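(* Fix rank conditions $r$ (with $n\ge1$). Suppose that for every tableau diagram $\{T_{ij}\}$ for $r$ and every path $\gamma$ that contains a down-step $(i,j-1)\to(i,j)$ immediately followed by an up-step $(i,j)\to(i+1,j)$, the following holds, where $T=T_{ij}$, $a=a_{ij}$, $b=b_{ij}$: for every factor sequence $(\dots,X,Y,\dots)$ for $\gamma$, with $X$ on that down-step and $Y$ on that up-step, such that $Y$ has at most $a$ rows, all entries of $X$ and $Y$ are strictly larger than all entries of $T$, $(X,Y)$ does not fit around $T$, and $S(X,T,Y)\neq0$, the sequence $(\dots,X',Y',\dots)$ obtained by replacing $X,Y$ with $X',Y'$ (defined below) is also a factor sequence for $\gamma$. Then for every tableau diagram for $r$, every path $\gamma$ of length $\ell$ and every sequence of partitions $\mu=(\mu_1,\dots,\mu_\ell)$, $c_\mu(\gamma)$ equals the number of factor sequences $(W_1,\dots,W_\ell)$ for $\gamma$ with $W_k$ of shape $\mu_k$ for all $k$.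
   Context: Rank conditions $r_{ij}$, $0\le i\le j\le n$: nonnegative integers with $r_{ij}\le\min(r_{i,j-1},r_{i+1,j})$ ($i<j$) and $r_{ij}-r_{i,j-1}-r_{i+1,j}+r_{i+1,j-1}\ge0$ ($j-i\ge2$). For $i<j$, $R_{ij}$ is the rectangle with $a_{ij}=r_{i+1,j}-r_{ij}$ rows and $b_{ij}=r_{i,j-1}-r_{ij}$ columns. Tableaux are semistandard with integer entries; $T\cdot U$ is the tableau product (row insertion of the row reading word of $U$, bottom row to top row, into $T$). A tableau diagram is a family $\{T_{ij}\}_{0\le i<j\le n}$, $T_{ij}$ of shape $R_{ij}$, with every entry of $T_{ij}$ strictly larger than every entry of $T_{kl}$ whenever $i\le k<l\le j$, $(k,l)\ne(i,j)$. $\Lambda=\mathbb Z[h_1,h_2,\dots]$, $h_0=1$, $h_m=0$ ($m<0$); $s_I=\det(h_{i_k+l-k})$ for an integer sequence $I=(i_1,\dots,i_p)$; $c^\mu_{\sigma\tau}$ are Littlewood–Richardson coefficients. Paths: vertices $(i,j)$, $0\le i\le j\le n$; steps: down $(i,j)\to(i,j+1)$, up $(i,j)\to(i+1,j)$, horizontal $(i,j)\to(i+1,j+1)$; a path is a sequence of steps from $(0,0)$ to $(n,n)$; length = number of steps. Lowest path: down from $(0,0)$ to $(0,n)$, then up to $(n,n)$. Every other path $\gamma$ arises from a lower path $\gamma'$ by Case 1 ($\gamma'$ has a horizontal step $(i,j)\to(i+1,j+1)$, $i<j$, replaced in $\gamma$ by up-step $(i,j)\to(i+1,j)$ and down-step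 $(i+1,j)\to(i+1,j+1)$) or Case 2 ($\gamma$ has a horizontal step $(i,j-1)\to(i+1,j)$, replaced in $\gamma'$ by down-step $(i,j-1)\to(i,j)$ and up-step $(i,j)\to(i+1,j)$; associated rectangle $R_{ij}$, tableau $T_{ij}$). $P_\gamma\in\Lambda^{\otimes\ell}$: identify $s_{I_1}\otimes\cdots\otimes s_{I_\ell}$ with the labeling of the steps of $\gamma$ (left to right) by $I_1,\dots,I_\ell$. Lowest path: $P=1\otimes\cdots\otimes1$. Case 1: $P_\gamma$ is obtained from $P_{\gamma'}$ by replacing each basis element with label $\mu$ on the horizontal step by $\sum_{\sigma,\tau}c^\mu_{\sigma\tau}$ (same element with labels $\sigma$ on the up-step, $\tau$ on the down-step). Case 2: replace each basis element with labels $\tau$ on the down-step and $\sigma$ on the up-step by $0$ if $\sigma$ has more than $a_{ij}$ parts, otherwise by the element with label $(b+\sigma_1,\dots,b+\sigma_a,\tau_1,\tau_2,\dots)$ on the horizontal step ($a=a_{ij}$, $b=b_{ij}$). This is independent of choices. Define $c_\mu(\gamma)$ by $P_\gamma=\sum_\mu c_\mu(\gamma)s_{\mu_1}\otimes\cdots\otimes s_{\mu_\ell}$ over sequences of partitions. Factor sequences (one tableau per step): lowest path: all empty. Otherwise pick lower $\gamma'$: Case 1: from a factor sequence $(\dots,W,\dots)$ of $\gamma'$ and any factorization $W=P\cdot Q$ get $(\dots,P,Q,\dots)$; Case 2: from $(\dots,Q,P,\dots)$ get $(\dots,Q\cdot T_{ij}\cdot P,\dots)$. All sequences so obtained (independent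 of $\gamma'$). Diagrams with weakly increasing rows: finite sequences of left-justified rows (empty allowed) filled with integers weakly increasing along rows; a violation is a box in row $\ge2$ with no box directly above or whose box above is not strictly smaller; $S(D)=s_I$ with $I$ the row lengths; $\operatorname{rect}(D)$ = product of the rows from bottom to top. Exchange operation between rows $k$ and $k+1$ (row $k+1$ containing a violation), of lengths $p$ and $q$: replace them by the unique pair of weakly increasing rows of lengths $q-1$ (row $k$) and $p+1$ (row $k+1$) whose product (new row $k+1$)$\cdot$(new row $k$) equals (old row $k+1$)$\cdot$(old row $k$). Violations are ordered: one at (row $i$, column $j$) is smaller than one at $(i',j')$ iff $j-i<j'-i'$, or $j-i=j'-i'$ and $i<i'$. $\mathcal P_a$ ($a\ge1$): pairs $(Q,P)$ of tableaux, $P$ with at most $a$ rows, such that $s_{(p_1,\dots,p_a,q_1,q_2,\dots)}\ne0$ (row lengths $p_k$ of $P$, $q_k$ of $Q$) and the diagram $D$ with $P$ in rows $1..a$ and $Q$ in rows $a+1,\dots$ is not a tableau. Fomin's involution on $\mathcal P_a$: exchange rows $a$ and $a+1$ of $D$; then, while the diagram has a violation outside row $a+1$, exchange the row of the minimal such violation with the row above it, and then exchange rows $a$ and $a+1$. At the end, $P'$ = rows $1..a$ and $Q'$ = the remaining rows; $(Q,P)\mapsto(Q',P')$. For $T=T_{ij}$ of shape $(b)^a$ and tableaux $X,Y$ with entries larger than those of $T$, $Y$ with at most $a$ rows: the diagram $(X,T,Y)$ has as row $k\le a$ the $k$-th row of $T$ followed by the $k$-th row of $Y$, and the rows of $X$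 below; $S(X,T,Y)=s_I$ for its row lengths $I$. $(X,Y)$ fits around $T$ iff this diagram is a tableau. If it does not and $S(X,T,Y)\ne0$, let $X=X_0\cdot\tilde X$ be the vertical cut after column $b$ ($X_0$ = first $b$ columns); then $(\tilde X,Y)\in\mathcal P_a$; let $(\tilde X',Y')$ be its image under Fomin's involution and $X'=X_0\cdot\tilde X'$. *)

(* Defs.v *)
From mathcomp Require Import all_boot all_order all_algebra.
From mathcomp Require Import finmap.
From mathcomp Require Import monalg.
From mathcomp Require Import boolp classical_sets functions cardinality fsbigop.

Set Implicit Arguments.
Unset Strict Implicit.
Unset Printing Implicit Defensive.

Import Order.TTheory GRing.Theory Num.Theory.
Local Open Scope classical_set_scope.
Local Open Scope ring_scope.

Definition rank_conditions (n : nat) (r : nat -> nat -> nat) : Prop :=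
  (forall i j : nat, (i < j <= n)%N -> (r i j <= minn (r i j.-1) (r i.+1 j))%N)
  /\ (forall i j : nat, (i.+2 <= j <= n)%N ->
       0 <= (r i j)%:Z - (r i j.-1)%:Z - (r i.+1 j)%:Z + (r i.+1 j.-1)%:Z).

(* Numbers of rows and of columns of the rectangle R_ij; under the rank
   conditions the truncated subtractions are exact. *)
Definition rect_rows (r : nat -> nat -> nat) (i j : nat) : nat :=
  (r i.+1 j - r i j)%N.
Definition rect_cols (r : nat -> nat -> nat) (i j : nat) : nat :=
  (r i j.-1 - r i j)%N.

(* A filled diagram is the list of its rows, from top to bottom; rows and
   columns are numbered from 0.  Rows beyond the end of the list are empty. *)
Definition diagram := seq (seq int).

Definition row_of (D : diagram) (i : nat) : seq int := nth [::] D i.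

Definition entries (D : diagram) : seq int := flatten D.

Definition violation (D : diagram) (i j : nat) : bool :=
  [&& (0 < i)%N, (j < size (row_of D i))%N &
    ~~ ((j < size (row_of D i.-1))%N &&
        (nth 0 (row_of D i.-1) j < nth 0 (row_of D i) j))].

(* "The diagram is a tableau", for a diagram whose rows weakly increase;
   empty rows at the bottom are harmless here. *)
Definition no_violation (D : diagram) : Prop := forall i j, ~~ violation D i j.

(* Semistandard tableaux, with no empty row in the list, so that equality of
   tableaux is equality of lists. *)
Definition is_tableau (T : diagram) : Prop :=
  [/\ [::] \notin T, all (sorted <=%R) T & no_violation T].

Definition drop_empty (D : diagram) : diagram := [seq u <- D | u != [::]].

Fixpoint row_insert (T : diagram) (x : int) : diagram :=
  match T with
  | [::] => [:: [:: x]]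
  | u :: T' =>
      let k := find (fun y => x < y) u in
      if (k < size u)%N then set_nth 0 u k x :: row_insert T' (nth 0 u k)
      else rcons u x :: T'
  end.

Definition reading_word (U : diagram) : seq int := flatten (rev U).

Definition tmul (T U : diagram) : diagram := foldl row_insert T (reading_word U).

Definition row_tableau (u : seq int) : diagram := drop_empty [:: u].

(* The exchange operation between row k-1 and row k. *)
Definition exchange (k : nat) (D D' : diagram) : Prop :=
  (exists j, violation D k j) /\
  exists u v : seq int,
    [/\ size u = (size (row_of D k)).-1, size v = (size (row_of D k.-1)).+1,
        sorted <=%R u /\ sorted <=%R v,
        tmul (row_tableau v) (row_tableau u) =
          tmul (row_tableau (row_of D k)) (row_tableau (row_of D k.-1))
      & D' = set_nth [::] (set_nth [::] D k.-1 u) k v].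

Definition violation_le (i j i' j' : nat) : Prop :=
  (j%:Z - i%:Z < j'%:Z - i'%:Z) \/
  (j%:Z - i%:Z = j'%:Z - i'%:Z /\ (i <= i')%N).

(* The minimal violation of D outside the row of index a, which is the
   (a+1)-st row. *)
Definition min_violation_off (a : nat) (D : diagram) (i j : nat) : Prop :=
  [/\ violation D i j, i <> a &
    forall i' j', violation D i' j' -> i' <> a -> violation_le i j i' j'].

Inductive fomin_loop (a : nat) : diagram -> diagram -> Prop :=
| fomin_stop D :
    (forall i j, violation D i j -> i = a) -> fomin_loop a D D
| fomin_step D D1 D2 D' i j :
    min_violation_off a D i j -> exchange i D D1 -> exchange a D1 D2 ->
    fomin_loop a D2 D' -> fomin_loop a D D'.

(* P in the first a rows (padded with empty rows), Q below. *)
Definition stack (a : nat) (P Q : diagram) : diagram := mkseq (row_of P) a ++ Q.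

(* (Q', P') is the image of (Q, P) under Fomin's involution. *)
Definition fomin (a : nat) (Q P Q' P' : diagram) : Prop :=
  exists D1 D2,
    [/\ exchange a (stack a P Q) D1, fomin_loop a D1 D2,
        Q' = drop_empty (drop a D2) & P' = drop_empty (take a D2)].

Definition around (a : nat) (X T Y : diagram) : diagram :=
  mkseq (fun k => row_of T k ++ row_of Y k) a ++ X.

Definition fits_around (a : nat) (X T Y : diagram) : Prop :=
  no_violation (around a X T Y).

(* The first b columns of X, and the remaining ones. *)
Definition left_cut (b : nat) (X : diagram) : diagram :=
  drop_empty (map (take b) X).
Definition right_cut (b : nat) (X : diagram) : diagram :=
  drop_empty (map (drop b) X).

(* (X', Y') is the pair attached to (X, Y), where T is an a x b rectangle. *)
Definition fomin_around (a b : nat) (X Y X' Y' : diagram) : Prop :=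
  exists2 X1, fomin a (right_cut b X) Y X1 Y' & X' = tmul (left_cut b X) X1.

Definition entries_above (T X : diagram) : Prop :=
  forall x t, x \in entries X -> t \in entries T -> t < x.

Definition tableau_diagram (n : nat) (r : nat -> nat -> nat)
    (T : nat -> nat -> diagram) : Prop :=
  (forall i j, (i < j <= n)%N ->
     is_tableau (T i j) /\
     (* as a partition, an a x 0 rectangle is the empty partition *)
     shape (T i j) = [seq m <- nseq (rect_rows r i j) (rect_cols r i j) | m != 0%N])
  /\ (forall i j k l, (j <= n)%N -> (i <= k < l)%N -> (l <= j)%N ->
       (k, l) <> (i, j) -> entries_above (T k l) (T i j)).

Inductive step := Down | Up | Horiz.

Definition move (v : nat * nat) (s : step) : nat * nat :=
  match s with
  | Down => (v.1, v.2.+1)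
  | Up => (v.1.+1, v.2)
  | Horiz => (v.1.+1, v.2.+1)
  end.

(* The vertex reached from (0,0). *)
Definition endpoint (g : seq step) : nat * nat := foldl move (0%N, 0%N) g.

Definition is_path (n : nat) (g : seq step) : Prop :=
  (forall k, ((endpoint (take k g)).1 <= (endpoint (take k g)).2 <= n)%N)
  /\ endpoint g = (n, n).

Definition lowest_path (n : nat) : seq step := nseq n Down ++ nseq n Up.

Inductive factor_seq (n : nat) (T : nat -> nat -> diagram) :
    seq step -> seq diagram -> Prop :=
| factor_lowest :
    factor_seq n T (lowest_path n) (nseq (size (lowest_path n)) [::])
| factor_split g1 g2 W1 W2 P Q :
    ((endpoint g1).1 < (endpoint g1).2)%N -> size W1 = size g1 ->
    is_tableau P -> is_tableau Q ->
    factor_seq n T (g1 ++ Horiz :: g2) (W1 ++ tmul P Q :: W2) ->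
    factor_seq n T (g1 ++ Up :: Down :: g2) (W1 ++ P :: Q :: W2)
| factor_merge g1 g2 W1 W2 Q P (i := (endpoint g1).1) (j := (endpoint g1).2.+1) :
    size W1 = size g1 ->
    factor_seq n T (g1 ++ Down :: Up :: g2) (W1 ++ Q :: P :: W2) ->
    factor_seq n T (g1 ++ Horiz :: g2) (W1 ++ tmul (tmul Q (T i j)) P :: W2).

(* Sym l is the l-th tensor power of Z[h_1, h_2, ...], realized as the
   polynomial ring over Z on generators indexed by 'I_l * nat; the generator of
   index (k, m) is h_(m+1) in the k-th tensor factor. *)
Notation Sym l := {malg int[{cmonom ('I_l * nat)%type}]}.

Definition hsym (l : nat) (k : 'I_l) (m : int) : Sym l :=
  match m with
  | Posz 0 => 1
  | Posz m'.+1 => << ucm (k, m') >>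
  | Negz _ => 0
  end.

Definition schur (l : nat) (k : 'I_l) (I : seq int) : Sym l :=
  \det (\matrix_(x < size I, y < size I) hsym k (I`_x + y%:Z - x%:Z)).

(* s_(I_1) (x) ... (x) s_(I_l): a pure tensor is the product of its factors. *)
Definition schur_tensor (l : nat) (I : seq (seq nat)) : Sym l :=
  \prod_(k < l) schur k (map Posz (nth [::] I k)).

(* S(D) <> 0, read in a single tensor factor. *)
Definition schur_nonzero (D : diagram) : Prop :=
  schur_tensor 1 [:: shape D] != 0.

Definition is_partition (p : seq nat) : bool :=
  sorted geq p && (0%N \notin p).

Definition is_schur_expansion (l : nat) (f : Sym l)
    (c : {malg int[seq (seq nat)]}) : Prop :=
  (forall mu, mu \in msupp c -> size mu = l /\ all is_partition mu) /\
  f = \sum_(mu <- msupp c) c@_mu *: schur_tensor l mu.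

(* The expansion exists and is unique, the Schur tensors being a Z-basis. *)
Definition schur_expansion (l : nat) (f : Sym l) : {malg int[seq (seq nat)]} :=
  xget 0 [set c | is_schur_expansion f c].

Definition schur_coef (l : nat) (f : Sym l) (mu : seq (seq nat)) : int :=
  (schur_expansion f)@_mu.

(* The Littlewood-Richardson coefficient of s_mu in s_sigma s_tau. *)
Definition lr_coef (mu sigma tau : seq nat) : int :=
  schur_coef (schur_tensor 1 [:: sigma] * schur_tensor 1 [:: tau]) [:: mu].

(* The linear map with the given values on the basis of Schur tensors. *)
Definition linear_ext (l m : nat) (phi : seq (seq nat) -> Sym m) (f : Sym l) :
    Sym m :=
  \sum_(mu <- msupp (schur_expansion f)) schur_coef f mu *: phi mu.

(* Effect on a basis element of replacing the horizontal step of index k by an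
   up-step and a down-step.  The sums have finite support. *)
Definition split_value (m k : nat) (mu : seq (seq nat)) : Sym m :=
  \sum_(sigma \in [set` is_partition]) \sum_(tau \in [set` is_partition])
    lr_coef (nth [::] mu k) sigma tau *:
      schur_tensor m (take k mu ++ sigma :: tau :: drop k.+1 mu).

(* Effect on a basis element of replacing the down-step of index k and the
   up-step of index k+1 by a horizontal step; the new label need not be a
   partition. *)
Definition merge_value (m a b k : nat) (mu : seq (seq nat)) : Sym m :=
  let tau := nth [::] mu k in
  let sigma := nth [::] mu k.+1 in
  if (size sigma <= a)%N then
    schur_tensor m
      (take k mu ++ (mkseq (fun x => b + nth 0 sigma x)%N a ++ tau)
         :: drop k.+2 mu)
  else 0.

Inductive path_poly (n : nat) (r : nat -> nat -> nat) :
    forall g : seq step, Sym (size g) -> Prop :=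
| path_poly_lowest : @path_poly n r (lowest_path n) 1
| path_poly_split g1 g2 (P : Sym (size (g1 ++ Horiz :: g2))) :
    ((endpoint g1).1 < (endpoint g1).2)%N ->
    path_poly n r P ->
    @path_poly n r (g1 ++ Up :: Down :: g2)
      (linear_ext (split_value _ (size g1)) P)
| path_poly_merge g1 g2 (P : Sym (size (g1 ++ Down :: Up :: g2)))
    (i := (endpoint g1).1) (j := (endpoint g1).2.+1) :
    path_poly n r P ->
    @path_poly n r (g1 ++ Horiz :: g2)
      (linear_ext
         (merge_value _ (rect_rows r i j) (rect_cols r i j) (size g1)) P).

(* P_gamma; path_poly determines it, whichever lower paths are chosen. *)
Definition P_of (n : nat) (r : nat -> nat -> nat) (g : seq step) :
    Sym (size g) :=
  xget 0 [set P | path_poly n r P].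

Definition c_of (n : nat) (r : nat -> nat -> nat) (g : seq step)
    (mu : seq (seq nat)) : int :=
  schur_coef (P_of n r g) mu.

(* Main.v *)
(* By induction along the path, P_gamma is the sum, over all factor sequences W for
   gamma, of the tensors of Schur functions of the shapes of W.

   Case 1.  A functional Phi on the tensor power is attached to each sequence of
   tableaux: multiplying by h_m amounts to splitting off a row of m letters on the
   right.  The exchange at the minimal violation is a sign-reversing involution on
   the terms of the Jacobi-Trudi determinant, so multiplying by s_lambda splits off
   a tableau of shape lambda.  Hence the Schur tensors are independent, and
   c^mu_(sigma, tau) counts the factorizations of any tableau of shape mu into
   tableaux of shapes sigma and tau.

   Case 2.  Fomin's involution changes the sign of S(X, T, Y), so only the pairs
   that fit around T survive.  Such a pair is determined by V = X . T . Y: the rows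
   of V below the a-th form X and the first a rows are T and Y.  That each factor
   sequence for gamma comes from a fitting pair follows once factor sequences are
   closed under the moves (X, Y) -> (X . Y_bot, Y_top) and
   (X, Y) -> (X_left, X_right . Y), where Y_top has the first a rows of Y and X_left
   the first b columns of X.  This is an induction on the height of the path.  Moves
   at distinct corners commute; in the remaining case the corner has up-steps before
   it and down-steps after it, both neighbouring corners are undone, canonical
   factors are chosen there, and since a_(i,j) decreases in j and b_(i,j)
   increases in i, Y_bot (or X_right) can be passed across the corner below. *)

From HB Require Import structures.
From mathcomp Require Import all_boot all_order all_fingroup all_algebra zify.
From mathcomp Require Import finmap monalg.
From mathcomp Require Import boolp classical_sets functions cardinality fsbigop.
Require Import Defs.

Set Implicit Arguments.
Unset Strict Implicit.
Unset Printing Implicit Defensive.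

Import Order.TTheory GRing.Theory Num.Theory.
Local Open Scope ring_scope.

(** * Insertion and the plactic relations *)

(** The two halves of Case 2 have different sources. The hypothesis of the theorem serves only to
    cancel the pairs that do not fit. That the fitting pairs reach every factor sequence is proved
    without it, and is the harder half: a factor sequence records only the product around [T], so a
    pair in canonical position has to be found among all the pairs with this product. Alternating
    the two moves finds one, because the first [b] columns of the left factor gain boxes while the
    total number of boxes is constant. Fomin's map is not shown to be an involution. It is shown to
    be injective on the pairs that do not fit, to keep them so, and to change the sign; the sum over
    a finite set then equals its own negative in a torsion-free group. Termination and injectivity
    both come from the fact that each exchange can be undone and that its row can be read off from
    the result. Statements on columns are obtained from those on rows by the boolean [s], which
    replaces the weak order by the strict one. *)

(* Row insertion uses [s = false]; [s = true] gives column insertion, acting on the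
   list of the columns of a tableau and on reversed words. *)
Definition lei (s : bool) : rel int := fun x y => if s then x < y else x <= y.

(* [count] at the plain type [int], so that [lia] identifies its atoms. *)
Definition occ (p : pred int) (u : seq int) : nat := count p u.

Lemma occP (u v : seq int) : reflect (forall p, occ p u = occ p v) (perm_eq u v).
Proof. exact: seq.permP. Qed.

Lemma occ_cat p (u v : seq int) : occ p (u ++ v) = (occ p u + occ p v)%N.
Proof. exact: count_cat. Qed.

Lemma occ_cons p (x : int) u : occ p (x :: u) = (p x + occ p u)%N.
Proof. by []. Qed.

Lemma occ_nil p : occ p [::] = 0%N. Proof. by []. Qed.

Definition occE := (occ_cat, occ_cons, occ_nil).

Ltac lia_lei := rewrite ?/lei; lia.

Section Insertion.
Variable s : bool.
Notation e := (lei s).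

(** The second component holds the bumped letter, or is empty when [x] is appended. As a list it
    makes the output of a whole word a concatenation in [rbumpw]. *)
Fixpoint rbump (u : seq int) (x : int) : seq int * seq int :=
  if u is y :: u' then
    if e y x then (y :: (rbump u' x).1, (rbump u' x).2) else (x :: u', [:: y])
  else ([:: x], [::]).

Fixpoint rbumpw (u w : seq int) : seq int * seq int :=
  if w is x :: w' then
    ((rbumpw (rbump u x).1 w').1, (rbump u x).2 ++ (rbumpw (rbump u x).1 w').2)
  else (u, [::]).

Fixpoint ins (T : diagram) (x : int) : diagram :=
  if T is u :: T' then
    (rbump u x).1 :: (if (rbump u x).2 is y :: _ then ins T' y else T')
  else [:: [:: x]].

Definition insw (T : diagram) (w : seq int) : diagram := foldl ins T w.

Lemma insw_cat T w1 w2 : insw T (w1 ++ w2) = insw (insw T w1) w2.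
Proof. exact: foldl_cat. Qed.

Lemma bump_out u x : (size (rbump u x).2 <= 1)%N.
Proof. by elim: u => //= y u IH; case: (e y x). Qed.

(** The rows of [T] only see the letters bumped out of [u], in their order, so the whole word can
    pass through [u] before any of them moves on. Later arguments treat insertion row by row in this
    way. *)
Lemma insw_cons u T w :
  insw (u :: T) w = (rbumpw u w).1 :: insw T (rbumpw u w).2.
Proof.
elim: w u T => // x w IH u T; rewrite /insw /= -/(insw _ _) IH /insw foldl_cat.
by case: (rbump u x).2 (bump_out u x) => [|y []].
Qed.

Lemma insw_nil w : w != [::] ->
  insw [::] w = (rbumpw [::] w).1 :: insw [::] (rbumpw [::] w).2.
Proof. by case: w => // x w _; rewrite -insw_cons. Qed.

Lemma bumpw_cat u w1 w2 :
  rbumpw u (w1 ++ w2) = ((rbumpw (rbumpw u w1).1 w2).1,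
                        (rbumpw u w1).2 ++ (rbumpw (rbumpw u w1).1 w2).2).
Proof. by elim: w1 u => [|x w1 IH] u /=; rewrite -?surjective_pairing // IH catA. Qed.

Lemma perm_bump u x : perm_eq ((rbump u x).1 ++ (rbump u x).2) (x :: u).
Proof.
apply/occP => p; elim: u => [|y u IH] //=; move: IH.
by case: (e y x); rewrite /= !occE; lia.
Qed.

Lemma perm_bumpw u w : perm_eq ((rbumpw u w).1 ++ (rbumpw u w).2) (u ++ w).
Proof.
apply/occP => p; elim: w u => [|x w IH] u //=.
have /occP/(_ p) := perm_bump u x; move: (IH (rbump u x).1).
by rewrite !occE; lia.
Qed.

Lemma size_bumpw u w :
  (size (rbumpw u w).1 + size (rbumpw u w).2 = size u + size w)%N.
Proof. by rewrite -!size_cat (perm_size (perm_bumpw u w)). Qed.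

Lemma bumpw_nonempty u w : (0 < size u)%N -> (0 < size (rbumpw u w).1)%N.
Proof.
elim: w u => //= x w IH u hu; apply: IH.
by case: u hu => //= y u _; case: (e y x).
Qed.

Lemma perm_insw T w : perm_eq (flatten (insw T w)) (flatten T ++ w).
Proof.
apply/occP => p; elim: T w => [|u T IH] w; last first.
  rewrite insw_cons /=; have /occP/(_ p) := perm_bumpw u w.
  by move: (IH (rbumpw u w).2); rewrite !occE; lia.
(* Induction on the length: the new first row keeps at least one letter, so the word passed on is
   strictly shorter. *)
elim: {w}(size w).+1 {-2}w (ltnSn (size w)) => [|n IH] [|x w] // sw.
rewrite insw_nil //=; have /occP/(_ p) := perm_bumpw [:: x] w.
have szw := size_bumpw [:: x] w; have hp := @bumpw_nonempty [:: x] w isT.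
rewrite !occE IH ?occE //=; first by lia.
by move: sw szw hp => /=; lia.
Qed.

(* [knuth1] for s = false are the Knuth relations; for s = true they are the
   Knuth relations of the reversed words. *)
Inductive knuth1 : seq int -> seq int -> Prop :=
| Knuth1 x y z : ~~ e y x -> e y z -> knuth1 [:: y; z; x] [:: y; x; z]
| Knuth2 x y z : e x y -> ~~ e z y -> knuth1 [:: x; z; y] [:: z; x; y].

Inductive plact : seq int -> seq int -> Prop :=
| plact_step u v a b : knuth1 a b -> plact (u ++ a ++ v) (u ++ b ++ v)
| plact_refl a : plact a a
| plact_sym a b : plact a b -> plact b a
| plact_trans a b c : plact a b -> plact b c -> plact a c.

Lemma plact_cat u v a b : plact a b -> plact (u ++ a ++ v) (u ++ b ++ v).
Proof.
elim=> {a b} [u' v' a b ab|a|a b _ IH|a b c _ IH1 _ IH2].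
- by rewrite -!catA !(catA u); apply: plact_step.
- exact: plact_refl.
- exact: plact_sym.
- exact: plact_trans IH1 IH2.
Qed.

Lemma plact_catl u a b : plact a b -> plact (u ++ a) (u ++ b).
Proof. by move=> /(plact_cat u [::]); rewrite !cats0. Qed.

Lemma plact_catr v a b : plact a b -> plact (a ++ v) (b ++ v).
Proof. exact: (@plact_cat [::]). Qed.

Lemma perm_plact a b : plact a b -> perm_eq a b.
Proof.
elim=> {a b} // [u v a b ab|a b _ IH|a b c _ IH1 _ IH2].
- by rewrite perm_cat2l perm_cat2r; case: ab => x y z _ _; apply/occP => p; rewrite !occE; lia.
- by rewrite perm_sym.
- exact: perm_trans IH1 IH2.
Qed.

Lemma lei_trans : transitive e.
Proof. by move=> y x z; case: s; lia_lei. Qed.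

Lemma lei_negr a b c : e a b -> ~~ e c b -> e a c.
Proof. by case: s; lia_lei. Qed.

Lemma lei_negl a b c : ~~ e b a -> e b c -> e a c.
Proof. by case: s; lia_lei. Qed.

Lemma lei_neg_trans a b c : ~~ e b a -> ~~ e c b -> ~~ e c a.
Proof. by case: s; lia_lei. Qed.

Lemma sorted_bump u x : sorted e u -> sorted e (rbump u x).1.
Proof.
have lt_e := @lei_trans.
rewrite !sorted_pairwise //; elim: u => //= y u IH /andP[yu su].
case: ifPn => /= yx; first rewrite IH // andbT.
  have: all (e y) ((rbump u x).1 ++ (rbump u x).2) by rewrite (perm_all _ (perm_bump u x)) /= yx.
  by rewrite all_cat => /andP[].
rewrite su andbT; apply: sub_all yu => z.
by move: yx; case: s; lia_lei.
Qed.

Lemma sorted_bumpw u w : sorted e u -> sorted e (rbumpw u w).1.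
Proof. by elim: w u => //= x w IH u su; apply/IH/sorted_bump. Qed.

Lemma sorted_ins T x : all (sorted e) T -> all (sorted e) (ins T x).
Proof.
elim: T x => //= u T IH x /andP[su sT]; rewrite sorted_bump //=.
by case: (rbump u x).2 => // y _; apply: IH.
Qed.

Lemma sorted_insw T w : all (sorted e) T -> all (sorted e) (insw T w).
Proof. by elim: w T => //= x w IH T sT; apply/IH/sorted_ins. Qed.

Variant bump_spec (u : seq int) (x : int) : seq int * seq int -> Type :=
| BumpEnd of all (e^~ x) u : bump_spec u x (rcons u x, [::])
| BumpAt u1 b u2 of u = u1 ++ b :: u2 & all (e^~ x) u1 & ~~ e b x :
    bump_spec u x (u1 ++ x :: u2, [:: b]).

Lemma bumpP u x : bump_spec u x (rbump u x).
Proof.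
elim: u => [|y u IH] /=; first exact: BumpEnd.
case: ifPn => yx; last exact: (@BumpAt _ _ [::]).
case: IH => [h|u1 b u2 -> h1 h2] /=; first by apply: BumpEnd; rewrite /= yx.
by apply: (@BumpAt _ _ (y :: u1)); rewrite //= yx.
Qed.

Lemma bump_at u1 b u2 x : all (e^~ x) u1 -> ~~ e b x ->
  rbump (u1 ++ b :: u2) x = (u1 ++ x :: u2, [:: b]).
Proof.
elim: u1 => [|y u1 IH] /=; first by move=> _ /negPf->.
by case/andP=> -> h1 h2; rewrite IH.
Qed.

Lemma bump_end u x : all (e^~ x) u -> rbump u x = (rcons u x, [::]).
Proof. by elim: u => //= y u IH /andP[-> h]; rewrite IH. Qed.

End Insertion.

(** * Knuth equivalence and insertion tableaux *)

Section KnuthInvariance.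
Variable s : bool.
Notation e := (lei s).
Notation rbump := (rbump s).
Notation rbumpw := (rbumpw s).
Notation insw := (insw s).
Notation knuth1 := (knuth1 s).
Notation plact := (plact s).

(** Row bumping lemma, weak case: [z] enters to the right of [y], so it bumps only if [y] did, and
    then a letter further right in the row. *)
Lemma bump_row_up u y z : sorted e u -> e y z ->
  match (rbump u y).2, (rbump (rbump u y).1 z).2 with
  | b :: _, d :: _ => e b d
  | [::], _ :: _ => false
  | _, _ => true
  end.
Proof.
move=> su yz; elim: u su => [|c u IH] //=; first by rewrite yz.
move=> su; have su' := path_sorted su.
case: ifPn => /= cy.
  have -> /= : e c z by move: cy yz; clear; case: s; lia_lei.
  exact: IH.
rewrite yz /=; case: (bumpP s u z) => [_|u1 d u2 uE _ _] //=.
move: su; rewrite (path_sortedE (@lei_trans s)) => /andP[/allP h _].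
by apply: h; rewrite uE mem_cat inE eqxx orbT.
Qed.

(** Row bumping lemma, strict case: [y] enters at or before the place taken by [z], so it always
    bumps a letter, and one that precedes the letter bumped by [z]. *)
Lemma bump_row_down u y z : ~~ e z y ->
  if (rbump (rbump u z).1 y).2 is f :: _ then
    if (rbump u z).2 is d :: _ then ~~ e d f else true
  else false.
Proof.
move=> zy; elim: u => [|c u IH] /=; first by rewrite (negPf zy).
case: ifPn => /= cz; last by rewrite (negPf zy) /=.
case: ifPn => /= cy; first exact: IH.
case: (bumpP s u z) => [|u1 b u2 _ _] //= bz.
by move: cz bz; clear; case: s; lia_lei.
Qed.

(** This reduces the invariance of insertion under Knuth moves to an induction over the rows. The
    proof follows the first letter [c] of the row: if the smallest of the three letters does not
    bump it, [c] stays and the tail decides; otherwise [c] is bumped, and the row bumping lemmas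
    govern what comes out of the tail. *)
Lemma bumpw_knuth u a b : sorted e u -> knuth1 a b ->
  (rbumpw u a).1 = (rbumpw u b).1 /\
  [\/ (rbumpw u a).2 = (rbumpw u b).2, knuth1 (rbumpw u a).2 (rbumpw u b).2
    | knuth1 (rbumpw u b).2 (rbumpw u a).2].
Proof.
move=> + K; case: K => {a b} x y z.
- move=> yx yz.
  have xz : e x z := lei_negl yx yz.
  elim: u => [|c u IH] su.
    by do 2 rewrite /= ?yz ?(negPf yx) /= ?xz; split=> //; constructor.
  have su' := path_sorted su; rewrite /=.
  have cu v : v \in u -> e c v.
    by move: su; rewrite /= (path_sortedE (@lei_trans s)) => /andP[/allP h _]; apply: h.
  case: (boolP (e c x)) => cx.
    have cy := lei_negr cx yx; have cz := lei_trans cx xz.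
    do 3 rewrite ?cx ?cy ?cz /=.
    by have [/= -> h2] := IH su'; split.
  case: (boolP (e c y)) => cy /=.
    have cz := lei_trans cy yz.
    do 2 rewrite ?cz ?(negPf cx) /= ?xz /=; split=> //.
    have := bump_row_up su' yz.
    case: (bumpP s u y) => [_|u1 b u2 uE h1 h2] /=.
      by case: (rbump _ z).2 => //; constructor.
    case: (rbump _ z) (bump_out s (u1 ++ y :: u2) z) => v [|d []] //= _; first by constructor.
    move=> bd; constructor 2; apply: Knuth1 => //.
    apply: contra h2 => h; exact: lei_trans h cy.
  do 2 rewrite ?yz ?(negPf yx) /= ?xz; split=> //.
  case: (bumpP s u z) => [_|u1 b u2 uE h1 h2] /=; first by constructor.
  constructor 2; apply: Knuth1 => //.
  by apply: cu; rewrite uE mem_cat inE eqxx orbT.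
- move=> xy zy.
  have xz : e x z := lei_negr xy zy.
  have zx : ~~ e z x by apply: contra zy => zx; exact: lei_trans zx xy.
  elim: u => [|c u IH] su.
    by do 2 rewrite /= ?xz ?xy ?(negPf zy) ?(negPf zx) /=; split=> //; constructor.
  have su' := path_sorted su; rewrite /=.
  have cu v : v \in u -> e c v.
    by move: su; rewrite /= (path_sortedE (@lei_trans s)) => /andP[/allP h _]; apply: h.
  case: (boolP (e c x)) => cx.
    have cy := lei_trans cx xy; have cz := lei_trans cx xz.
    do 3 rewrite ?cx ?cy ?cz /=.
    by have [/= -> h2] := IH su'; split.
  rewrite /= xz /= xy /=; case: (boolP (e c z)) => cz /=.
    rewrite (negPf cx) /= xy /=; split=> //.
    have := bump_row_down u zy.
    case: (bumpP s u z) => [_|u1 b u2 uE h1 h2] /=.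
      by case: (rbump _ y).2 => //; constructor.
    case: (bumpP s (u1 ++ z :: u2) y) => [_|w1 f w2 wE h3 h4] //= bf.
    constructor 2; apply: Knuth2 => //.
    have: f \in u1 ++ z :: u2 by rewrite wE mem_cat inE eqxx orbT.
    rewrite mem_cat inE => /or3P[fu|/eqP->//|fu]; apply: cu; rewrite uE mem_cat ?fu //.
    by rewrite inE fu !orbT.
  rewrite (negPf zx) /= xy /=; case: u {IH su'} su cu => [|d u] /= su cu.
    by rewrite (negPf zy); split=> //; constructor.
  have cd : e c d by apply: cu; rewrite inE eqxx.
  have dz : ~~ e d z by apply: contra cz; exact: lei_trans.
  have dy : ~~ e d y by move: cd dz zy cz; clear; case: s; lia_lei.
  rewrite (negPf dz) (negPf dy) /= (negPf zy) /=; split=> //.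
  by constructor 2; apply: Knuth1.
Qed.

Lemma size_knuth a b : knuth1 a b -> size a = 3%N /\ size b = 3%N.
Proof. by case. Qed.

Lemma insw_knuth T a b : all (sorted e) T -> knuth1 a b -> insw T a = insw T b.
Proof.
elim: T a b => [|u T IH] a b /=.
  move=> _ K; have [na nb] : a != [::] /\ b != [::] by case: K.
  rewrite (insw_nil s na) (insw_nil s nb); have [] := @bumpw_knuth [::] a b isT K => ->.
  have h1 := size_bumpw s [::] a; have h2 := size_bumpw s [::] b.
  have k1 (c : seq int) : c != [::] -> (0 < size (rbumpw [::] c).1)%N.
    by case: c => [//|x c] _; exact: (@bumpw_nonempty s [:: x] c).
  have {}k1a := k1 a na; have {}k1b := k1 b nb; have [sza szb] := size_knuth K.
  move: h1 h2 k1a k1b; rewrite sza szb.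
  (* In an empty row at least one of the three letters stays, so at most two come out, too few for a
     Knuth relation. *)
  by move=> /= h1 h2 k1a k1b [->//|/size_knuth[]|/size_knuth[]]; lia.
case/andP=> su sT K; rewrite !insw_cons.
have [-> [->|K2|K2]] := bumpw_knuth su K => //; congr (_ :: _); first exact: IH.
by symmetry; apply: IH.
Qed.

Lemma insw_plact T a b : all (sorted e) T -> plact a b -> insw T a = insw T b.
Proof.
move=> sT H; elim: H T sT => {a b} [u v a b ab|//|a b _ IH|a b c _ IH1 _ IH2] T sT.
- rewrite !insw_cat; congr (insw _ _); apply: insw_knuth ab; exact: sorted_insw.
- by rewrite IH.
- by rewrite IH1 ?IH2.
Qed.

(** [x] moves left past the letters after [b] by the first relation; then [b] moves left past the
    letters before it by the second. *)
Lemma plact_bump u x : sorted e u -> plact (u ++ [:: x]) ((rbump u x).2 ++ (rbump u x).1).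
Proof.
move=> su; case: bumpP => [_|u1 b u2 uE h1 h2] /=; first by rewrite cats1; exact: plact_refl.
move: su; rewrite uE sorted_pairwise; last exact: lei_trans.
rewrite pairwise_cat => /and3P[h3 su1] /= /andP[h4 h5].
have step1 : plact (b :: u2 ++ [:: x]) (b :: x :: u2).
  have {h3 uE}: sorted e (b :: u2) by rewrite (sorted_pairwise (@lei_trans s)) /= h4.
  elim/last_ind: u2 h4 {h5} => [|u2 c IH]; first by move=> _ _; exact: plact_refl.
  rewrite all_rcons -rcons_cons => /andP[bc h4] su2.
  have [su3 ec] : sorted e (b :: u2) /\ e (last b u2) c.
    by move: su2; rewrite rcons_cons /= rcons_path => /andP[].
  rewrite -cats1; have H1 := plact_catr [:: c] (IH h4 su3).
  rewrite /= -catA /= in H1; apply: plact_trans H1; rewrite -catA /=.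
  rewrite -!(cat_cons b) lastI -cats1 -!catA; apply: plact_catl => /=.
  apply: (@plact_step _ [::] [::] [:: _; c; x] [:: _; x; c]); apply: Knuth1 => //.
  apply: contra h2 => h; case: (u2) h4 h => //= c' u3 /(allP (s := c' :: u3)) h4.
  by apply: lei_trans; apply: h4; exact: mem_last.
apply: (@plact_trans _ _ (u1 ++ b :: x :: u2)).
  by rewrite -catA; apply: plact_catl.
elim/last_ind: u1 x h2 u2 {uE h3 h4 h5 step1} h1 su1 => [|u1 a IH] x h2 u2.
  by move=> _ _; exact: plact_refl.
rewrite all_rcons pairwise_rcons => /andP[ax h1] /andP[h3 h4].
rewrite -cats1 -!catA /=; apply: (@plact_trans _ _ (u1 ++ b :: a :: x :: u2)).
  by apply: (@plact_step _ u1 u2 [:: a; b; x] [:: b; a; x]); exact: Knuth2.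
by apply: IH => //; apply: contra h2 => h; exact: lei_trans ax.
Qed.

Lemma plact_ins T x : all (sorted e) T ->
  plact (reading_word T ++ [:: x]) (reading_word (ins s T x)).
Proof.
elim: T x => [|u T IH] x /=; first by move=> _; exact: plact_refl.
case/andP=> su sT; rewrite /reading_word !rev_cons !flatten_rcons -catA.
apply: plact_trans (plact_catl _ (plact_bump x su)) _.
rewrite catA; apply: plact_catr.
case: (rbump u x).2 (bump_out s u x) => [|y []] // _; first by rewrite cats0; exact: plact_refl.
exact: IH.
Qed.

Lemma plact_insw T w : all (sorted e) T ->
  plact (reading_word T ++ w) (reading_word (insw T w)).
Proof.
elim: w T => [|x w IH] T sT /=; first by rewrite cats0; exact: plact_refl.
rewrite -cat1s catA; apply: plact_trans (plact_catr _ (plact_ins x sT)) _.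
by apply: IH; exact: sorted_ins.
Qed.

Definition P (w : seq int) : diagram := insw [::] w.

Lemma plact_P w : plact w (reading_word (P w)).
Proof. exact: (@plact_insw [::]). Qed.

Lemma P_plact w w' : plact w w' -> P w = P w'.
Proof. exact: insw_plact. Qed.

Lemma plact_of_P w w' : P w = P w' -> plact w w'.
Proof.
move=> h; apply: plact_trans (plact_P w) _; rewrite h; apply: plact_sym; exact: plact_P.
Qed.

(* [v] may stand directly below [u] (for [s = true], directly to its right). *)
Fixpoint dom (u v : seq int) : bool :=
  match u, v with
  | _, [::] => true
  | [::], _ => false
  | a :: u', b :: v' => ~~ e b a && dom u' v'
  end.

Fixpoint tabl (T : diagram) : bool :=
  if T is u :: T' then
    [&& u != [::], sorted e u, dom u (head [::] T') & tabl T']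
  else true.

Lemma dom0 u : dom u [::]. Proof. by case: u. Qed.

Lemma dom_size u v : dom u v -> (size v <= size u)%N.
Proof. by elim: u v => [|a u IH] [|b v] //= /andP[_ /IH]. Qed.

Lemma domP (u v : seq int) : reflect ((size v <= size u)%N /\ forall k, (k < size v)%N -> ~~ e (nth 0 v k) (nth 0 u k)) (dom u v).
Proof.
apply: (iffP idP).
  move=> h; split; first exact: dom_size.
  elim: u v h => [|a u IH] [|b v] //= /andP[h1 h2] [|k] //=; rewrite ltnS; exact: IH.
elim: u v => [|a u IH] [|b v] //= [h1 h2] //.
by rewrite (h2 0%N) //=; apply: IH; split=> // k hk; apply: (h2 k.+1).
Qed.

Lemma dom_bump_end t u y : dom t u -> (rbump t y).2 = [::] -> dom (rbump t y).1 u.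
Proof.
elim: t u => [|a t IH] [|b u] //=; first by rewrite dom0.
case: (e a y) => //= /andP[-> h] /IH; exact.
Qed.

(** The letter bumped out of [t] moves weakly to the left on entering the row below, because below
    its old place stands a larger letter or none. Above its new place there is then a smaller
    letter. *)
Lemma dom_bump t u y x : dom t u -> (rbump t y).2 = [:: x] ->
  dom (rbump t y).1 (rbump u x).1.
Proof.
elim: t u => [|a t IH] //= u; case: ifPn => ay /=.
  move=> tu bx; have xy : ~~ e x y.
    by case: (bumpP s t y) bx => //= u1 b u2 _ _ h [<-].
  have xa : ~~ e x a by apply: contra xy => h; exact: lei_trans ay.
  case: u tu => [|c u] /=; first by rewrite xa dom0.
  case/andP=> ca tu; case: ifPn => cx /=; first by rewrite ca IH.
  (* Here [x] replaces the first letter [c]; beyond it only the upper row changes, and its letters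
     only decrease. *)
  rewrite xa /=; move: tu; clear -bx s.
  elim: t u bx => [|a t IH] [|c u] //=; rewrite ?dom0 //.
  case: ifPn => /= ay; first by move=> bx /andP[-> /(IH _ bx)].
  move=> _ /andP[ca ->]; rewrite andbT; exact: lei_neg_trans ca.
case: u => [|c u] /=.
  by move=> _ [<-]; rewrite ay dom0.
by case/andP=> ca tu [<-]; rewrite (negPf ca) /= ay tu.
Qed.

Lemma tabl_ins T x : tabl T -> tabl (ins s T x).
Proof.
elim: T x => [|u T IH] x //= /and4P[nu su dT tT].
rewrite sorted_bump //; have -> /= : (rbump u x).1 != [::].
  by case: bumpP => [_|u1 b u2 _ _ _]; [case: (u) | case: (u1)].
case E : (rbump u x).2 (bump_out s u x) => [|y []] // _.
  by rewrite dom_bump_end.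
rewrite IH // andbT; case: T dT {IH tT} => [|v T] /= dT.
  exact: (@dom_bump _ [::]).
exact: dom_bump.
Qed.

Lemma tabl_insw T w : tabl T -> tabl (insw T w).
Proof. by elim: w T => //= x w IH T tT; apply/IH/tabl_ins. Qed.

Lemma tabl_P w : tabl (P w). Proof. exact: tabl_insw. Qed.

Lemma tabl_sorted T : tabl T -> all (sorted e) T.
Proof. by elim: T => //= u T IH /and4P[_ -> _ /IH]. Qed.

Lemma bumpw_prefix p v w : all (fun x => all (e x) w) p ->
  rbumpw (p ++ v) w = (p ++ (rbumpw v w).1, (rbumpw v w).2).
Proof.
elim: w p v => [|x w IH] p v /= h //.
have {h}[h1 h2] : all (e^~ x) p /\ all (fun x => all (e x) w) p.
  by split; apply: sub_all h => y /andP[].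
have -> : rbump (p ++ v) x = (p ++ (rbump v x).1, (rbump v x).2).
  elim: p h1 {h2} => [|a p IHp] /=; first by case: (rbump v x).
  by case/andP=> -> /IHp->.
by rewrite /= IH.
Qed.

Lemma bumpw_end p w : sorted e w -> all (fun x => all (e x) w) p ->
  rbumpw p w = (p ++ w, [::]).
Proof.
move=> sw h; rewrite -{1}(cats0 p) bumpw_prefix //.
suff -> : rbumpw [::] w = (w, [::]) by [].
elim: w {h} sw => // x w IH /= pw; have sw := path_sorted pw.
rewrite -[[:: x]]cats0 bumpw_prefix /= ?IH // andbT.
by move: pw; rewrite (path_sortedE (@lei_trans s)) => /andP[].
Qed.

(** Each letter of [u] bumps the letter of [v] in the same column. The last hypothesis keeps surplus
    letters of [u] from bumping [w]: either the two rows have equal length, or [w] is empty. *)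
Lemma bumpw_dom u v w : sorted e u -> dom u v -> (size u <= size v)%N || (w == [::]) ->
  rbumpw (v ++ w) u = (u ++ w, v).
Proof.
elim: u v => [|a u IH] v /=.
  by move=> _; case: v.
move=> pu; have su := path_sorted pu; case: v => [|b v] /=.
  move=> _ /eqP->; rewrite !cats0 -cat1s bumpw_end //= andbT.
  by move: pu; rewrite (path_sortedE (@lei_trans s)) => /andP[].
case/andP=> ba uv h; rewrite (negPf ba) /= -[a :: _]/([:: a] ++ (v ++ w)).
rewrite bumpw_prefix /= ?IH // andbT.
by move: pu; rewrite (path_sortedE (@lei_trans s)) => /andP[].
Qed.

(** The rows are inserted from bottom to top, and each of them, dominating the next one, pushes the
    whole tableau down by one row; [key] is this step. *)
Lemma P_reading T : tabl T -> P (reading_word T) = T.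
Proof.
elim: T => //= u T IH /and4P[nu su dT tT].
rewrite /P /reading_word rev_cons flatten_rcons insw_cat -/(P _) IH // .
have E v w : sorted e v -> dom v w -> rbumpw w v = (v, w).
  by move=> sv vw; rewrite -{1}[w]cats0 bumpw_dom ?eqxx ?orbT // cats0.
have key v T' : dom u v -> tabl (v :: T') -> insw (v :: T') u = u :: v :: T'.
  elim: T' u v su {nu dT IH tT} => [|w T' IH] u v su uv /= /and4P[nv sv vw tT'].
    by rewrite insw_cons E // insw_nil // bumpw_end.
  by rewrite insw_cons E // IH.
case: T dT tT {IH} => [|v T] /= dT tT; last exact: key.
by rewrite insw_nil // bumpw_end.
Qed.

End KnuthInvariance.

Lemma row_of_cons u T i : row_of (u :: T) i = if i is i'.+1 then row_of T i' else u.
Proof. by case: i. Qed.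

Lemma row_of_nil i : row_of [::] i = [::].
Proof. by rewrite /row_of nth_nil. Qed.

Lemma row_of_default D i : (size D <= i)%N -> row_of D i = [::].
Proof. exact: nth_default. Qed.

Lemma row_of_neq0 D i : [::] \notin D -> (i < size D)%N -> row_of D i != [::].
Proof. by move=> nD iD; apply: contra nD => /eqP <-; apply: mem_nth. Qed.

Lemma row_of_ext D1 D2 : [::] \notin D1 -> [::] \notin D2 ->
  row_of D1 =1 row_of D2 -> D1 = D2.
Proof.
move=> n1 n2 h; have sz : size D1 = size D2.
  apply/eqP; rewrite eqn_leq; apply/andP; split; rewrite leqNgt; apply/negP => lt.
    by have := row_of_neq0 n1 lt; rewrite h row_of_default ?eqxx.
  by have := row_of_neq0 n2 lt; rewrite -h row_of_default ?eqxx.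
by apply: (eq_from_nth (x0 := [::])) => // i _; exact: h.
Qed.

Section RowsOf.
Variable s : bool.
Notation e := (lei s).

Definition dom_rows (D : diagram) := forall i, dom s (row_of D i) (row_of D i.+1).

Lemma tablP T : reflect
  [/\ [::] \notin T, (forall i, sorted e (row_of T i)) & dom_rows T] (tabl s T).
Proof.
apply: (iffP idP).
  elim: T => [|u T IH] /=; first by move=> _; split=> // i; rewrite !row_of_nil.
  case/and4P=> nu su dT /IH[nT sT hT]; split.
  - by rewrite inE negb_or eq_sym nu.
  - by case.
  - by case=> [|i]; [rewrite /row_of /= nth0 | exact: hT].
elim: T => [|u T IH] //= [nT sT hT]; move: nT; rewrite inE negb_or eq_sym => /andP[-> nT].
rewrite (sT 0%N) /=; have := hT 0%N; rewrite /row_of /= nth0 => -> /=.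
by apply: IH; split=> // i; [have := sT i.+1 | have := hT i.+1].
Qed.

Lemma dom_rows_size D i j : dom_rows D -> (i <= j)%N ->
  (size (row_of D j) <= size (row_of D i))%N.
Proof.
move=> h; elim: j => [|j IH]; first by case: i.
rewrite leq_eqVlt => /predU1P[->//|]; rewrite ltnS => /IH; apply: leq_trans.
exact: dom_size (h j).
Qed.

Lemma dom_rows_behead u D : dom_rows (u :: D) -> dom_rows D.
Proof. by move=> h i; exact: (h i.+1). Qed.

Lemma row_of_drop_empty D : dom_rows D -> row_of (drop_empty D) =1 row_of D.
Proof.
elim: D => [|u D IH] //= h; case: eqP => [u0|_] /=; last first.
  by case=> [|i] //; apply: IH; exact: dom_rows_behead h.
suff -> : drop_empty D = [::].
  move=> i; rewrite row_of_nil; apply/esym/eqP; rewrite -size_eq0 -leqn0.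
  by have := dom_rows_size h (leq0n i); rewrite [row_of _ 0]row_of_cons u0.
apply/eqP; rewrite -size_eq0 size_filter -leqn0 leqNgt -has_count.
apply/hasP => -[v /(nthP [::])[i iD <-]]; rewrite -/(row_of _ _) => /negP; apply.
rewrite -size_eq0 -leqn0.
by have := dom_rows_size h (leq0n i.+1); rewrite !row_of_cons u0.
Qed.

Lemma nil_drop_empty D : [::] \notin drop_empty D.
Proof. by rewrite mem_filter eqxx. Qed.

Lemma tabl_drop_empty D : (forall i, sorted e (row_of D i)) -> dom_rows D ->
  tabl s (drop_empty D).
Proof.
move=> sD hD; have h := row_of_drop_empty hD; apply/tablP; split=> [|i|i].
- exact: nil_drop_empty.
- by rewrite h.
- by rewrite !h.
Qed.

End RowsOf.

Notation tab := (tabl false).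
Notation lew := (lei false).

Lemma no_violation_dom D : no_violation D <-> dom_rows false D.
Proof.
split=> [h i|h i j].
  apply/domP; have hj j : (j < size (row_of D i.+1))%N ->
    (j < size (row_of D i))%N /\ nth 0 (row_of D i) j < nth 0 (row_of D i.+1) j.
    by move=> lt; have := h i.+1 j; rewrite /violation /= lt negbK => /andP[].
  split=> [|k /hj[_]]; last by rewrite /lei ltNge.
  case: (posnP (size (row_of D i.+1))) => [->//|sp].
  have [|h1 _] := hj (size (row_of D i.+1)).-1; last by lia.
  by rewrite prednK.
case: i => [|i] //; rewrite /violation /=; apply/negP => /andP[lt /negP]; apply.
have /domP[h1 h2] := h i; rewrite (leq_trans lt h1) ltNge.
exact: h2 lt.
Qed.

Lemma is_tableauP T : is_tableau T <-> tab T.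
Proof.
split=> [[n st v]|/tablP[n st v]].
  apply/tablP; split=> // [i|]; last exact/no_violation_dom.
  case: (ltnP i (size T)) => iT; last by rewrite row_of_default.
  exact: (allP st _ (mem_nth _ iT)).
split=> //; last exact/no_violation_dom.
by apply/allP => u /(nthP [::])[i iT <-]; exact: st.
Qed.

Lemma row_insertE T x : row_insert T x = ins false T x.
Proof.
elim: T x => [|u T IH] x //=.
have : exists k, k = find (fun y => x < y) u by eexists.
case: bumpP => [h|u1 b u2 uE h1 h2] _ /=.
  have hf : has (fun y => x < y) u = false.
    by apply/hasP => -[y yu]; have := allP h y yu; rewrite /lei /=; lia.
  by rewrite -has_find hf.
have fE : find (fun y => x < y) u = size u1.
  rewrite uE find_cat /=; have -> : has (fun y => x < y) u1 = false.
    by apply/hasP => -[y yu]; have := allP h1 y yu; rewrite /lei /=; lia.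
  by rewrite ltNge h2 addn0.
rewrite fE uE size_cat /= -[X in (X < _)%N]addn0 ltn_add2l /=.
rewrite nth_cat ltnn subnn /= IH; congr (_ :: _).
by elim: (u1) => //= a u1' ->.
Qed.

Lemma tmulE T U : tmul T U = insw false T (reading_word U).
Proof. by rewrite /tmul /insw; elim: (reading_word U) T => //= x w IH T; rewrite row_insertE. Qed.

Notation Pw := (P false).

Notation "a ~~p b" := (plact false a b) (at level 70).

Lemma Pw_reading T : tab T -> Pw (reading_word T) = T.
Proof. exact: P_reading. Qed.

Lemma Pw_cat w1 w2 : insw false (Pw w1) w2 = Pw (w1 ++ w2).
Proof. by rewrite /P insw_cat. Qed.

Lemma tmul_Pw T U : tab T -> tmul T U = Pw (reading_word T ++ reading_word U).
Proof. by move=> tT; rewrite tmulE -{1}(Pw_reading tT) Pw_cat. Qed.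

Lemma tmul_PwPw a b : tmul (Pw a) (Pw b) = Pw (a ++ b).
Proof.
rewrite tmulE Pw_cat; apply: P_plact; apply: plact_catl; apply: plact_sym.
exact: plact_P.
Qed.

Lemma tab_tmul T U : tab T -> tab (tmul T U).
Proof. by move=> tT; rewrite tmulE; exact: tabl_insw. Qed.

Lemma tmul0 T : tmul T [::] = T. Proof. by []. Qed.

Lemma tmul_nil T : tab T -> tmul [::] T = T.
Proof. by move=> tT; rewrite tmul_Pw // Pw_reading. Qed.

Lemma tmulA A B C : tab A -> tab B -> tab C -> tmul (tmul A B) C = tmul A (tmul B C).
Proof.
move=> tA tB tC; rewrite -(Pw_reading tA) -(Pw_reading tB) -(Pw_reading tC).
by rewrite !tmul_PwPw catA.
Qed.

Lemma reading_cat A B : reading_word (A ++ B) = reading_word B ++ reading_word A.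
Proof. by rewrite /reading_word rev_cat flatten_cat. Qed.

Lemma perm_reading D : perm_eq (reading_word D) (entries D).
Proof. by apply: perm_flatten; rewrite perm_rev. Qed.

Lemma perm_tmul T U : perm_eq (entries (tmul T U)) (entries T ++ entries U).
Proof.
rewrite tmulE (permPl (perm_insw _ _ _)) perm_cat2l; exact: perm_reading.
Qed.

Lemma tab_drop s k T : tabl s T -> tabl s (drop k T).
Proof. by elim: k T => [|k IH] [|u T] //= /and4P[_ _ _ /IH]. Qed.

Lemma tab_take s k T : tabl s T -> tabl s (take k T).
Proof.
elim: k T => [|k IH] [|u T] //= /and4P[-> -> h /IH ->].
by case: k {IH} T h => [|k] [|v T] //= h; rewrite ?dom0 ?h.
Qed.

Fixpoint join (L R : diagram) : diagram :=
  match L, R with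
  | [::], _ => R
  | _, [::] => L
  | l :: L', r :: R' => (l ++ r) :: join L' R'
  end.

Lemma row_of_join L R i : row_of (join L R) i = row_of L i ++ row_of R i.
Proof.
by elim: L R i => [|l L IH] [|r R] [|i] //=; rewrite ?row_of_nil ?cats0.
Qed.

Lemma join0 L : join L [::] = L. Proof. by case: L. Qed.

Lemma nil_join L R : [::] \notin L -> [::] \notin R -> [::] \notin join L R.
Proof.
elim: L R => [|l L IH] [|r R] //=; rewrite !inE !negb_or => /andP[h1 h2] /andP[h3 h4].
by rewrite IH // andbT eq_sym -size_eq0 size_cat addn_eq0 size_eq0 eq_sym negb_and h1.
Qed.

(** A letter that ends in row [k] of [R] passes through the rows above it, where it must bump no
    letter of [L]; hence all [i <= k]. *)
Definition jcond (L R : diagram) := forall i k, (i <= k)%N ->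
  {in row_of L i & row_of R k, forall x y, x <= y}.

Lemma jcond_behead l L r R : jcond (l :: L) (r :: R) -> jcond L R.
Proof. by move=> h i k ik; exact: (h i.+1 k.+1). Qed.

Lemma mem_reading D x : (x \in reading_word D) = (x \in entries D).
Proof. exact: (perm_mem (perm_reading D)). Qed.

Lemma entriesP D x : reflect (exists i, x \in row_of D i) (x \in entries D).
Proof.
apply: (iffP flattenP) => [[u /(nthP [::])[i _ <-]]|[i xi]]; first by exists i.
exists (row_of D i) => //; apply: mem_nth; rewrite ltnNge; apply/negP => h.
by rewrite row_of_default in xi.
Qed.

(** The reading word of [R] passes through the first row of [L] as through an empty row, since it
    bumps no letter of [l]. What comes out has the remaining rows of [R] as its insertion tableau,
    and induction applies. *)
Lemma join_mul L R : all (sorted lew) L -> tab R -> jcond L R -> tmul L R = join L R.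
Proof.
rewrite tmulE; elim: L R => [|l L IH] R sL tR h.
  by rewrite /= -[RHS]Pw_reading.
case: R tR h => [|r R] tR h //; move: sL => /andP[sl sL].
have rw0 : reading_word (r :: R) != [::].
  case: (r) tR => [|a r'] // _; rewrite /reading_word rev_cons flatten_rcons.
  by rewrite -size_eq0 size_cat /= addnS.
have := Pw_reading tR; rewrite {1}/P insw_nil // => -[rE RE].
rewrite insw_cons -{1 2}[l]cats0 bumpw_prefix ?rE; last first.
  apply/allP => x xl; apply/allP => y; rewrite mem_reading => /entriesP[k yk].
  exact: h (leq0n k) _ _ xl yk.
rewrite /=; congr (_ :: _); have /and4P[_ _ _ tR'] := tR.
rewrite -IH //; last exact: jcond_behead h.
apply: insw_plact => //; apply: plact_of_P.
by rewrite Pw_reading // -[RHS]RE.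
Qed.

(** * Cutting tableaux by rows and by columns *)

Lemma mem_nthP (x : int) (u : seq int) : x \in u ->
  exists2 i, (i < size u)%N & nth 0 u i = x.
Proof. by case/(nthP 0) => i iu <-; exists i. Qed.

Lemma sorted_nth_le (u : seq int) i j : sorted lew u -> (i <= j)%N -> (j < size u)%N ->
  nth 0 u i <= nth 0 u j.
Proof.
move=> su ij ju; apply: (sorted_leq_nth le_trans lexx) => //; rewrite inE //.
exact: leq_ltn_trans ju.
Qed.

Lemma row_of_map (f : seq int -> seq int) D i : f [::] = [::] ->
  row_of (map f D) i = f (row_of D i).
Proof.
move=> f0; case: (ltnP i (size D)) => iD; first exact: nth_map.
by rewrite !row_of_default ?size_map.
Qed.

Lemma dom_take s b u v : dom s u v -> dom s (take b u) (take b v).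
Proof. by elim: b u v => [|b IH] [|x u] [|y v] //= /andP[-> /IH]. Qed.

Lemma dom_drop s b u v : dom s u v -> dom s (drop b u) (drop b v).
Proof.
elim: b u v => [|b IH] [|x u] [|y v] //=; first by rewrite dom0.
by case/andP=> _ /IH.
Qed.

Section Cuts.
Variables (b : nat) (D : diagram).
Hypothesis tD : tab D.

Let hD : dom_rows false D. Proof. by case/tablP: tD. Qed.
Let sD i : sorted lew (row_of D i). Proof. by case/tablP: tD. Qed.
Let nD : [::] \notin D. Proof. by case/tablP: tD. Qed.

Let dom_take_rows : dom_rows false (map (take b) D).
Proof. by move=> i; rewrite !row_of_map ?dom_take // => n [] . Qed.

Let dom_drop_rows : dom_rows false (map (drop b) D).
Proof. by move=> i; rewrite !row_of_map ?dom_drop. Qed.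

Lemma row_of_left_cut i : row_of (left_cut b D) i = take b (row_of D i).
Proof. by rewrite (row_of_drop_empty dom_take_rows) row_of_map. Qed.

Lemma row_of_right_cut i : row_of (right_cut b D) i = drop b (row_of D i).
Proof. by rewrite (row_of_drop_empty dom_drop_rows) row_of_map. Qed.

Lemma tab_left_cut : tab (left_cut b D).
Proof. by apply: tabl_drop_empty => // i; rewrite row_of_map // take_sorted. Qed.

Lemma tab_right_cut : tab (right_cut b D).
Proof. by apply: tabl_drop_empty => // i; rewrite row_of_map // drop_sorted. Qed.

Lemma join_cut : join (left_cut b D) (right_cut b D) = D.
Proof.
apply: row_of_ext => //; first by apply: nil_join; exact: nil_drop_empty.
by move=> i; rewrite row_of_join row_of_left_cut row_of_right_cut cat_take_drop.
Qed.

(** From a box of the left part go down its column to row [k], which is long enough because it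
    reaches beyond column [b], and then right along that row. *)
Lemma jcond_cut : jcond (left_cut b D) (right_cut b D).
Proof.
move=> i k ik x y; rewrite row_of_left_cut row_of_right_cut => xi yk.
have [m mD ym] : exists2 m, (b + m < size (row_of D k))%N & nth 0 (row_of D k) (b + m) = y.
  case/mem_nthP: yk => m; rewrite size_drop nth_drop => mD <-; exists m => //; lia.
have [l lb [lD xl]] : exists2 l, (l < b)%N & (l < size (row_of D i))%N /\ nth 0 (row_of D i) l = x.
  case/mem_nthP: xi => l; rewrite size_take_min => lD <-; exists l; first by lia.
  by rewrite nth_take; lia.
have szk := dom_rows_size hD ik.
have lk : nth 0 (row_of D i) l <= nth 0 (row_of D k) l.
  move: ik mD; clear -hD lb; elim: k => [|k IH]; first by rewrite leqn0 => /eqP->.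
  rewrite leq_eqVlt => /predU1P[->//|ik] mD.
  have /domP[h1 h2] := hD k.
  apply: le_trans (IH ik _) _; first by apply: leq_trans mD _.
  by have := h2 l; rewrite /lei -ltNge => h; apply/ltW/h; apply: leq_ltn_trans mD; lia.
rewrite -ym -xl; apply: le_trans lk _.
apply: sorted_nth_le => //; lia.
Qed.

Lemma tmul_cut : tmul (left_cut b D) (right_cut b D) = D.
Proof.
rewrite join_mul ?join_cut //; [|exact: tab_right_cut|exact: jcond_cut].
by apply: tabl_sorted; exact: tab_left_cut.
Qed.

End Cuts.

Lemma row_of_leq_left b D i : tab D -> (size (row_of (left_cut b D) i) <= b)%N.
Proof. by move=> tD; rewrite row_of_left_cut // size_take_min geq_minl. Qed.

Lemma cut_join b L R : tab L -> tab R -> tab (join L R) ->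
  (forall i, size (row_of L i) <= b)%N ->
  (forall i, row_of R i != [::] -> size (row_of L i) = b) ->
  left_cut b (join L R) = L /\ right_cut b (join L R) = R.
Proof.
move=> tL tR tJ hL hR; have [nL _ _] := tablP _ _ tL; have [nR _ _] := tablP _ _ tR.
split; apply: row_of_ext => //; try exact: nil_drop_empty; move=> i.
  rewrite row_of_left_cut // row_of_join take_cat.
  case: ltnP => h; first by have := hL i; lia.
  have [->|/hR ->] := eqVneq (row_of R i) [::]; first by rewrite cats0.
  by rewrite subnn take0 cats0.
rewrite row_of_right_cut // row_of_join drop_cat.
have [->|/hR ->] := eqVneq (row_of R i) [::]; last by rewrite ltnn subnn drop0.
by have := hL i; case: ltnP => h1 h2; rewrite ?drop_oversize ?drop_nil.
Qed.

Lemma cut_flush b D i : tab D ->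
  row_of (right_cut b D) i != [::] -> size (row_of (left_cut b D) i) = b.
Proof.
move=> tD; rewrite row_of_right_cut // row_of_left_cut // -size_eq0 size_drop subn_eq0 -ltnNge.
by move=> h; rewrite size_takel // ltnW.
Qed.

(** * Cuts of a product, by rows and by columns *)

Section Columns.
Variable s : bool.

(** Insertion cut off after the rows of [C]: the second component is the word that leaves the last
    of them. For [s = true] these rows are columns of a tableau. *)
Fixpoint inso (C : diagram) (w : seq int) : diagram * seq int :=
  if C is c :: C' then
    ((rbumpw s c w).1 :: (inso C' (rbumpw s c w).2).1, (inso C' (rbumpw s c w).2).2)
  else ([::], w).

Lemma insw_inso C1 C2 w :
  insw s (C1 ++ C2) w = (inso C1 w).1 ++ insw s C2 (inso C1 w).2.
Proof. by elim: C1 w => //= c C1 IH w; rewrite insw_cons IH. Qed.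

Lemma size_inso C w : size (inso C w).1 = size C.
Proof. by elim: C w => //= c C IH w; rewrite IH. Qed.

End Columns.

Lemma tmul_take_drop a D : tab D -> tmul (drop a D) (take a D) = D.
Proof.
by move=> tD; rewrite tmul_Pw ?tab_drop // -reading_cat cat_take_drop Pw_reading.
Qed.

(** The word of [B] runs through the first [a] rows of [A] and leaves them as a word [out], whatever
    lies below. In [A] it is then inserted into [drop a A]; in [take a A] it forms the lower rows
    alone. So the two products differ by a left factor [drop a A] in their lower rows. *)
Lemma tmul_rows a a' A B : tab A -> tab B -> (a' <= a)%N ->
  take a' (tmul A B) = take a' (tmul (take a A) B) /\
  drop a' (tmul A B) = tmul (drop a A) (drop a' (tmul (take a A) B)).
Proof.
move=> tA tB aa; case: (leqP (size A) a) => sA.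
  rewrite (take_oversize sA) (drop_oversize sA) tmul_nil //.
  by apply: tab_drop; exact: tab_tmul.
rewrite !tmulE; set w := reading_word B.
have -> : insw false (take a A) w =
    (inso false (take a A) w).1 ++ Pw (inso false (take a A) w).2.
  by rewrite -[in LHS](cats0 (take a A)) insw_inso.
have E : insw false A w =
    (inso false (take a A) w).1 ++ insw false (drop a A) (inso false (take a A) w).2.
  by rewrite -insw_inso cat_take_drop.
have tE : tab (insw false A w) by exact: tabl_insw.
move: E tE => ->; set out := (inso _ _ _).2; set C := (inso _ _ _).1 => tE.
have sC : size C = a by rewrite size_inso size_takel // ltnW.
rewrite !take_cat !drop_cat sC; case: ltnP => [h|h]; last first.
  have -> : a' = a by lia.
  rewrite subnn !take0 !drop0; split=> //.
  rewrite -[LHS]Pw_reading; last by move: (tab_drop a tE); rewrite drop_size_cat.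
  rewrite -tmulE tmul_Pw ?tab_drop //; apply: P_plact.
  apply: plact_trans (plact_sym (plact_insw _ (tabl_sorted (tab_drop a tA)))) _.
  by apply: plact_catl; exact: plact_P.
split=> //.
rewrite -[LHS]Pw_reading; last by move: (tab_drop a' tE); rewrite drop_cat sC h.
rewrite -tmulE tmul_Pw ?tab_drop //; apply: P_plact; rewrite !reading_cat catA; apply: plact_catr.
apply: plact_trans (plact_sym (plact_insw _ (tabl_sorted (tab_drop a tA)))) _.
by apply: plact_catl; exact: plact_P.
Qed.

Lemma plact_rev s a b : plact s a b -> plact (~~ s) (rev a) (rev b).
Proof.
elim=> {a b} [u v a b ab|a|a b _ IH|a b c _ IH1 _ IH2]; last 3 first.
- exact: plact_refl.
- exact: plact_sym.
- exact: plact_trans IH1 IH2.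
rewrite !rev_cat -!catA; apply: plact_step.
case: ab => x y z; rewrite /lei; case: s => /= h1 h2.
- by apply: Knuth2 => /=; rewrite /lei /=; lia.
- by apply: Knuth2 => /=; rewrite /lei /=; lia.
- by apply: Knuth1 => /=; rewrite /lei /=; lia.
- by apply: Knuth1 => /=; rewrite /lei /=; lia.
Qed.

(** Reversing the reading word of a list of columns gives the column word: columns from left to
    right, each from bottom to top. *)
Definition rowsof (C : diagram) : diagram := Pw (rev (reading_word C)).

(* The columns of a tableau, computed by column insertion. *)
Definition colsof (T : diagram) : diagram := P true (rev (reading_word T)).

Lemma tab_rowsof C : tab (rowsof C). Proof. exact: tabl_P. Qed.

Lemma colsofK T : tab T -> rowsof (colsof T) = T.
Proof.
move=> tT; rewrite -[RHS]Pw_reading //; apply: P_plact.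
rewrite -[X in plact _ _ X]revK; apply: (@plact_rev true); apply: plact_sym.
exact: plact_P.
Qed.

Lemma rowsof_cat C1 C2 : rowsof (C1 ++ C2) = tmul (rowsof C1) (rowsof C2).
Proof. by rewrite /rowsof tmul_PwPw reading_cat rev_cat. Qed.

Definition col_diag (c : seq int) : diagram := [seq [:: x] | x <- c].

Lemma reading_col c : reading_word (col_diag c) = rev c.
Proof.
elim: c => //= x c IH; rewrite /reading_word rev_cons flatten_rcons.
by rewrite -/(reading_word _) IH rev_cons cats1.
Qed.

Lemma row_of_col c i : row_of (col_diag c) i = if (i < size c)%N then [:: nth 0 c i] else [::].
Proof.
case: ltnP => h; last by rewrite row_of_default ?size_map.
by rewrite /row_of (nth_map 0).
Qed.

Lemma tab_col c : sorted (lei true) c -> tab (col_diag c).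
Proof.
elim: c => //= x c IH pc; rewrite IH ?(path_sorted pc) // andbT /=.
by case: c pc {IH} => //= y c /andP[xy _]; rewrite andbT /lei -ltNge.
Qed.

(** A letter of the first column is at most every letter to its right in the same or a lower row, so
    multiplying by the other columns is a juxtaposition. The bound on the number of rows is what
    lets [rowsof_take_drop] cut row by row. *)
Lemma rowsof_cons c C : tabl true (c :: C) ->
  rowsof (c :: C) = join (col_diag c) (rowsof C) /\
  (size (rowsof C) <= size c)%N.
Proof.
move=> tC.
suff [h1 h2] : size (rowsof C) = size (head [::] C) /\ jcond (col_diag c) (rowsof C).
  have /and4P[_ sc dC _] := tC; rewrite h1; split; last exact: dom_size dC.
  rewrite -cat1s rowsof_cat -join_mul //; last exact: tab_rowsof.
    congr tmul; rewrite -[RHS]Pw_reading ?tab_col // /rowsof; congr Pw.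
    by rewrite reading_col /reading_word /= cats0.
  by apply: tabl_sorted; exact: tab_col.
elim: C c tC => [|c' C IH] c tC.
  by split=> // i k _ x y; rewrite row_of_nil.
have /and4P[_ sc dc tC'] := tC; have [h1 h2] := IH _ tC'.
have /and4P[_ sc' dC _] := tC'.
have E : rowsof (c' :: C) = join (col_diag c') (rowsof C).
  rewrite -cat1s rowsof_cat -join_mul //; last exact: tab_rowsof.
    congr tmul; rewrite -[RHS]Pw_reading ?tab_col // /rowsof; congr Pw.
    by rewrite reading_col /reading_word /= cats0.
  by apply: tabl_sorted; exact: tab_col.
have lec' := dom_size dC.
have sz : size (rowsof (c' :: C)) = size c'.
  have sj L R : size (join L R) = maxn (size L) (size R).
    by elim: L R => [|l L IHL] [|r R] //=; rewrite ?max0n ?maxn0 // IHL maxnSS.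
  by rewrite E sj size_map h1; apply/maxn_idPl.
split=> // i k ik x y.
have /domP[szc domc] := dc.
rewrite row_of_col; case: ltnP => // ic; rewrite inE => /eqP-> yk.
have kc' : (k < size c')%N.
  by rewrite -sz ltnNge; apply/negP => hk; rewrite row_of_default in yk.
have h3 : nth 0 c i <= nth 0 c' i by have := domc i; rewrite /lei -leNgt; apply; exact: leq_ltn_trans ik kc'.
apply: le_trans h3 _; move: yk; rewrite E row_of_join mem_cat row_of_col kc' inE.
case/orP=> [/eqP->|yk]; last first.
  by apply: (h2 _ _ ik _ _ _ yk); rewrite row_of_col (leq_ltn_trans ik kc') inE.
apply: sorted_nth_le => //.
by apply: sub_sorted sc' => u v; rewrite /lei; exact: ltW.
Qed.

Lemma rowsof_take_drop b C i : tabl true C ->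
  row_of (rowsof (take b C)) i = take b (row_of (rowsof C) i) /\
  row_of (rowsof (drop b C)) i = drop b (row_of (rowsof C) i).
Proof.
have r0 : row_of (rowsof [::]) i = [::] by rewrite /rowsof row_of_nil.
elim: b C => [|b IH] C tC; first by rewrite !take0 !drop0 r0.
case: C tC => [|c C] tC; first by rewrite /= r0.
rewrite [take _ _]/= [drop _ (_ :: _)]/=.
have [E sz] := rowsof_cons tC; have /and4P[nc sc dC tC'] := tC.
have tc : tabl true (c :: take b C).
  exact: (tab_take b.+1 tC).
have [E' _] := rowsof_cons tc.
have [h1 h2] := IH C tC'.
rewrite E E' !row_of_join row_of_col h1 h2; case: ltnP => // ic.
by rewrite !cat0s row_of_default ?(leq_trans sz).
Qed.

Lemma cut_rowsof b C : tabl true C ->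
  left_cut b (rowsof C) = rowsof (take b C) /\ right_cut b (rowsof C) = rowsof (drop b C).
Proof.
move=> tC; have tr := tab_rowsof.
have n0 D : [::] \notin rowsof D by case/tablP: (tr D).
split; apply: row_of_ext; rewrite ?nil_drop_empty // => i;
  have [h1 h2] := rowsof_take_drop b i tC.
- by rewrite row_of_left_cut // h1.
- by rewrite row_of_right_cut // h2.
Qed.

(* The analogue of [tmul_rows] for columns, by column insertion of [A] into [Q]. *)
Lemma tmul_columns b b' A Q : tab A -> tab Q -> (b' <= b)%N ->
  left_cut b' (tmul A Q) = left_cut b' (tmul A (left_cut b Q)) /\
  right_cut b' (tmul A Q) = tmul (right_cut b' (tmul A (left_cut b Q))) (right_cut b Q).
Proof.
move=> tA tQ bb; set w := rev (reading_word A).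
have tc T : tabl true (colsof T) by exact: tabl_P.
have colM C : tabl true C -> tmul A (rowsof C) = rowsof (insw true C w) /\ tabl true (insw true C w).
  move=> tC; split; last exact: tabl_insw.
  rewrite tmul_Pw //; apply: P_plact.
  apply: plact_trans (plact_catl _ (plact_sym (plact_P _ _))) _.
  rewrite -[reading_word A]revK -rev_cat; apply: (@plact_rev true).
  exact: plact_insw (tabl_sorted tC).
set C := colsof Q; have QE : rowsof C = Q by exact: colsofK.
have tC : tabl true C by exact: tc.
have [QlE QrE] := cut_rowsof b tC; rewrite QE in QlE QrE.
have tCl : tabl true (take b C) := tab_take b tC.
rewrite QlE QrE -{1 2}QE.
have [-> tW] := colM _ tC; have [-> tV] := colM _ tCl.
have [-> ->] := cut_rowsof b' tW; have [-> ->] := cut_rowsof b' tV.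
rewrite -rowsof_cat.
case: (leqP (size C) b) => sC.
  by rewrite (take_oversize sC) (drop_oversize sC) cats0.
pose out := (inso true (take b C) w).2; pose C1 := (inso true (take b C) w).1.
have -> : insw true C w = C1 ++ insw true (drop b C) out.
  by rewrite -insw_inso cat_take_drop.
have -> : insw true (take b C) w = C1 ++ insw true [::] out by rewrite -insw_inso cats0.
have sC1 : size C1 = b by rewrite size_inso size_takel // ltnW.
rewrite !take_cat !drop_cat sC1.
have key : rowsof (insw true (drop b C) out) = rowsof (insw true [::] out ++ drop b C).
  apply: P_plact; apply: (@plact_rev true); rewrite reading_cat.
  apply: plact_trans (plact_sym (plact_insw _ _)) _.
    exact: tabl_sorted (tab_drop b tC).
  by apply: plact_catl; exact: plact_P.
case: ltnP => h; last first.
  have -> : b' = b by lia.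
  by rewrite subnn !take0 !drop0.
by split=> //; rewrite -catA !(rowsof_cat (drop b' C1)) key.
Qed.

(** * Products with a rectangle *)

Lemma drop_cat_le (A : Type) n (u v : seq A) : (n <= size u)%N ->
  drop n (u ++ v) = drop n u ++ v.
Proof.
rewrite leq_eqVlt drop_cat => /predU1P[->|->//].
by rewrite ltnn subnn drop0 drop_size.
Qed.

Lemma jcond_above T P : entries_above T P -> jcond T P.
Proof.
by move=> h i k _ x y xi yk; apply/ltW/h; apply/entriesP; [exists k | exists i].
Qed.

Lemma join_cat L1 L2 R :
  join (L1 ++ L2) R = join L1 (take (size L1) R) ++ join L2 (drop (size L1) R).
Proof. by elim: L1 R => [|l L1 IH] [|r R] //=; rewrite ?join0 ?IH. Qed.

(* The letters of [u] are smaller than those of the left columns, which they push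
   down by one box; the other columns stay in place. *)
Lemma insw_shift u Ql Qr : tab (u :: Ql) -> [::] \notin Qr -> dom_rows false Qr ->
  (forall i, row_of Qr i != [::] -> size (row_of Ql i) = size u) ->
  insw false (join Ql Qr) u = join (u :: Ql) Qr.
Proof.
elim: Ql u Qr => [|q Ql IH] u Qr tQ nQ dQ h.
  have /and4P[nu su _ _] := tQ.
  case: Qr nQ dQ h => [|r Qr] nQ _ h; last first.
    move: nu; rewrite -size_eq0 -(h 0%N) //.
    by move: nQ; rewrite inE negb_or eq_sym => /andP[].
  by rewrite /= insw_nil // bumpw_end.
have /and4P[nu su duq tqQ] := tQ.
case: Qr nQ dQ h => [|r Qr] nQ dQ h.
  rewrite !join0 insw_cons -{1 2}[q]cats0 bumpw_dom ?eqxx ?orbT // cats0 /=.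
  by have := IH q [::] tqQ isT dQ; rewrite !join0 => -> // i; rewrite row_of_nil.
move: (nQ); rewrite inE negb_or eq_sym => /andP[nr nQ'].
have sq : size q = size u by apply: (h 0%N).
rewrite /= insw_cons bumpw_dom ?sq ?leqnn //= IH //; first exact: dom_rows_behead dQ.
by move=> i hi; rewrite sq; apply: (h i.+1).
Qed.

Section Rectangle.
Variables (a b : nat) (T : diagram).
Hypothesis tT : tab T.
Hypothesis shT : shape T = [seq m <- nseq a b | m != 0%N].

(** For [b = 0] the tableau is the empty list whatever [a] is; this degenerate case is treated apart
    in several lemmas below. *)
Lemma rect_rowsP :
  [\/ size T = a /\ (forall i, (i < a)%N -> size (row_of T i) = b) /\ (0 < b)%N
    | T = [::] /\ (a = 0%N \/ b = 0%N)].
Proof.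
case: (posnP b) => [b0|b0].
  right; split; last by right.
  apply/eqP; rewrite -size_eq0 -(size_map size) -/(shape T) shT b0 size_filter.
  by rewrite count_nseq /= mul0n.
left; have E : shape T = nseq a b.
  by rewrite shT (@eq_in_filter _ _ predT) ?filter_predT // => m /nseqP[-> _]; rewrite -lt0n.
have sz : size T = a by rewrite -(size_map size) -/(shape T) E size_nseq.
split=> //; split=> // i ia; rewrite /row_of -(nth_map _ 0%N) ?sz //.
by rewrite -/(shape T) E nth_nseq ia.
Qed.

Lemma rect_row i : size (row_of T i) = if (i < a)%N then b else 0%N.
Proof.
case: rect_rowsP => [[sT [hT _]]|[-> ab]]; last first.
  by rewrite row_of_nil; case: ab => ->; rewrite ?if_same.
by case: ltnP => h; [exact: hT | rewrite row_of_default ?sT].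
Qed.

Lemma sorted_T : all (sorted lew) T. Proof. exact: tabl_sorted. Qed.

Lemma tmul_above P : tab P -> entries_above T P -> tmul T P = join T P.
Proof. by move=> tP h; apply: join_mul sorted_T tP (jcond_above h). Qed.

Lemma above_sub X Y : {subset entries X <= entries Y} ->
  entries_above T Y -> entries_above T X.
Proof. by move=> XY h x t xX tt; apply: h => //; apply: XY. Qed.

Lemma mem_entries_take k X : {subset entries (take k X) <= entries X}.
Proof.
move=> x /flattenP[u uX xu]; apply/flattenP; exists u => //; exact: mem_take uX.
Qed.

Lemma mem_entries_left_cut k X : {subset entries (left_cut k X) <= entries X}.
Proof.
move=> x /flattenP[u]; rewrite mem_filter => /andP[_ /mapP[v vX ->]] /mem_take xv.
by apply/flattenP; exists v.
Qed.

Lemma mem_entries_right_cut k X : {subset entries (right_cut k X) <= entries X}.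
Proof.
move=> x /flattenP[u]; rewrite mem_filter => /andP[_ /mapP[v vX ->]] /mem_drop xv.
by apply/flattenP; exists v.
Qed.

(** The rows of [T . P] below the [a]-th are those of [P], and lower rows come first in the reading
    word; so [T . P] is the product of [drop a P] and [T . take a P]. *)
Lemma tmul_top Q P : tab Q -> tab P -> entries_above T P ->
  tmul (tmul Q T) P = tmul (tmul (tmul Q (drop a P)) T) (take a P).
Proof.
move=> tQ tP hP; have tt := tab_take a tP; have td := tab_drop a tP.
have tM U V : tab U -> tab (tmul U V) by exact: tab_tmul.
rewrite !(tmulA, tM) //; congr tmul; rewrite -(tmulA td) //.
case: rect_rowsP => [[sT [hT b0]]|[-> ab]]; last first.
  by rewrite tmul0 tmul_take_drop // tmul_nil.
rewrite tmulA // (tmul_above tP hP) (tmul_above tt); last first.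
  exact: above_sub (@mem_entries_take a P) hP.
have E : join T P = join T (take a P) ++ drop a P.
  by rewrite -[in LHS](cats0 T) join_cat sT.
have tE : tab (join T P) by rewrite -tmul_above //; exact: tM.
rewrite -[LHS]Pw_reading // E reading_cat tmul_Pw //.
Qed.

Lemma tab_stack Q : tab Q -> (forall i, size (row_of Q i) <= b)%N ->
  entries_above T Q -> tab (T ++ Q).
Proof.
move=> tQ hQ hTQ; case: rect_rowsP => [[sT [hT b0]]|[-> //]].
have [nT st dT] := tablP _ _ tT; have [nQ sQ dQ] := tablP _ _ tQ.
have rE i : row_of (T ++ Q) i = if (i < a)%N then row_of T i else row_of Q (i - a).
  by rewrite /row_of nth_cat sT.
apply/tablP; split=> [|i|i]; first by rewrite mem_cat negb_or nT.
  by rewrite rE; case: ifP.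
rewrite !rE; case: (ltngtP i.+1 a) => h.
- exact: dT.
- by rewrite subSn.
- rewrite -h subnn; apply/domP; split; first by rewrite hT ?hQ // -h.
  move=> k kQ; rewrite /lei -ltNge; apply: hTQ; apply/entriesP.
    by exists 0%N; exact: mem_nth.
  exists i; apply: mem_nth; rewrite hT -?h //; exact: leq_trans kQ (hQ _).
Qed.

Lemma stack_mul Q : tab Q -> (forall i, size (row_of Q i) <= b)%N ->
  entries_above T Q -> tmul Q T = T ++ Q.
Proof.
move=> tQ hQ hTQ; rewrite tmul_Pw // -reading_cat Pw_reading //; exact: tab_stack.
Qed.

(** The rows of [T] are inserted into [Q] from bottom to top. Each has [b] letters, all smaller than
    those of [Q], so it pushes the first [b] columns down by one row and leaves the others in place
    ([insw_shift]). *)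
Lemma tmul_left Q : tab Q -> entries_above T Q ->
  tmul Q T = tmul (tmul (left_cut b Q) T) (right_cut b Q).
Proof.
move=> tQ hTQ; have tl := tab_left_cut b tQ; have tr := tab_right_cut b tQ.
case: rect_rowsP => [[sT [hT b0]]|[-> ab]]; last by rewrite !tmul0 tmul_cut.
have hl i : (size (row_of (left_cut b Q) i) <= b)%N by exact: row_of_leq_left.
have ha : entries_above T (left_cut b Q) := above_sub (@mem_entries_left_cut b Q) hTQ.
have tS := tab_stack tl hl ha.
have [nr _ dr] := tablP _ _ tr.
rewrite (stack_mul tl hl ha) [RHS]join_mul //; last 2 first.
- exact: tabl_sorted.
- move=> i k ik x y; rewrite /row_of nth_cat sT; case: ltnP => h xi yk.
    apply/ltW/hTQ; last by apply/entriesP; exists i.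
    by apply: (@mem_entries_right_cut b); apply/entriesP; exists k.
  by apply: (jcond_cut tQ _ xi yk); lia.
rewrite -{1}(join_cut b tQ) tmulE.
have sub : forall i, row_of (right_cut b Q) i != [::] ->
    forall j, (j <= i)%N -> size (row_of (left_cut b Q) j) = b.
  move=> i hi j ji; apply/eqP; rewrite eqn_leq hl /=; have [_ _ dl] := tablP _ _ tl.
  by apply: leq_trans (dom_rows_size dl ji); rewrite (cut_flush tQ hi).
(* The state after the last [k] rows of [T] have been inserted. *)
have: forall k, (k <= a)%N -> insw false (join (left_cut b Q) (right_cut b Q))
    (reading_word (drop (a - k) T)) = join (drop (a - k) T ++ left_cut b Q) (right_cut b Q).
  elim=> [|k IH] ka; first by rewrite subn0 drop_oversize ?sT.
  have lt : (a - k.+1 < size T)%N by rewrite sT; lia.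
  rewrite (drop_nth [::] lt) -subSn // subSS -cat1s reading_cat insw_cat IH; last by lia.
  rewrite [reading_word [:: _]]/reading_word /= cats0 -cat_cons insw_shift //.
    by have := tab_drop (a - k.+1) tS; rewrite drop_cat lt (drop_nth [::] lt) -subSn // subSS.
  move=> i hi; rewrite -/(row_of T _) hT; last by lia.
  rewrite /row_of nth_cat size_drop sT; case: ltnP => h.
    by rewrite nth_drop -/(row_of T _) hT; lia.
  by apply: sub hi _ _; exact: leq_subr.
by move/(_ a (leqnn a)); rewrite subnn drop0.
Qed.

Lemma trip_left Q P : tab Q -> tab P -> entries_above T Q ->
  tmul (tmul Q T) P = tmul (tmul (left_cut b Q) T) (tmul (right_cut b Q) P).
Proof.
move=> tQ tP hQ; rewrite tmul_left // tmulA //; last exact: tab_right_cut.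
by apply: tab_tmul; exact: tab_left_cut.
Qed.

End Rectangle.

Definition area (D : diagram) : nat := size (entries D).

Lemma area_tmul X Y : area (tmul X Y) = (area X + area Y)%N.
Proof. by rewrite /area (perm_size (perm_tmul X Y)) size_cat. Qed.

Lemma area_take_drop k X : area X = (area (take k X) + area (drop k X))%N.
Proof. by rewrite /area -size_cat -flatten_cat cat_take_drop. Qed.

(** * Insertion into a tableau cut after column [b] *)

Section SingleInsertion.
Variable b : nat.

Definition left_size (V : diagram) : nat := size (flatten (map (take b) V)).

Lemma right_cut_cons u V : tab (u :: V) ->
  right_cut b (u :: V) = if drop b u == [::] then [::] else drop b u :: right_cut b V.
Proof.
move=> tV; have [n _ d] := tablP _ _ tV.
rewrite {1}/right_cut /drop_empty /=; case: eqP => //= du.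
apply: row_of_ext => //; first exact: nil_drop_empty.
move=> i; rewrite row_of_nil -/(right_cut b V) row_of_right_cut; last by case/and4P: tV.
rewrite drop_oversize //; have := dom_rows_size d (leq0n i.+1); rewrite !row_of_cons.
by move=> h; apply: leq_trans h _; rewrite -subn_eq0 -size_drop du.
Qed.

Lemma left_size_cons u V : left_size (u :: V) = (minn b (size u) + left_size V)%N.
Proof. by rewrite /left_size /= size_cat size_take_min. Qed.

(** Insertion paths move weakly to the left on their way down. The last hypothesis forces [y] to
    enter in column [c] or before, so the path stays in the first [b] columns and ends with a new
    box there. *)
Lemma left_size_low (c : nat) V (y : int) : tab V -> (c < b)%N ->
  ((c < size (row_of V 0))%N -> y < nth 0 (row_of V 0) c) ->
  left_size (ins false V y) = (left_size V).+1.
Proof.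
elim: V c y => [|v V IH] c y tV cb h.
  by rewrite left_size_cons /= /left_size /=; lia.
have /and4P[_ sv dv tV'] := tV.
rewrite /=; case: bumpP h => [hy|v1 z v2 vE h1 h2] h; rewrite !left_size_cons.
  have : (size v <= c)%N.
    rewrite leqNgt; apply/negP => cv; have := h cv.
    by rewrite ltNge => /negP; apply; exact: (allP hy _ (mem_nth 0 cv)).
  by rewrite size_rcons; lia.
have v1c : (size v1 <= c)%N.
  rewrite leqNgt; apply/negP => cv1.
  have cv : (c < size v)%N by rewrite vE size_cat; lia.
  have := h cv; rewrite /row_of /= vE nth_cat cv1.
  by rewrite ltNge => /negP; apply; exact: (allP h1 _ (mem_nth 0 cv1)).
rewrite (IH (size v1)) //.
- by rewrite vE !size_cat /=; lia.
- exact: leq_ltn_trans cb.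
- move=> lt; have /domP[_ hd] := dv; have := hd (size v1).
  rewrite /row_of nth0 in lt *; move/(_ lt).
  by rewrite vE nth_cat ltnn subnn /lei /= -ltNge.
Qed.

(** If the insertion path ever enters the first [b] columns it ends there, by [left_size_low];
    otherwise it runs just as it would in [right_cut b V] alone. *)
Lemma ins_cut V x : tab V ->
  left_size (ins false V x) = (left_size V).+1 \/
  (forall i, take b (row_of (ins false V x) i) = take b (row_of V i)) /\
  right_cut b (ins false V x) = ins false (right_cut b V) x.
Proof.
elim: V x => [|u V IH] x tV.
  case: (posnP b) => [->|b0]; last by left; rewrite left_size_cons /left_size /=; lia.
  by right; split=> // i; rewrite !take0.
have /and4P[nu su du tV'] := tV; have tI := tabl_ins x tV.
move: tI; rewrite /=; case: bumpP => [hx|u1 z u2 uE h1 h2] tI.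
  case: (ltnP (size u) b) => ub.
    by left; rewrite !left_size_cons size_rcons; move: ub; clear; lia.
  right; split.
    by case=> [|i] //; rewrite /row_of /= -cats1 takel_cat.
  rewrite !right_cut_cons //.
  rewrite /=; have -> : drop b (rcons u x) = rcons (drop b u) x by rewrite -!cats1 drop_cat_le.
  case: eqP => [|_]; first by case: (drop b u).
  case: eqP => [d0|d0]; last first.
    rewrite /= bump_end //; apply/allP => y /mem_drop; exact: (allP hx).
  rewrite d0 /=; congr (_ :: _); have := right_cut_cons tV; rewrite d0 eqxx => h.
  apply: row_of_ext => //; first exact: nil_drop_empty.
  move=> i; have := row_of_right_cut b tV i.+1.
  by rewrite h !row_of_nil row_of_right_cut // row_of_cons.
have szu : size (u1 ++ x :: u2) = size u by rewrite uE !size_cat.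
case: (ltnP (size u1) b) => u1b.
  left; rewrite !left_size_cons szu (@left_size_low (size u1)) //; first by clear; lia.
  move=> lt; have /domP[_ hd] := du; have := hd (size u1).
  rewrite /row_of nth0 in lt *; move/(_ lt).
  by rewrite uE nth_cat ltnn subnn /lei /= -ltNge.
case: (IH z tV') => [h|[h hr]]; [left|right].
  by rewrite !left_size_cons h szu; clear; lia.
split.
  case=> [|i] /=; last exact: h.
  by rewrite /row_of /= uE !takel_cat.
rewrite !right_cut_cons // uE !drop_cat_le //=.
case: eqP => [|_]; first by case: (drop b u1).
case: eqP => [|_]; first by case: (drop b u1).
rewrite hr /= (bump_at (s := false)) //=; apply/allP => y /mem_drop; exact: (allP h1).
Qed.

Lemma left_size_cut V : left_size V = area (left_cut b V).
Proof.
rewrite /area /left_size /entries /left_cut /drop_empty.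
by elim: (map (take b) V) => // u T IH; case: u => [|x u] //=; rewrite !size_cat IH.
Qed.

Lemma insw_cut V w : tab V ->
  (left_size V < left_size (insw false V w))%N \/
  left_cut b (insw false V w) = left_cut b V /\
  right_cut b (insw false V w) = insw false (right_cut b V) w.
Proof.
elim: w V => [|x w IH] V tV; first by right.
have tI := tabl_ins x tV; have [g|[g1 g2]] := ins_cut x tV.
  left; have [h|[h _]] := IH _ tI; rewrite /= in h *; first by lia.
  by rewrite [X in (_ < X)%N]left_size_cut h -left_size_cut g.
have gE : left_cut b (ins false V x) = left_cut b V.
  apply: row_of_ext; rewrite ?nil_drop_empty // => i.
  by rewrite !row_of_left_cut.
have [h|[h1 h2]] := IH _ tI; last by right; rewrite /= h1 gE h2 g2.
by left; rewrite left_size_cut -gE -left_size_cut.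
Qed.

End SingleInsertion.

(** * Canonical factors of a product with a rectangle *)

Section Canonical.
Variables (a b : nat) (T : diagram).
Hypothesis tT : tab T.
Hypothesis shT : shape T = [seq m <- nseq a b | m != 0%N].

(* [X] has at most [b] columns and the rows of [Y] below row [a] fit to the
   right of [X]. *)
Definition col_canonical X Y :=
  left_cut b (tmul X (drop a Y)) = X /\ right_cut b (tmul X (drop a Y)) = drop a Y.

(* In the product [X . T . Y] the first [a] rows are [T] and [Y], and [X] is below. *)
Definition row_canonical X Y :=
  take a (tmul (tmul X T) Y) = join T Y /\ drop a (tmul (tmul X T) Y) = X.

(** The two moves are alternated, starting with [Q] cut to [b] columns. By [insw_cut], multiplying
    [Q] by [drop a P] either leaves its first [b] columns unchanged, and then the pair is canonical,
    or adds boxes to them. In the latter case the new right factor is smaller, because the product,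
    and hence the total number of boxes, is unchanged. *)
Lemma canonical_exists (F : diagram -> diagram -> Prop) :
  (forall Q P, F Q P -> [/\ tab Q, tab P, entries_above T Q & entries_above T P]) ->
  (forall Q P, F Q P -> F (tmul Q (drop a P)) (take a P)) ->
  (forall Q P, F Q P -> F (left_cut b Q) (tmul (right_cut b Q) P)) ->
  forall Q P, F Q P -> exists X Y,
    [/\ F X Y, tmul (tmul X T) Y = tmul (tmul Q T) P & col_canonical X Y].
Proof.
move=> hF M1 M2 Q P; wlog : Q P / forall i, (size (row_of Q i) <= b)%N.
  move=> H FQP; have [tQ tP aQ aP] := hF _ _ FQP; have F2 := M2 _ _ FQP.
  have [|X [Y [h1 h2 h3]]] := H _ _ _ F2; first by move=> i; exact: row_of_leq_left.
  by exists X, Y; split=> //; rewrite h2 -(trip_left tT shT).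
elim: {P}(size (entries P)).+1 {-2}P (ltnSn (size (entries P))) Q => // m IH P sP Q hQ FQP.
have [tQ tP aQ aP] := hF _ _ FQP; have tD := tab_drop a tP.
have QE : left_cut b Q = Q.
  apply: row_of_ext; rewrite ?nil_drop_empty //; first by case/tablP: tQ.
  by move=> i; rewrite row_of_left_cut // take_oversize.
have F1 := M1 _ _ FQP; have F2 := M2 _ _ F1.
have [tQ1 tP1 aQ1 aP1] := hF _ _ F1.
have := insw_cut b (reading_word (drop a P)) tQ; rewrite -tmulE QE.
have R0 : right_cut b Q = [::].
  apply: row_of_ext; rewrite ?nil_drop_empty // => i.
  by rewrite row_of_right_cut // drop_oversize // row_of_nil.
rewrite R0 => -[lt|[h1 h2]]; last first.
  exists Q, P; split=> //; split=> //; rewrite h2.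
  exact: Pw_reading.
have EQ : tmul (tmul (left_cut b (tmul Q (drop a P))) T)
    (tmul (right_cut b (tmul Q (drop a P))) (take a P)) = tmul (tmul Q T) P.
  by rewrite -(trip_left tT shT) // -(tmul_top tT shT).
have [||X [Y [g1 g2 g3]]] := IH _ _ _ _ F2.
- have h1 := area_take_drop a P; have := congr1 area EQ; rewrite !area_tmul.
  by move: lt sP h1; rewrite !left_size_cut QE -/(area _) -/(area (tmul _ _)) area_tmul; lia.
- by move=> i; exact: row_of_leq_left.
by exists X, Y; split=> //; rewrite g2.
Qed.

(** The factors fit side by side: [T] on top of [X] at the left, [Y] at the right. The product is
    thus [join (T ++ X) Y], and the cut after column [b] separates them. *)
Lemma col_canonicalP X Y : tab X -> tab Y -> entries_above T X -> entries_above T Y ->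
  col_canonical X Y ->
  left_cut b (tmul (tmul X T) Y) = tmul X T /\
  right_cut b (tmul (tmul X T) Y) = Y.
Proof.
move=> tX tY aX aY [h1 h2].
have hX i : (size (row_of X i) <= b)%N.
  by rewrite -h1; apply: row_of_leq_left; exact: tab_tmul.
have tS := tab_stack tT shT tX hX aX; have sE := stack_mul tT shT tX hX aX.
have [nX _ dX] := tablP _ _ tX; have [nY _ dY] := tablP _ _ tY.
have tXD : tab (tmul X (drop a Y)) := tab_tmul _ tX.
have rS i : row_of (T ++ X) i = if (i < size T)%N then row_of T i else row_of X (i - size T).
  by rewrite /row_of nth_cat.
have sT : (size T = a /\ forall i, (i < a)%N -> size (row_of T i) = b) \/ T = [::] /\ (a = 0%N \/ b = 0%N).
  by case: (rect_rowsP shT) => [[? [? _]]|?]; [left|right].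
have JE : tmul (tmul X T) Y = join (T ++ X) Y.
  rewrite sE join_mul //; first exact: tabl_sorted.
  move=> i k ik x y; rewrite rS; case: ltnP => h xi yk.
    by apply/ltW/aY; apply/entriesP; [exists k | exists i].
  case: sT => [[sT _]|[T0 ab]]; last first.
    case: ab => ab; last first.
      by move: xi; have := hX (i - size T)%N; rewrite ab leqn0 size_eq0 => /eqP->.
    have := jcond_cut (b := b) tXD; rewrite h1 h2 ab drop0 => J.
    by apply: (J _ _ _ _ _ xi yk); rewrite T0 subn0.
  have := jcond_cut (b := b) tXD; rewrite h1 h2 => J.
  apply: (J _ (k - a)%N _ _ _ xi); first by rewrite sT; lia.
  by rewrite /row_of nth_drop subnKC //; lia.
have tJ : tab (join (T ++ X) Y) by rewrite -JE; apply/tab_tmul/tab_tmul.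
rewrite JE sE; apply: cut_join => // i; rewrite rS; case: ltnP => h.
- by rewrite (rect_row shT); case: ifP.
- exact: hX.
- move=> _; case: sT => [[sT hT]|[T0 _]]; last by rewrite T0 in h.
  by apply: hT; rewrite -sT.
move=> hi; case: sT => [[sT hT]|[T0 ab]].
  rewrite -{1}h1; apply: (cut_flush tXD); rewrite h2 sT /row_of nth_drop subnKC //.
  by rewrite -sT.
rewrite T0 subn0; case: ab => ab.
  by rewrite -{1}h1; apply: (cut_flush tXD); rewrite h2 ab drop0.
by apply/eqP; rewrite ab -leqn0 -ab hX.
Qed.

(** The same picture [join (T ++ X) Y], cut after row [a]: above are [T] and the first rows of [Y],
    below are [X] and [drop a Y] side by side, which is their product. *)
Lemma col_row_canonical X Y : tab X -> tab Y -> entries_above T X -> entries_above T Y ->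
  col_canonical X Y -> row_canonical (tmul X (drop a Y)) (take a Y).
Proof.
move=> tX tY aX aY cXY; have [h1 h2] := cXY.
have [g1 g2] := col_canonicalP tX tY aX aY cXY.
rewrite /row_canonical -(tmul_top tT shT) //.
have hX i : (size (row_of X i) <= b)%N.
  by rewrite -h1; apply: row_of_leq_left; exact: tab_tmul.
have sE := stack_mul tT shT tX hX aX.
have tW : tab (tmul (tmul X T) Y) by apply/tab_tmul/tab_tmul.
have WE : tmul (tmul X T) Y = join (T ++ X) Y by rewrite -[LHS](join_cut b tW) g1 g2 sE.
have JX : join X (drop a Y) = tmul X (drop a Y).
  by rewrite -[RHS](join_cut b (tab_tmul _ tX)) h1 h2.
rewrite WE -JX; case: (rect_rowsP shT) => [[sT [hT b0]]|[T0 ab]].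
  rewrite join_cat sT take_size_cat ?drop_size_cat //.
    have sj L R : size (join L R) = maxn (size L) (size R).
      by elim: L R => [|l L IHL] [|r R] //=; rewrite ?max0n ?maxn0 // IHL maxnSS.
    by rewrite sj sT size_take_min; apply/maxn_idPl; exact: geq_minl.
  have sj L R : size (join L R) = maxn (size L) (size R).
    by elim: L R => [|l L IHL] [|r R] //=; rewrite ?max0n ?maxn0 // IHL maxnSS.
  by rewrite sj sT size_take_min; apply/maxn_idPl; exact: geq_minl.
case: ab => ab; first by rewrite T0 ab !take0 !drop0.
have X0 : X = [::].
  have [nX _ _] := tablP _ _ tX; apply: row_of_ext => // i; rewrite row_of_nil.
  by apply/eqP; rewrite -size_eq0 -leqn0 -ab.
by rewrite T0 X0.
Qed.

(** The diagram around [T] reads as [X] followed by [T . Y]; so if it is a tableau, it is the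
    product. Some of its first [a] rows may be empty, hence [drop_empty]. *)
Lemma row_canonicalP X Y : tab X -> tab Y -> (size Y <= a)%N ->
  entries_above T X -> entries_above T Y ->
  row_canonical X Y <-> fits_around a X T Y.
Proof.
move=> tX tY sY aX aY.
have rA i : row_of (around a X T Y) i = if (i < a)%N then row_of T i ++ row_of Y i else row_of X (i - a).
  rewrite /row_of /around nth_cat size_mkseq; case: ltnP => // h.
  by rewrite nth_mkseq.
rewrite /fits_around no_violation_dom; split=> [[h1 h2]|h].
  have tW : tab (tmul (tmul X T) Y) by apply/tab_tmul/tab_tmul.
  have [_ _ dW] := tablP _ _ tW.
  suff E : row_of (around a X T Y) =1 row_of (tmul (tmul X T) Y) by move=> i; rewrite !E.
  move=> i; rewrite rA; case: ltnP => hi.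
    by rewrite -row_of_join -h1 /row_of nth_take.
  by rewrite -{1}h2 /row_of nth_drop subnKC.
have sT : (size T <= a)%N by case: (rect_rowsP shT) => [[-> _]|[->]].
have sA i : sorted lew (row_of (around a X T Y) i).
  rewrite rA; case: ltnP => hi; last by case/tablP: tX.
  rewrite -row_of_join -(tmul_above tT) //.
  by have /tablP[_ ] := tab_tmul Y tT.
have tA := tabl_drop_empty sA h; have rE := row_of_drop_empty h.
set A := drop_empty _ in tA rE.
have nA : [::] \notin A by exact: nil_drop_empty.
have tJ : tab (join T Y) by rewrite -(tmul_above tT) //; exact: tab_tmul.
have [nJ _ _] := tablP _ _ tJ; have [nX _ _] := tablP _ _ tX.
have tkA : take a A = join T Y.
  apply: row_of_ext => //; first by apply: contra nA; exact: mem_take.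
  move=> i; rewrite row_of_join; case: (ltnP i a) => hi.
    by have := rA i; rewrite hi -rE /row_of nth_take.
  by rewrite !row_of_default ?(leq_trans _ hi) // size_take_min geq_minl.
have dpA : drop a A = X.
  apply: row_of_ext => //; first by apply: contra nA; exact: mem_drop.
  by move=> i; have := rA (a + i)%N; rewrite ltnNge leq_addr /= addKn -rE /row_of nth_drop.
suff E : tmul (tmul X T) Y = A by rewrite /row_canonical E.
by rewrite tmulA // (tmul_above tT) // -tkA -[X in tmul X _]dpA tmul_take_drop.
Qed.

End Canonical.

(** * The exchange operation *)

Notation rb := (rbumpw false).

Lemma rb_cons a v x u : sorted lew (x :: u) ->
  rb (a :: v) (x :: u) = if a <= x then (a :: (rb v (x :: u)).1, (rb v (x :: u)).2)
                         else (x :: (rb v u).1, a :: (rb v u).2).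
Proof.
move=> su; have xu : all (lew x) u.
  by move: su; rewrite /= (path_sortedE (@lei_trans false)) => /andP[].
case: ifPn => ax.
  rewrite -cat1s bumpw_prefix //= andbT /lei ax /=.
  by apply: sub_all xu => y; rewrite /lei; exact: le_trans.
rewrite /= /lei (negPf ax) /= -[x :: v]cat1s bumpw_prefix //= andbT.
exact: xu.
Qed.

Lemma rb0 v : rb v [::] = (v, [::]). Proof. by []. Qed.

Arguments rbumpw : simpl never.

Lemma rb_nil u : sorted lew u -> rb [::] u = (u, [::]).
Proof. by move=> su; rewrite bumpw_end. Qed.

Lemma rb_subseq v u : sorted lew u -> subseq (rb v u).2 v.
Proof.
elim: v u => [|a v IH] u su; first by rewrite rb_nil.
case: u su => [|x u] su //; rewrite rb_cons //; case: ifP => _ /=.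
  exact: subseq_trans (IH _ su) (subseq_cons _ _).
by rewrite eqxx; apply: IH; exact: path_sorted su.
Qed.

Lemma rb_step v x u : rb v (x :: u) =
  ((rb (rbump false v x).1 u).1, (rbump false v x).2 ++ (rb (rbump false v x).1 u).2).
Proof. by []. Qed.

Lemma rb_out_size v u : (size (rb v u).2 <= size u)%N.
Proof.
elim: u v => [|x u IH] v //; rewrite rb_step size_cat /=.
by have := bump_out false v x; have := IH (rbump false v x).1; lia.
Qed.

Lemma sorted_rb_out v u : sorted lew v -> sorted lew u -> sorted lew (rb v u).2.
Proof.
by move=> sv su; apply: (subseq_sorted (@lei_trans false)) sv; exact: rb_subseq.
Qed.

(** The letters of a weakly increasing word enter from left to right, so once one of them is
    appended, all later ones are. *)
Lemma rb_split v u : sorted lew u -> exists u1 u2,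
  [/\ u = u1 ++ u2, size (rb v u1).2 = size u1, size (rb v u1).1 = size v &
      rb v u = ((rb v u1).1 ++ u2, (rb v u1).2)].
Proof.
elim: v u => [|a v IH] u su; first by exists [::], u; rewrite rb0 (rb_nil su).
case: u su => [|x u] su; first by exists [::], [::]; rewrite !rb0 !cats0.
rewrite rb_cons //; case: ifP => ax.
  have [u1 [u2 [uE h1 h2 h3]]] := IH _ su; rewrite h3.
  have E : rb (a :: v) u1 = (a :: (rb v u1).1, (rb v u1).2).
    rewrite -cat1s bumpw_prefix //= andbT; apply/allP => y yu1.
    have : y \in x :: u by rewrite uE mem_cat yu1.
    move: su; rewrite /= (path_sortedE (@lei_trans false)) inE => /andP[/allP h _].
    by case/predU1P => [->|/h]; rewrite /lei // => /(le_trans ax).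
  by exists u1, u2; rewrite E /= h1 h2 uE.
have [u1 [u2 [uE h1 h2 h3]]] := IH _ (path_sorted su); rewrite h3.
have E : rb (a :: v) (x :: u1) = (x :: (rb v u1).1, a :: (rb v u1).2).
  rewrite rb_cons ?ax //; move: su; rewrite uE -cat_cons => /cat_sorted2[]//.
by exists (x :: u1), u2; rewrite E /= h1 h2 uE.
Qed.

(** An order-reversing symmetry that keeps rows weakly increasing and turns reverse bumping into
    bumping. *)
Definition nu (u : seq int) : seq int := rev (map -%R u).

Lemma nuK : involutive nu.
Proof. by move=> u; rewrite /nu map_rev revK -map_comp map_id_in // => x _ /=; rewrite opprK. Qed.

Lemma size_nu u : size (nu u) = size u. Proof. by rewrite size_rev size_map. Qed.

Lemma sorted_nu u : sorted lew (nu u) = sorted lew u.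
Proof.
by rewrite rev_sorted sorted_map; apply: eq_sorted => x y; rewrite /lei /= lerN2.
Qed.

Lemma nu_cat u v : nu (u ++ v) = nu v ++ nu u.
Proof. by rewrite /nu map_cat rev_cat. Qed.

Lemma rbump_inv v x v' b : sorted lew v -> rbump false v x = (v', [:: b]) ->
  rbump false (nu v') (- b) = (nu v, [:: - x]).
Proof.
move=> sv; case: bumpP => [//|u1 b' u2 vE h1 h2] [<- <-].
have [s1 h3] : sorted lew u1 /\ all (lew b') u2.
  move: sv; rewrite vE (sorted_pairwise (@lei_trans false)) pairwise_cat /=.
  by case/and4P=> _ h4 h5 _; rewrite (sorted_pairwise (@lei_trans false)).
have nuE y : nu (u1 ++ y :: u2) = nu u2 ++ (- y) :: nu u1.
  by rewrite nu_cat -cat1s nu_cat /nu /= -catA.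
rewrite vE !nuE bump_at //.
  apply/allP => y; rewrite /nu mem_rev => /mapP[z zu ->].
  by have := allP h3 z zu; rewrite /lei lerN2.
by move: h2; rewrite /lei lerN2.
Qed.

Lemma rb_inv v u : sorted lew v -> size (rb v u).2 = size u ->
  rb (nu (rb v u).1) (nu (rb v u).2) = (nu v, nu u).
Proof.
elim: u v => [|x u IH] v sv //; rewrite rb_step /= size_cat.
have := sorted_bump x sv; have := rbump_inv sv (x := x).
case E : (rbump false v x) (bump_out false v x) => [v1 [|b []]] //= _.
  by have := rb_out_size v1 u; lia.
move=> /(_ _ _ erefl) h sv1 [sz]; rewrite -cat1s !nu_cat bumpw_cat.
have -> : nu [:: b] = [:: - b] by [].
rewrite (IH _ sv1 sz) [(nu v1, _).1]/= [(nu v1, _).2]/= rb_step h /=.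
by congr (_, _); rewrite /nu /= rev_cons cats1.
Qed.

(** When every letter bumps, [nu] inverts the process. In general the appended letters are those of
    the new row beyond the length of the old one, which is why the lengths of [v] and [v'] must
    agree. *)
Lemma rb_inj v u v' u' : sorted lew v -> sorted lew u -> sorted lew v' -> sorted lew u' ->
  size v = size v' -> rb v u = rb v' u' -> v = v' /\ u = u'.
Proof.
move=> sv su sv' su' szv; have [u1 [u2 [uE h1 h2 h3]]] := rb_split v su.
have [u1' [u2' [uE' h1' h2' h3']]] := rb_split v' su'.
rewrite h3 h3' => -[e1 e2].
have /eqP := e1; rewrite eqseq_cat ?h2 ?h2' // => /andP[/eqP e3 /eqP e4].
have i1 := rb_inv sv h1; have i2 := rb_inv sv' h1'.
move: i1; rewrite e3 e2 i2 => -[/(inv_inj nuK) <- /(inv_inj nuK) e5].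
by rewrite uE uE' e4 e5.
Qed.

(** The comparison is right-aligned: each letter of [u] bumps at the latest at the place that leaves
    just enough room for the letters after it. *)
Lemma rb_all_bump v u : sorted lew v -> sorted lew u -> (size u <= size v)%N ->
  (forall k, (k < size u)%N -> nth 0 u k < nth 0 v (size v - size u + k)) ->
  size (rb v u).2 = size u.
Proof.
elim: v u => [|a v IH] u sv su; first by rewrite leqn0 size_eq0 => /eqP->.
case: u su => [|x u] su // szu h; rewrite rb_cons //; case: ifPn => ax.
  have szv : (size u < size v)%N.
    move: szu; rewrite /= ltnS leq_eqVlt => /predU1P[E|//].
    by have := h 0%N isT; rewrite /= E subnn /= ltNge ax.
  apply: (IH (x :: u)); rewrite ?(path_sorted sv) // => k ku.
  have := h k ku; rewrite [size (_ :: _)]/= [size (x :: u)]/= subSS => /=.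
  by rewrite (_ : (size v - size u + k) = (size v - (size u).+1 + k).+1)%N //; lia.
rewrite [RHS]/= -[in RHS](IH u) //; rewrite ?(path_sorted sv) ?(path_sorted su) // => k ku.
by have := h k.+1 ku; rewrite [size (_ :: _)]/= [size (x :: u)]/= subSS addnS.
Qed.

(** The first [m] letters of [w1] are taken for the row after bumping and [w2] for the letters
    bumped. Undoing this gives [v] and the beginning of [u]; the rest of [w1] was appended. *)
Lemma rb_exists w1 w2 m : sorted lew w1 -> sorted lew w2 -> dom false w1 w2 ->
  (size w2 <= m <= size w1)%N ->
  exists v u, [/\ sorted lew v, sorted lew u, size v = m & rb v u = (w1, w2)].
Proof.
move=> s1 s2 dw /andP[m2 m1]; pose w' := take m w1; pose u2 := drop m w1.
have sw' : sorted lew w' by exact: take_sorted.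
have szw' : size w' = m by rewrite size_takel.
have /domP[_ hd] := dw.
(* Seen through [nu], domination becomes the right-aligned comparison of [rb_all_bump]. *)
have sz : size (rb (nu w') (nu w2)).2 = size (nu w2).
  apply: rb_all_bump; rewrite ?sorted_nu ?size_nu ?szw' // => k k2.
  rewrite /nu !nth_rev ?size_map ?szw' //; last by lia.
  rewrite !(nth_map 0) ?szw'; try lia.
  have -> : (m - (m - size w2 + k).+1 = size w2 - k.+1)%N by lia.
  rewrite ltrN2 nth_take; last by lia.
    by have := hd (size w2 - k.+1)%N; rewrite /lei -ltNge; apply; lia.
  by rewrite ltn_subrL /=; apply: leq_ltn_trans k2.
have := rb_inv _ sz; rewrite !nuK sorted_nu sw' => /(_ isT).
set v := nu _; set u1 := nu _ => E.
have sv : sorted lew v by rewrite sorted_nu; apply: sorted_bumpw; rewrite sorted_nu.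
have su1 : sorted lew u1 by rewrite sorted_nu; apply: sorted_rb_out; rewrite sorted_nu.
have sub x : x \in u1 -> x \in w'.
  rewrite /u1 /nu mem_rev => /mapP[y].
  have /mem_subseq sb := @rb_subseq (nu w') (nu w2) (etrans (sorted_nu _) s2).
  move/sb; rewrite /nu mem_rev => /mapP[z zw ->] ->.
  by rewrite opprK.
have le12 x y : x \in w' -> y \in u2 -> x <= y.
  move=> xw yu; move: s1; rewrite -(cat_take_drop m w1) (sorted_pairwise (@lei_trans false)).
  by rewrite pairwise_cat => /and3P[/allrelP h _ _]; exact: h.
exists v, (u1 ++ u2); split=> //.
- rewrite (sorted_pairwise (@lei_trans false)) pairwise_cat -!(sorted_pairwise (@lei_trans false)).
  rewrite su1 drop_sorted // !andbT; apply/allrelP => x y /sub; exact: le12.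
- have := size_bumpw false (nu w') (nu w2); rewrite /v size_nu !size_nu szw' sz size_nu; lia.
- rewrite bumpw_cat E bumpw_end ?drop_sorted // ?cats0 ?cat_take_drop //.
  by apply/allP => x xw; apply/allP => y; exact: le12.
Qed.

Lemma Pw_two v u : sorted lew u -> sorted lew v -> v ++ u != [::] ->
  Pw (v ++ u) = (rb v u).1 :: row_tableau (rb v u).2.
Proof.
move=> su sv n0; have E : Pw (v ++ u) = (rb [::] (v ++ u)).1 :: insw false [::] (rb [::] (v ++ u)).2.
  exact: insw_nil.
move: E; rewrite bumpw_cat rb_nil //= => ->; congr (_ :: _).
have so := sorted_rb_out sv su; rewrite /row_tableau /drop_empty /=.
case: eqP => [->//|/eqP h]; rewrite insw_nil // rb_nil //.
Qed.

Lemma tmul_rows2 v u : sorted lew v -> sorted lew u ->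
  tmul (row_tableau v) (row_tableau u) = Pw (v ++ u).
Proof.
move=> sv su; have h w : sorted lew w -> tab (row_tableau w) /\ reading_word (row_tableau w) = w.
  rewrite /row_tableau /drop_empty /=; case: eqP => [->//|/eqP nw] /= sw.
  by rewrite nw sw dom0 /reading_word /= cats0.
by have [tv rv] := h _ sv; have [tu ru] := h _ su; rewrite tmul_Pw // rv ru.
Qed.

Lemma rb_Pw v u v' u' : sorted lew v -> sorted lew u -> sorted lew v' -> sorted lew u' ->
  (rb v u = rb v' u') <-> (Pw (v ++ u) = Pw (v' ++ u')).
Proof.
move=> sv su sv' su'.
have nilP w : Pw w = [::] -> w = [::].
  move=> h; apply/nilP; rewrite /nilp -(perm_size (perm_insw false [::] w)).
  by rewrite -/(P _ _) h.
have sz1 w w' : rb w w' = ([::], [::]) -> w ++ w' = [::].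
  by move=> h; have := size_bumpw false w w'; rewrite h /= -size_cat => /esym/size0nil.
have [e|n] := eqVneq (v ++ u) [::]; have [e'|n'] := eqVneq (v' ++ u') [::].
- by case: v u v' u' e e' {sv su sv' su'} => [|? ?] [|? ?] [|? ?] [|? ?].
- split=> h.
    case/eqP: n'; apply: sz1; rewrite -h.
    by case: v u e {sv su h} => [|? ?] [|? ?].
  by case/eqP: n'; apply: nilP; rewrite -h e.
- split=> h.
    case/eqP: n; apply: sz1; rewrite h.
    by case: v' u' e' {sv' su' h} => [|? ?] [|? ?].
  by case/eqP: n; apply: nilP; rewrite h e'.
rewrite !Pw_two //; split=> [-> //|[e1]].
rewrite /row_tableau /drop_empty /= => e2; apply: injective_projections => //.
by move: e2; case: eqP => [->|_]; case: eqP => [->|_] // [].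
Qed.

Lemma two_rows_uniq v u v' u' :
  sorted lew v -> sorted lew u -> sorted lew v' -> sorted lew u' ->
  size v = size v' -> Pw (v ++ u) = Pw (v' ++ u') -> v = v' /\ u = u'.
Proof. by move=> sv su sv' su' szv /rb_Pw h; apply: rb_inj => //; apply: h. Qed.

(** The second row of the product consists of letters of [y] bumped by letters of [x], so it is no
    longer than either factor, and [rb_exists] applies with the lengths in the other order. Both the
    exchange operation and the commutation of the h_m rest on this. *)
Lemma two_rows_swap y x : sorted lew y -> sorted lew x ->
  exists v u, [/\ sorted lew v, sorted lew u, size v = size x, size u = size y &
    Pw (v ++ u) = Pw (y ++ x)].
Proof.
move=> sy sx; case E : (rb y x) => [w1 w2].
have sw1 : sorted lew w1 by have := sorted_bumpw x sy; rewrite E.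
have sw2 : sorted lew w2 by have := sorted_rb_out sy sx; rewrite E.
have dw : dom false w1 w2.
  have [e|n] := eqVneq (y ++ x) [::].
    by move: E; case: y e {sy} => [|? ?] //; case: x {sx} => [|? ?] // _; rewrite rb0 => -[<- <-].
  have := tabl_P false (y ++ x); rewrite Pw_two // E /=.
  rewrite /row_tableau /drop_empty /=; by case: (eqVneq w2 [::]) => [->|_] /and4P[]; rewrite ?dom0.
have z1 := size_bumpw false y x; have z2 := rb_out_size y x.
have z3 := size_subseq (rb_subseq y sx); rewrite E /= in z1 z2 z3.
have [|v [u [sv su szv h]]] := @rb_exists w1 w2 (size x) sw1 sw2 dw; first by lia.
have z4 := size_bumpw false v u; rewrite h /= in z4.
exists v, u; split=> //; first by lia.
by apply/rb_Pw => //; rewrite h.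
Qed.

Lemma Pw_row v w : sorted lew v -> v != [::] ->
  Pw (v ++ w) = (rb v w).1 :: Pw (rb v w).2.
Proof.
move=> sv nv; rewrite /P insw_nil; last by case: v nv {sv}.
by rewrite bumpw_cat rb_nil.
Qed.

Lemma rb_all_bump_cat p q w : size (rb p w).2 = size w ->
  rb (p ++ q) w = ((rb p w).1 ++ q, (rb p w).2).
Proof.
elim: w p => [|x w IH] p //; rewrite !rb_step size_cat.
have h0 := rb_out_size (rbump false p x).1 w.
case: (bumpP false p x) h0 => [_|p1 b p2 -> h1 h2] h0 /=; first by move: h0 => /=; lia.
move=> [sz]; rewrite -catA cat_cons bump_at //= -cat_cons catA IH //.
Qed.

Lemma allrel_le_sorted (p q : seq int) : sorted lew p -> sorted lew q ->
  (forall x y, x \in p -> y \in q -> x <= y) -> sorted lew (p ++ q).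
Proof.
move=> sp sq h; rewrite (sorted_pairwise (@lei_trans false)) pairwise_cat.
rewrite -!(sorted_pairwise (@lei_trans false)) sp sq !andbT.
by apply/allrelP => x y; exact: h.
Qed.

(* The letters of [p] bumped by [w] all lie in [p], so that [q] slides past [w]. *)
Lemma plact_slide p q w z : sorted lew p -> sorted lew q -> sorted lew w ->
  size p = (size w).+1 -> (forall k, (k < size w)%N -> nth 0 w k < nth 0 p k.+1) ->
  {in p, forall x, x <= z} -> {in w, forall x, x <= z} -> {in q, forall x, z <= x} ->
  plact false (p ++ q ++ w) (p ++ w ++ q).
Proof.
move=> sp sq sw szp pw pz wz qz.
have ab : size (rb p w).2 = size w.
  by apply: rb_all_bump; rewrite // szp // => k kw; rewrite subSn // subnn add1n; exact: pw.
have np : p != [::] by rewrite -size_eq0 szp.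
have spq : sorted lew (p ++ q).
  by apply: allrel_le_sorted => // x y /pz h /qz; exact: le_trans h.
apply: plact_of_P; rewrite [X in Pw X = _]catA !Pw_row //; last by case: (p) np.
rewrite rb_all_bump_cat // bumpw_cat; suff -> : rb (rb p w).1 q = ((rb p w).1 ++ q, [::]).
  by rewrite /= cats0.
apply: bumpw_end => //; apply/allP => x xm; apply/allP => y /qz; apply: le_trans.
have : x \in (rb p w).1 ++ (rb p w).2 by rewrite mem_cat xm.
by rewrite (perm_mem (perm_bumpw _ _ _)) mem_cat => /orP[/pz|/wz].
Qed.

Definition srows (D : diagram) := forall i, sorted lew (row_of D i).

Lemma set_rowsE (D : diagram) k u v : (0 < k < size D)%N ->
  set_nth [::] (set_nth [::] D k.-1 u) k v = take k.-1 D ++ u :: v :: drop k.+1 D.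
Proof.
case: k => [//|k] /= kD; elim: k D kD => [|k IH] [|x D] //=.
  by case: D => //= y D; rewrite drop0.
by rewrite ltnS => /IH->.
Qed.

Lemma rows_splitE (D : diagram) k : (0 < k < size D)%N ->
  D = take k.-1 D ++ row_of D k.-1 :: row_of D k :: drop k.+1 D.
Proof.
case: k => [//|k] /= kD; rewrite -{1}(cat_take_drop k D); congr (_ ++ _).
by rewrite (drop_nth [::]) 1?(drop_nth [::] kD) // ltnW.
Qed.

Lemma row_of_set (D : diagram) k u v i : (0 < k)%N ->
  row_of (set_nth [::] (set_nth [::] D k.-1 u) k v) i =
  if i == k then v else if i == k.-1 then u else row_of D i.
Proof. by move=> _; rewrite /row_of !nth_set_nth /= nth_set_nth. Qed.

Lemma violation_size D k j : violation D k j -> (0 < k < size D)%N.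
Proof.
case/and3P=> k0 jk _; rewrite k0 ltnNge; apply/negP => h.
by rewrite row_of_default in jk.
Qed.

Lemma first_violation D k j : violation D k j ->
  exists2 m, violation D k m & forall j', (j' < m)%N -> ~~ violation D k j'.
Proof.
move=> v; have ex : exists m, violation D k m by exists j.
case: (ex_minnP ex) => m vm min; exists m => // j' lt.
by apply/negP => /min; rewrite leqNgt lt.
Qed.

Lemma exchange_uniq k D D1 D2 : exchange k D D1 -> exchange k D D2 -> D1 = D2.
Proof.
move=> [_ [u [v [su sv [ssu ssv] h ->]]]] [_ [u' [v' [su' sv' [ssu' ssv'] h' ->]]]].
move: h; rewrite -h' !tmul_rows2 // => h.
by have [-> ->] := two_rows_uniq ssv ssu ssv' ssu' (etrans sv (esym sv')) h.
Qed.

(* [D'] is the result of exchanging rows [k-1] and [k] of [D], where [j] is the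
   column of the leftmost violation of row [k]; the boxes left of it do not move. *)
Record exchanged (k j : nat) (D D' : diagram) : Prop := Exchanged {
  exch_srows0 : srows D;
  exch_rel : exchange k D D';
  exch_viol : violation D k j;
  exch_first : forall j', (j' < j)%N -> ~~ violation D k j';
  exch_srows : srows D';
  exch_size : size D' = size D;
  exch_row : forall i, i != k -> i != k.-1 -> row_of D' i = row_of D i;
  exch_up : take j (row_of D' k.-1) = take j (row_of D k.-1);
  exch_down : take j.+1 (row_of D' k) = take j.+1 (row_of D k);
  exch_size_up : size (row_of D' k.-1) = (size (row_of D k)).-1;
  exch_size_down : size (row_of D' k) = (size (row_of D k.-1)).+1;
  exch_up_le : (j <= size (row_of D k.-1))%N;
  exch_ge : {in drop j (row_of D' k.-1), forall x, nth 0 (row_of D k) j <= x};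
  exch_word : plact false (row_of D' k ++ row_of D' k.-1) (row_of D k ++ row_of D k.-1)
}.

(** Only the parts beyond the violation are exchanged. The lower row keeps [j.+1] letters and the
    upper row [j], which accounts for the lengths growing and shrinking by one. *)
Lemma exchange_exists k j D : srows D -> violation D k j ->
  (forall j', (j' < j)%N -> ~~ violation D k j') -> exists D', exchanged k j D D'.
Proof.
move=> sD vD first; have /andP[k0 kD] := violation_size vD.
case/and3P: (vD) => _ jy hj; set y := row_of D k in jy hj *; set x := row_of D k.-1 in hj *.
have sy : sorted lew y by exact: sD.
have sx : sorted lew x by exact: sD.
have lt j' : (j' < j)%N -> (j' < size x)%N /\ nth 0 x j' < nth 0 y j'.
  move=> lt; have := first _ lt; rewrite /violation k0 -/x -/y (ltn_trans lt jy) /= negbK.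
  by case/andP.
have jx : (j <= size x)%N.
  by case: (posnP j) => [->//|j0]; have [h _] := lt j.-1 ltac:(lia); lia.
(* The letter at the violation is a pivot: it is at least every letter that is kept and at most
   every letter that is exchanged. *)
pose z := nth 0 y j.
have ym : {in take j.+1 y, forall w, w <= z}.
  move=> w /mem_nthP[i]; rewrite size_take_min => hi <-; rewrite nth_take; last by lia.
  by apply: sorted_nth_le => //; lia.
have yp : {in drop j.+1 y, forall w, z <= w}.
  move=> w /mem_nthP[i]; rewrite size_drop => hi <-; rewrite nth_drop.
  by apply: sorted_nth_le => //; lia.
have xm : {in take j x, forall w, w <= z}.
  move=> w /mem_nthP[i]; rewrite size_take_min => hi <-; rewrite nth_take; last by lia.
  have [_ h] := lt i ltac:(lia); apply: le_trans (ltW h) _.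
  by apply: sorted_nth_le => //; lia.
have xp : {in drop j x, forall w, z <= w}.
  move=> w /mem_nthP[i]; rewrite size_drop => hi <-; rewrite nth_drop.
  apply: (@le_trans _ _ (nth 0 x j)); last by apply: sorted_nth_le => //; lia.
  by move: hj; rewrite (_ : (j < size x)%N) /= ?leNgt //; lia.
have [vp [up [svp sup szv szu hP]]] := two_rows_swap (drop_sorted j.+1 sy) (drop_sorted j sx).
have mem w : (w \in vp ++ up) = (w \in drop j.+1 y ++ drop j x).
  by rewrite (perm_mem (perm_plact (plact_of_P hP))).
have vpz : {in vp, forall w, z <= w}.
  by move=> w wv; have := mem w; rewrite !mem_cat wv /= => /esym/orP[/yp|/xp].
have upz : {in up, forall w, z <= w}.
  by move=> w wv; have := mem w; rewrite !mem_cat wv orbT /= => /esym/orP[/yp|/xp].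
pose u := take j x ++ up; pose v := take j.+1 y ++ vp.
have su : sorted lew u.
  apply: allrel_le_sorted; rewrite ?take_sorted // => a b /xm h /upz; exact: le_trans h.
have sv : sorted lew v.
  apply: allrel_le_sorted; rewrite ?take_sorted // => a b /ym h /vpz; exact: le_trans h.
have sztx : size (take j x) = j by rewrite size_takel.
have szty : size (take j.+1 y) = j.+1 by rewrite size_takel.
have szu' : size u = (size y).-1 by rewrite size_cat sztx szu size_drop; lia.
have szv' : size v = (size x).+1 by rewrite size_cat szty szv size_drop; lia.
(* The kept part of the upper row slides to the left past the exchanged part of the lower row, so
   that the two exchanged parts become adjacent. *)
have slide q t : sorted lew q -> {in q, forall w, z <= w} ->
    plact false ((take j.+1 y ++ q) ++ take j x ++ t) ((take j.+1 y ++ take j x) ++ q ++ t).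
  move=> sq qz; have -> : (take j.+1 y ++ q) ++ take j x ++ t = (take j.+1 y ++ q ++ take j x) ++ t.
    by rewrite -!catA.
  have -> : (take j.+1 y ++ take j x) ++ q ++ t = (take j.+1 y ++ take j x ++ q) ++ t.
    by rewrite -!catA.
  apply: plact_catr; apply: (@plact_slide _ _ _ z); rewrite ?take_sorted // ?sztx ?szty // => k' hk.
  rewrite !nth_take //; have [_ h] := lt _ hk; apply: lt_le_trans h _.
  by apply: sorted_nth_le => //; lia.
have prod : plact false (v ++ u) (y ++ x).
  apply: plact_trans (slide _ _ svp vpz) _.
  rewrite -[y in plact _ _ (y ++ _)](cat_take_drop j.+1) -[x in plact _ _ (_ ++ x)](cat_take_drop j).
  apply: plact_sym; apply: plact_trans (slide _ _ (drop_sorted _ sy) yp) _.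
  by apply: plact_catl; apply: plact_sym; exact: plact_of_P.
exists (set_nth [::] (set_nth [::] D k.-1 u) k v).
have kk : (k.-1 == k) = false by apply/eqP; lia.
have rE := row_of_set D u v; split; rewrite ?rE ?eqxx ?kk //.
- split; first by exists j.
  exists u, v; split=> //; rewrite -/x -/y !tmul_rows2 //; exact: P_plact.
- by move=> i; rewrite rE //; case: ifP => // _; case: ifP.
- by rewrite !size_set_nth; lia.
- by move=> i ik ik1; rewrite rE // (negPf ik) (negPf ik1).
- by rewrite /u take_size_cat.
- by rewrite /v take_size_cat.
- by rewrite /u drop_size_cat.
Qed.

Lemma exchangedP k D D' : srows D -> exchange k D D' -> exists j, exchanged k j D D'.
Proof.
move=> sD xD; have [[j0 v0] _] := xD; have [j vj fj] := first_violation v0.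
have [D2 h] := exchange_exists sD vj fj; exists j.
by rewrite (exchange_uniq xD (exch_rel h)).
Qed.

Lemma take_agree (m c : nat) (u v : seq int) : take m u = take m v -> (c < m)%N ->
  (c < size u)%N = (c < size v)%N /\ nth 0 u c = nth 0 v c.
Proof.
move=> h cm; split; last by rewrite -(nth_take 0 cm) h nth_take.
by have := congr1 size h; rewrite !size_take_min; lia.
Qed.

Section Exchanged.
Variables (k j : nat) (D D' : diagram).
Hypothesis X : exchanged k j D D'.

Let k0 : (0 < k)%N. Proof. by have /andP[] := violation_size (exch_viol X). Qed.

Lemma exchange_violation : violation D' k j.
Proof.
case/and3P: (exch_viol X) => _ jy hj.
have [e1 e2] := take_agree (exch_down X) (ltnSn j).
rewrite /violation k0 e1 jy e2 /= negb_and -leqNgt -leNgt.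
case: ltnP => //= h; apply: (exch_ge X).
have -> : nth 0 (row_of D' k.-1) j = nth 0 (drop j (row_of D' k.-1)) 0 by rewrite nth_drop addn0.
by rewrite mem_nth // size_drop subn_gt0.
Qed.

(** Row [k] is unchanged up to column [j] and row [k.-1] before column [j]. A position not beyond
    [(k, j)] in the order of violations looks only at these boxes and at other rows, apart from
    [(k, j)] itself, which stays a violation. *)
Lemma exchange_status i' j' : violation_le i' j' k j ->
  violation D' i' j' = violation D i' j'.
Proof.
move=> le; case: (posnP i') => [->//|i0]; rewrite /violation i0 /=.
have [ik|ik] := eqVneq i' k.
  have jj : (j' <= j)%N by move: le; rewrite ik /violation_le; lia.
  move: jj; rewrite leq_eqVlt => /predU1P[jj|lt].
    have := exchange_violation; have := exch_viol X.
    by rewrite /violation ik jj k0 /= => -> ->.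
  rewrite ik; have [-> ->] := take_agree (exch_up X) lt.
  by have [-> ->] := take_agree (exch_down X) (ltnW lt).
have [ik1|ik1] := eqVneq i' k.+1.
  have jj : (j' < j.+1)%N by move: le; rewrite ik1 /violation_le; lia.
  rewrite ik1 -[k.+1.-1]/k; have [-> ->] := take_agree (exch_down X) jj.
  by rewrite (exch_row X) //; lia.
have [ik2|ik2] := eqVneq i' k.-1.
  have jj : (j' < j)%N by move: le; rewrite ik2 /violation_le; lia.
  rewrite ik2; have [-> ->] := take_agree (exch_up X) jj.
  by rewrite (exch_row X) //; lia.
by rewrite !(exch_row X) //; lia.
Qed.

Lemma exchange_sym : exchange k D' D.
Proof.
have kD := violation_size (exch_viol X); have [_ [u [v [su sv [ssu ssv] h E]]]] := exch_rel X.
split; first by exists j; exact: exchange_violation.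
have kk : (k.-1 == k) = false by apply/eqP; lia.
have rE i : row_of D' i = if i == k then v else if i == k.-1 then u else row_of D i.
  by rewrite E row_of_set.
have jy : (j < size (row_of D k))%N by case/and3P: (exch_viol X).
have [_ [u' [v' [_ _ [_ _] h' _]]]] := exch_rel X.
exists (row_of D k.-1), (row_of D k); split.
- by rewrite rE eqxx sv.
- by rewrite rE kk eqxx su; lia.
- by split; exact: exch_srows0 X _.
- by rewrite !rE eqxx kk eqxx h.
- have kD' : (0 < k < size D')%N by rewrite (exch_size X).
  rewrite set_rowsE // {1}(rows_splitE kD) E set_rowsE //.
  have tz : size (take k.-1 D) = k.-1 by rewrite size_takel //; lia.
  rewrite take_size_cat // drop_cat tz ifF; last by lia.
  by rewrite (_ : k.+1 - k.-1 = 2)%N /= ?drop0 //; lia.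
Qed.

Lemma rowprod_exchange : Pw (reading_word D') = Pw (reading_word D).
Proof.
have kD := violation_size (exch_viol X); have kD' := kD; rewrite -(exch_size X) in kD'.
have [_ [u [v [_ _ _ _ E]]]] := exch_rel X.
have tE : take k.-1 D' = take k.-1 D.
  by rewrite E set_rowsE // take_size_cat // size_takel //; lia.
have dE : drop k.+1 D' = drop k.+1 D.
  have tz : size (take k.-1 D) = k.-1 by rewrite size_takel //; lia.
  rewrite E set_rowsE // drop_cat tz ifF; last by lia.
  by rewrite (_ : k.+1 - k.-1 = 2)%N /= ?drop0 //; lia.
rewrite (rows_splitE kD) (rows_splitE kD') tE dE.
apply: P_plact; rewrite -![_ :: _ :: drop _ _]/([:: _; _] ++ drop _ _) !reading_cat -!catA.
apply: plact_catl; rewrite !catA; apply: plact_catr.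
by rewrite /reading_word /= !cats0; exact: exch_word X.
Qed.

Lemma shape_exchange : shape D' =
  take k.-1 (shape D) ++ (nth 0%N (shape D) k).-1 :: (nth 0%N (shape D) k.-1).+1 :: drop k.+1 (shape D).
Proof.
have kD := violation_size (exch_viol X).
have [_ [u [v [su sv _ _ E]]]] := exch_rel X.
rewrite E set_rowsE // /shape map_cat /= map_take map_drop su sv.
by rewrite /row_of !(nth_map [::] 0%N) //; lia.
Qed.

End Exchanged.

(** * Fomin's involution *)

Lemma violation_le_trans i j i' j' i'' j'' :
  violation_le i j i' j' -> violation_le i' j' i'' j'' -> violation_le i j i'' j''.
Proof. by rewrite /violation_le; lia. Qed.

Lemma violation_le_total i j i' j' : violation_le i j i' j' \/ violation_le i' j' i j.
Proof. by rewrite /violation_le; lia. Qed.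

Lemma violation_le_anti i j i' j' :
  violation_le i j i' j' -> violation_le i' j' i j -> i = i' /\ j = j'.
Proof. by rewrite /violation_le; lia. Qed.

Lemma min_violation (p : nat -> Prop) D i j : violation D i j -> p i ->
  exists i0 j0, [/\ violation D i0 j0, p i0 &
    forall i' j', violation D i' j' -> p i' -> violation_le i0 j0 i' j'].
Proof.
move=> v pi; pose N := size D.
(* The order of violations as a natural number with two digits: the shift by [N] keeps the
   difference nonnegative, and the row index is below the base. *)
pose key (i j : nat) := ((j + N - i) * N.+1 + i)%N.
have keyP i1 j1 i2 j2 : (i1 < N)%N -> (i2 < N)%N -> (key i1 j1 <= key i2 j2)%N ->
    violation_le i1 j1 i2 j2.
  rewrite /key /violation_le; set A := (j1 + N - i1)%N; set B := (j2 + N - i2)%N => h1 h2 h.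
  suff : (A < B)%N \/ A = B /\ (i1 <= i2)%N by rewrite /A /B; lia.
  case: (ltngtP A B) => AB; first by left.
    have : (B.+1 * N.+1 <= A * N.+1)%N by rewrite leq_mul2r AB orbT.
    by rewrite mulSn; lia.
  by right; split=> //; rewrite AB in h; lia.
pose q n := exists i j, [/\ violation D i j, p i & key i j = n].
have ex : exists n, `[< q n >] by exists (key i j); apply/asboolP; exists i, j.
case: (ex_minnP ex) => n /asboolP[i0 [j0 [v0 p0 k0]]] nmin.
exists i0, j0; split=> // i' j' v' p'.
have [_ h1] := andP (violation_size v0); have [_ h2] := andP (violation_size v').
apply: keyP => //; rewrite k0; apply: nmin; apply/asboolP; by exists i', j'.
Qed.

Lemma exchange_at k j D D' : srows D -> violation D k j ->
  (forall j', (j' < j)%N -> ~~ violation D k j') -> exchange k D D' -> exchanged k j D D'.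
Proof.
by move=> sD vD f x; have [D2 h] := exchange_exists sD vD f; rewrite (exchange_uniq x (exch_rel h)).
Qed.

Lemma min_first (p : nat -> Prop) D i j : p i ->
  (forall i' j', violation D i' j' -> p i' -> violation_le i j i' j') ->
  forall j', (j' < j)%N -> ~~ violation D i j'.
Proof.
by move=> pi h j' lt; apply/negP => /h/(_ pi); rewrite /violation_le; lia.
Qed.

Lemma exchange_min (p : nat -> Prop) D i j D1 : srows D -> violation D i j -> p i ->
  (forall i' j', violation D i' j' -> p i' -> violation_le i j i' j') ->
  exchange i D D1 ->
  exchanged i j D D1 /\
  forall i' j', violation D1 i' j' -> p i' -> violation_le i j i' j'.
Proof.
move=> sD v pi h x; have X := exchange_at sD v (min_first pi h) x.
split=> // i' j' v' p'; have [le|//] := violation_le_total i' j' i j.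
by apply: h => //; rewrite -(exchange_status X).
Qed.

Definition xshape (k : nat) (sh : seq nat) : seq nat :=
  take k.-1 sh ++ (nth 0%N sh k).-1 :: (nth 0%N sh k.-1).+1 :: drop k.+1 sh.

Lemma perm_exchange k D D' : srows D -> exchange k D D' -> perm_eq (entries D') (entries D).
Proof.
move=> sD x; have [j X] := exchangedP sD x.
rewrite -(permPl (perm_reading D')) -(permPr (perm_reading D)).
by apply: (@perm_plact false); apply: plact_of_P; exact: rowprod_exchange X.
Qed.

Lemma diagrams_finite n (w : seq int) : exists s : seq diagram,
  forall D, size D = n -> perm_eq (entries D) w -> D \in s.
Proof.
pose N := (size w).+1.
exists [seq reshape (map val (t : n.-tuple 'I_N)) f | t <- enum {: n.-tuple 'I_N}, f <- permutations w].
move=> D sD pD; apply/allpairsP.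
have szD : (sumn (shape D) < N)%N by rewrite -size_flatten ltnS (perm_size pD).
have lt : all (fun m => (m < N)%N) (shape D).
  move: szD; clear; elim: D => //= u D IH h; rewrite (leq_ltn_trans (leq_addr _ _) h) /=.
  by apply: IH; apply: leq_ltn_trans h; exact: leq_addl.
have szt : size (map inord (shape D) : seq 'I_N) == n by rewrite !size_map sD.
exists (Tuple szt, entries D); rewrite mem_enum mem_permutations pD; split=> //=.
rewrite -map_comp (_ : map _ _ = shape D) ?flattenK //.
rewrite -[RHS]map_id; apply/eq_in_map => m mD /=; rewrite inordK //; exact: (allP lt).
Qed.

Section Fomin.
Variable a : nat.

(* Throughout the algorithm the leftmost violation of row [a], in column [c], is
   the minimal one in the whole diagram, and it never moves. *)
Definition Inv (c : nat) (D : diagram) :=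
  [/\ srows D, violation D a c & forall i j, violation D i j -> violation_le a c i j].

Definition fomin_round (D D2 : diagram) := exists i j D1,
  [/\ min_violation_off a D i j, exchange i D D1 & exchange a D1 D2].

Lemma off_step c D i j D1 : Inv c D -> min_violation_off a D i j -> exchange i D D1 ->
  [/\ exchanged i j D D1, Inv c D1 & min_violation_off a D1 i j].
Proof.
move=> [sD vD mD] [vi ia mi] x.
have [X h] := @exchange_min (fun i => i <> a) D i j D1 sD vi ia mi x.
split=> //; last by split=> //; exact: exchange_violation X.
split; first exact: exch_srows X.
  by rewrite (exchange_status X) //; exact: mD.
move=> i' j' v'; have [le|le] := violation_le_total i' j' i j.
  by apply: mD; rewrite -(exchange_status X).
exact: violation_le_trans (mD _ _ vi) le.
Qed.

Lemma a_step c D D1 : Inv c D -> exchange a D D1 -> exchanged a c D D1 /\ Inv c D1.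
Proof.
move=> [sD vD mD] x.
have [|X h] := @exchange_min (fun _ => True) D a c D1 sD vD I _ x; first by move=> *; exact: mD.
split=> //; split; first exact: exch_srows X.
  exact: exchange_violation X.
by move=> i j v; exact: h.
Qed.

Lemma round_inv c D D2 : Inv c D -> fomin_round D D2 -> Inv c D2.
Proof.
move=> ID [i [j [D1 [m x y]]]]; have [_ I1 _] := off_step ID m x.
by have [] := a_step I1 y.
Qed.

(** The exchange at row [a] is its own inverse, which determines the middle diagram. There the
    violation just used is still the minimal one outside row [a], so the row of the first exchange
    is determined too. *)
Lemma round_back c c' D D' D2 : Inv c D -> Inv c' D' ->
  fomin_round D D2 -> fomin_round D' D2 -> D = D'.
Proof.
move=> ID ID' [i [j [D1 [m x y]]]] [i' [j' [D1' [m' x' y']]]].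
have [X I1 m1] := off_step ID m x; have [X' I1' m1'] := off_step ID' m' x'.
have [Y _] := a_step I1 y; have [Y' _] := a_step I1' y'.
have E : D1 = D1' := exchange_uniq (exchange_sym Y) (exchange_sym Y').
move: m1' X'; rewrite -E => m1' X'.
have [vi ia mi] := m1; have [vi' ia' mi'] := m1'.
have [ii _] := violation_le_anti (mi _ _ vi' ia') (mi' _ _ vi ia).
by move: X'; rewrite -ii => X'; exact: exchange_uniq (exchange_sym X) (exchange_sym X').
Qed.

Lemma round_exists c D i j : Inv c D -> violation D i j -> i <> a -> exists D2, fomin_round D D2.
Proof.
move=> ID v ia; have [i0 [j0 [v0 p0 m0]]] := @min_violation (fun i => i <> a) D i j v ia.
have sD : srows D by case: ID.
have m : min_violation_off a D i0 j0 by [].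
have [D1 X] := exchange_exists sD v0 (min_first p0 m0).
have [_ I1 _] := off_step ID m (exch_rel X).
have [s1 va ma] := I1.
have [D2 Y] := exchange_exists s1 va (@min_first (fun _ => True) _ _ _ I (fun i j v _ => ma i j v)).
by exists D2, i0, j0, D1; split=> //; [exact: exch_rel X | exact: exch_rel Y].
Qed.

Inductive rounds (D : diagram) : diagram -> Prop :=
| rounds0 : rounds D D
| roundsS E F : rounds D E -> fomin_round E F -> rounds D F.

Lemma rounds_trans D E F : rounds D E -> rounds E F -> rounds D F.
Proof. by move=> h; elim=> // G H _ IH; exact: roundsS. Qed.

Lemma rounds_inv c D E : Inv c D -> rounds D E -> Inv c E.
Proof. by move=> ID; elim=> // F G _ IH /(round_inv IH). Qed.

Lemma fomin_loopP D E : fomin_loop a D E <->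
  rounds D E /\ (forall i j, violation E i j -> i = a).
Proof.
split.
  elim=> {D E} [D h|D D1 D2 D' i j m x y _ [IH h]]; first by split=> //; exact: rounds0.
  split=> //; apply: rounds_trans IH; apply: (roundsS (rounds0 _)).
  by exists i, j, D1.
case=> h hE; suff: forall E', fomin_loop a E E' -> fomin_loop a D E'.
  by apply; exact: fomin_stop.
elim: h {hE} => // E1 F _ IH [i [j [D1 [m x y]]]] E' h; apply: IH.
exact: fomin_step m x y h.
Qed.

(** Rounds being injective, two runs with a common end agree when read backwards until the shorter
    one is used up. *)
Lemma rounds_backward c c' D D' E : Inv c D -> Inv c' D' -> rounds D E -> rounds D' E ->
  [\/ D = D', exists2 G, Inv c G & fomin_round G D' | exists2 G, Inv c' G & fomin_round G D].
Proof.
move=> ID ID' h; elim: h D' ID' => [|E1 F h1 IH R1] D' ID' h'.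
  case: h' ID => [|G F h' RG] ID; first by constructor 1.
  by constructor 3; exists G => //; exact: rounds_inv ID' h'.
have I1 := rounds_inv ID h1.
case: h' R1 => [|G F' h' RG] R1; first by constructor 2; exists E1.
have IG := rounds_inv ID' h'.
by apply: IH => //; rewrite (round_back I1 IG R1 RG).
Qed.

Lemma round_size_perm c D D2 : Inv c D -> fomin_round D D2 ->
  size D2 = size D /\ perm_eq (entries D2) (entries D).
Proof.
move=> ID [i [j [D1 [m x y]]]]; have [X I1 _] := off_step ID m x.
have [Y _] := a_step I1 y; rewrite (exch_size Y) (exch_size X); split=> //.
have [sD _ _] := ID; have [sD1 _ _] := I1.
by rewrite (permPl (perm_exchange sD1 y)) (permPl (perm_exchange sD x)).
Qed.

(* The rounds are injective on a finite set of diagrams, so that they can only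
   go on for ever by returning to their starting point. *)
Lemma rounds_terminate c D : Inv c D ->
  (forall G, Inv c G -> ~ fomin_round G D) ->
  exists2 E, rounds D E & forall i j, violation E i j -> i = a.
Proof.
move=> ID noprev; apply: contrapT => nostop.
have go E : rounds D E -> exists F, fomin_round E F.
  move=> h; apply: contrapT => nF; apply: nostop; exists E => // i j v.
  apply: contrapT => ia; apply: nF; exact: round_exists (rounds_inv ID h) v ia.
pose next E := if pselect (exists F, fomin_round E F) is left h then projT1 (cid h) else E.
have nextP E : rounds D E -> fomin_round E (next E).
  by move=> /go h; rewrite /next; case: pselect => // h'; case: cid.
pose tr n := iter n next D.
have trR n : rounds D (tr n).
  by elim: n => [|n IH]; [exact: rounds0 | exact: roundsS IH (nextP _ IH)].
have trI n : Inv c (tr n) := rounds_inv ID (trR n).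
have tr_inj : injective tr.
  have wlg m n : (m < n)%N -> tr m <> tr n.
    elim: m n => [|m IH] [|n] // lt E.
      by apply: (noprev _ (trI n)); rewrite -[D]/(tr 0) E; exact: nextP (trR n).
    apply: (IH n lt); apply: (round_back (trI m) (trI n) (nextP _ (trR m))).
    by rewrite -[next (tr m)]/(tr m.+1) E; exact: nextP (trR n).
  move=> m n E; case: (ltngtP m n) => // lt; first by have := wlg _ _ lt.
  by have := wlg _ _ lt; rewrite E.
have [s sP] := diagrams_finite (size D) (entries D).
have trP n : size (tr n) = size D /\ perm_eq (entries (tr n)) (entries D).
  elim: n => [|n [h1 h2]]; first by split.
  have [h3 h4] := round_size_perm (trI n) (nextP _ (trR n)).
  by split; [rewrite [LHS]h3 | rewrite (permPl h4)].
have u : uniq (map tr (iota 0 (size s).+1)) by rewrite map_inj_uniq ?iota_uniq.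
have := @uniq_leq_size _ _ s u; rewrite size_map size_iota ltnn => H.
suff : false by []; apply: H => // E /mapP[n _ ->].
by have [h1 h2] := trP n; exact: sP.
Qed.

Definition fomin_diag (D0 D2 : diagram) :=
  exists2 D1, exchange a D0 D1 & fomin_loop a D1 D2.

Definition only_row (D : diagram) := (exists j, violation D a j) /\
  forall i j, violation D i j -> i = a.

Lemma only_row_Inv D : srows D -> only_row D -> exists c, Inv c D.
Proof.
move=> sD [[j v] h]; have [m vm fm] := first_violation v; exists m; split=> // i j' v'.
have ia := h _ _ v'; rewrite ia in v' *.
have : (m <= j')%N by rewrite leqNgt; apply/negP => /fm; rewrite v'.
by rewrite /violation_le; lia.
Qed.

(** Undoing the exchange at row [a] in [D1] gives [D0], where all violations lie in row [a]; undoing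
    the end of a round gives a diagram with a violation elsewhere. *)
Lemma fomin_diag_start D0 D1 c : Inv c D0 -> only_row D0 -> exchange a D0 D1 ->
  Inv c D1 /\ forall c' G, Inv c' G -> ~ fomin_round G D1.
Proof.
move=> I0 [_ h0] x; have [X I1] := a_step I0 x; split=> // c' G IG [i [j [E [m y z]]]].
have [_ IE [v ia _]] := off_step IG m y; have [Z _] := a_step IE z.
by apply: ia; apply: (h0 i j); rewrite (exchange_uniq (exchange_sym X) (exchange_sym Z)).
Qed.

Lemma fomin_diag_exists D0 : srows D0 -> only_row D0 -> exists D2, fomin_diag D0 D2.
Proof.
move=> s0 h0; have [c I0] := only_row_Inv s0 h0; have [_ v0 m0] := I0.
have [D1 X] := exchange_exists s0 v0 (@min_first (fun _ => True) _ _ _ I (fun i j v _ => m0 i j v)).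
have x := exch_rel X.
have [I1 np] := fomin_diag_start I0 h0 x.
have [E h1 h2] := rounds_terminate I1 (np c).
by exists E, D1 => //; apply/fomin_loopP.
Qed.

(** Were the runs of different lengths, one of the starting diagrams would be the result of a round,
    which [fomin_diag_start] excludes. *)
Lemma fomin_diag_inj D0 D0' D2 : srows D0 -> only_row D0 -> srows D0' -> only_row D0' ->
  fomin_diag D0 D2 -> fomin_diag D0' D2 -> D0 = D0'.
Proof.
move=> s0 h0 s0' h0' [D1 x /fomin_loopP[r _]] [D1' x' /fomin_loopP[r' _]].
have [c I0] := only_row_Inv s0 h0; have [c' I0'] := only_row_Inv s0' h0'.
have [I1 np] := fomin_diag_start I0 h0 x; have [I1' np'] := fomin_diag_start I0' h0' x'.
have [E|[G IG /(np' _ _ IG)]|[G IG /(np _ _ IG)]] // := rounds_backward I1 I1' r r'.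
have [X _] := a_step I0 x; have [X' _] := a_step I0' x'.
by rewrite -E in X'; exact: exchange_uniq (exchange_sym X) (exchange_sym X').
Qed.

(* An invariant of all the exchanges of the algorithm; the boolean is the parity
   of their number. *)
Lemma fomin_diag_rel (R : bool -> diagram -> diagram -> Prop) D0 D2 :
  (forall D, R false D D) ->
  (forall b b' D E F, R b D E -> R b' E F -> R (b (+) b') D F) ->
  (forall c k j D E, violation_le a c k j -> exchanged k j D E -> R true D E) ->
  srows D0 -> only_row D0 -> fomin_diag D0 D2 ->
  R true D0 D2 /\ srows D2 /\ only_row D2.
Proof.
move=> R0 RT RX s0 h0 [D1 x /fomin_loopP[r h]].
have [c I0] := only_row_Inv s0 h0; have [X I1] := a_step I0 x.
have [s2 v2 _] := rounds_inv I1 r; split; last first.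
  by split=> //; split=> //; exists c.
apply: (RT true false _ D1); first by apply: RX X; right; split.
elim: r {h s2 v2} => // E F r Rr [i [j [E1 [m y z]]]].
apply: (RT false false _ E) => //.
have IE := rounds_inv I1 r; have [Y IE1 _] := off_step IE m y; have [Z _] := a_step IE1 z.
have [_ _ mE] := IE.
apply: (RT true true _ E1); first by apply: (RX _ _ _ _ _ _ Y); apply: mE; exact: exch_viol Y.
by apply: RX Z; right; split.
Qed.

End Fomin.

Lemma dom_violation D i : dom false (row_of D i) (row_of D i.+1) <->
  (forall j, ~~ violation D i.+1 j).
Proof.
split=> [h j|h].
  rewrite /violation /=; apply/negP => /andP[lt /negP]; apply.
  have /domP[h1 h2] := h; rewrite (leq_trans lt h1) ltNge.
  exact: h2 lt.
apply/domP; have hj j : (j < size (row_of D i.+1))%N ->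
    (j < size (row_of D i))%N /\ nth 0 (row_of D i) j < nth 0 (row_of D i.+1) j.
  by move=> lt; have := h j; rewrite /violation lt /= negbK => /andP[].
split=> [|k /hj[_]]; last by rewrite /lei ltNge.
case: (posnP (size (row_of D i.+1))) => [->//|sp].
have [|h1 _] := hj (size (row_of D i.+1)).-1; last by lia.
by rewrite prednK.
Qed.

Lemma dom_cat s u u' v v' : dom s u v -> dom s u' v' -> (v' != [::] -> size v = size u) ->
  dom s (u ++ u') (v ++ v').
Proof.
elim: u v => [|x u IH] [|y v] //= h1 h2 h3.
  by case: (v') h3 => // y w /(_ isT).
case/andP: h1 => -> h1 /=; apply: IH => // h; by case: (h3 h).
Qed.

Lemma row_of_stack a P Q i : row_of (stack a P Q) i =
  if (i < a)%N then row_of P i else row_of Q (i - a).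
Proof.
by rewrite /row_of /stack nth_cat size_mkseq; case: ltnP => // h; rewrite nth_mkseq.
Qed.

Lemma size_stack a P Q : size (stack a P Q) = (a + size Q)%N.
Proof. by rewrite size_cat size_mkseq. Qed.

Lemma left_cut0 V : left_cut 0 V = [::].
Proof. by elim: V => // u V; rewrite /left_cut /drop_empty /= take0. Qed.

(** The rows with more than [b] boxes come first. The others are untouched by the cut, and later by
    Fomin's map, so they form a fixed tail of the shape. *)
Lemma shape_cut b X : tab X -> shape X =
  [seq (b + n)%N | n <- shape (right_cut b X)] ++
  drop (size (right_cut b X)) (shape (left_cut b X)).
Proof.
elim: X => // u V IH tX; have [nX _ dX] := tablP _ _ tX; have /and4P[nu _ _ tV] := tX.
rewrite right_cut_cons //; case: eqP => [d0|/eqP d0].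
  rewrite [_ ++ _]/= drop0; congr (map size _); apply: row_of_ext; rewrite ?nil_drop_empty // => i.
  rewrite row_of_left_cut // take_oversize //; apply: leq_trans (dom_rows_size dX (leq0n i)) _.
  by rewrite row_of_cons -subn_eq0 -size_drop d0.
have bu : (b < size u)%N by move: d0; rewrite -size_eq0 size_drop subn_eq0 -ltnNge.
rewrite /= [in LHS]IH // size_drop subnKC ?(ltnW bu) //; congr (_ :: (_ ++ _)).
rewrite {2}/left_cut /drop_empty /=; case: (posnP b) => [->|b0].
  by rewrite take0 /= -/(drop_empty _) -/(left_cut 0 V) left_cut0.
by case: (take b u) (size_take_min b u) => //= /esym; lia.
Qed.

(** * Fomin's map on the pairs around a rectangle *)

Section Around.
Variables (a b : nat) (T : diagram).
Hypothesis tT : tab T.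
Hypothesis shT : shape T = [seq m <- nseq a b | m != 0%N].

Definition bad (X Y : diagram) :=
  [/\ tab X, tab Y, (size Y <= a)%N, entries_above T X /\ entries_above T Y
    & ~ fits_around a X T Y].

Lemma row_of_around X Y i : row_of (around a X T Y) i =
  if (i < a)%N then row_of T i ++ row_of Y i else row_of X (i - a).
Proof.
rewrite /row_of /around nth_cat size_mkseq; case: ltnP => // h.
by rewrite nth_mkseq.
Qed.

Lemma stack_srows X Y : tab X -> tab Y -> srows (stack a Y (right_cut b X)).
Proof.
move=> tX tY i; rewrite row_of_stack; case: ifP => _; first by case/tablP: tY.
by case/tablP: (tab_right_cut b tX).
Qed.

Lemma stack_dom X Y i : tab X -> tab Y -> i.+1 <> a ->
  dom false (row_of (stack a Y (right_cut b X)) i) (row_of (stack a Y (right_cut b X)) i.+1).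
Proof.
move=> tX tY ia; have [_ _ dY] := tablP _ _ tY.
have [_ _ dX] := tablP _ _ (tab_right_cut b tX).
rewrite !row_of_stack; case: (ltnP i.+1 a) => h.
  by rewrite ltnW //; exact: dY.
have ai : (a <= i)%N by lia.
by rewrite ltnNge ai subSn //; exact: dX.
Qed.

(** Letters of [T] are smaller than those of [X], so nothing can go wrong in the first [b] columns.
    Beyond them the diagram is the stack of [Y] on the right part of [X], and only the row where the
    two tableaux meet can contain a violation. *)
Lemma fits_stack X Y : tab X -> tab Y -> entries_above T X -> entries_above T Y ->
  fits_around a X T Y <-> (forall j, ~~ violation (stack a Y (right_cut b X)) a j).
Proof.
move=> tX tY aX aY; have [_ _ dX] := tablP _ _ tX; have [_ _ dY] := tablP _ _ tY.
have [_ _ dT] := tablP _ _ tT; have rT := rect_row shT.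
rewrite /fits_around no_violation_dom.
case: (posnP a) => [a0|a0].
  split=> _; first by move=> j; rewrite a0.
  by move=> i; rewrite !row_of_around a0 !subn0; exact: dX.
have E : a = a.-1.+1 by rewrite prednK.
have szT : size (row_of T a.-1) = b by rewrite rT prednK ?leqnn.
have r1 : row_of (stack a Y (right_cut b X)) a.-1 = row_of Y a.-1.
  by rewrite row_of_stack prednK ?leqnn.
have r2 : row_of (stack a Y (right_cut b X)) a.-1.+1 = drop b (row_of X 0).
  by rewrite row_of_stack prednK // ltnn subnn row_of_right_cut.
have r3 : row_of (around a X T Y) a.-1 = row_of T a.-1 ++ row_of Y a.-1.
  by rewrite row_of_around prednK ?leqnn.
have r4 : row_of (around a X T Y) a.-1.+1 = row_of X 0.
  by rewrite row_of_around prednK // ltnn subnn.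
split=> h.
  move=> j; rewrite -[a in violation _ a j](prednK a0); move: j.
  apply/dom_violation; rewrite r1 r2.
  have := dom_drop b (h a.-1); rewrite r3 r4 drop_cat szT ltnn subnn drop0.
  by [].
move=> i; case: (ltngtP i.+1 a) => ia.
- by rewrite !row_of_around ia (ltnW ia); apply: dom_cat; rewrite ?dT ?dY // !rT ia (ltnW ia).
- by rewrite !row_of_around ltnNge -ltnS ia /= ltnNge (ltnW ia) /= subSn.
have -> : i = a.-1 by lia.
rewrite r3 r4 -(cat_take_drop b (row_of X 0)); apply: dom_cat.
- apply/domP; rewrite szT size_take_min geq_minl; split=> // k kb.
  rewrite /lei -ltNge nth_take; last by lia.
  apply: aX; apply/entriesP; [exists 0%N | exists a.-1]; apply: mem_nth.
    exact: leq_trans kb (geq_minr _ _).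
  by rewrite szT; exact: leq_trans kb (geq_minl _ _).
- by rewrite -r1 -r2; apply/dom_violation; rewrite -E.
- move=> h0; rewrite szT size_takel //; move: h0; rewrite -size_eq0 size_drop subn_eq0 -ltnNge.
  exact: ltnW.
Qed.

Lemma bad_only_row X Y : bad X Y -> only_row a (stack a Y (right_cut b X)).
Proof.
move=> [tX tY sY [aX aY] nf]; split.
  apply: contrapT => nv; apply: nf; apply/fits_stack => // j.
  by apply/negP => v; apply: nv; exists j.
move=> [|i] j v; first by case/and3P: v.
apply: contrapT => ia; have /dom_violation/(_ j) := stack_dom tX tY ia.
by rewrite v.
Qed.

Definition fomin_image (X Y X' Y' : diagram) := exists D2,
  [/\ fomin_diag a (stack a Y (right_cut b X)) D2,
      X' = tmul (left_cut b X) (drop a D2) & Y' = drop_empty (take a D2)].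

Lemma fomin_image_exists X Y : bad X Y -> exists X' Y', fomin_image X Y X' Y'.
Proof.
move=> bXY; have [tX tY _ _ _] := bXY.
have [D2 h] := fomin_diag_exists (stack_srows tX tY) (bad_only_row bXY).
by exists (tmul (left_cut b X) (drop a D2)), (drop_empty (take a D2)), D2.
Qed.

Definition antisym (V : zmodType) (f : seq nat -> V) := forall k sh,
  (0 < k < size sh)%N -> (0 < nth 0%N sh k)%N -> f (xshape k sh) = - f sh.

(** The algorithm sees only the stack, so its output must be fitted back to the first [b] columns of
    [X]. The invariant [Rsz] does this: the number of rows and the first letter of each row from
    index [a] on never change. So no lower row becomes empty, and the letters of the left part
    remain at most those to their right. *)
Lemma fomin_image_props X Y X' Y' : bad X Y -> fomin_image X Y X' Y' ->
  exists2 D2, fomin_diag a (stack a Y (right_cut b X)) D2 &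
  [/\ D2 = stack a Y' (right_cut b X'), left_cut b X' = left_cut b X,
      [/\ fomin_around a b X Y X' Y', tab X', tab Y' & (size Y' <= a)%N],
      only_row a D2 /\ size (right_cut b X') = size (right_cut b X) &
      forall (V : zmodType) (f : seq nat -> V), antisym f -> f (shape D2) =
        - f (shape (stack a Y (right_cut b X)))].
Proof.
move=> bXY [D2 [hD XE YE]]; exists D2 => //.
have [tX tY sY [aX aY] _] := bXY; have tX0 := tab_left_cut b tX; have tXr := tab_right_cut b tX.
set D0 := stack _ _ _ in hD *.
have s0 : srows D0 := stack_srows tX tY.
have h0 : only_row a D0 := bad_only_row bXY.
pose Rsz (p : bool) (D D' : diagram) := size D' = size D /\
  forall i, (a <= i)%N -> take 1 (row_of D' i) = take 1 (row_of D i).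
have [||c k j D D' le X1|[szD t1] [s2 h2]] := @fomin_diag_rel a Rsz D0 D2 _ _ _ s0 h0 hD.
- by split.
- by move=> p p' D D' D'' [g1 g2] [g3 g4]; split; rewrite ?g3 // => i ai; rewrite g4 // g2.
- split; first exact: exch_size X1.
  move=> i ai; have tt n (u : seq int) : take 1 u = take 1 (take n.+1 u).
    by case: u => //= y u; rewrite !take0.
  have [->|ik] := eqVneq i k; first by rewrite (tt j) (exch_down X1) -tt.
  have [ik1|ik1] := eqVneq i k.-1; last by rewrite (exch_row X1).
  (* For [j = 0] row [k.-1] may lose its first letter. But then [k <= a], as no violation precedes
     the one in row [a], and row [k.-1] is not a lower row. *)
  case: j le X1 => [|j] le X1; last by rewrite ik1 (tt j) (exch_up X1) -tt.
  have /andP[k0 _] := violation_size (exch_viol X1).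
  by move: le; rewrite /violation_le; lia.
have domD2 i : i.+1 <> a -> dom false (row_of D2 i) (row_of D2 i.+1).
  by move=> ia; apply/dom_violation => j; apply/negP => v; apply: ia; case: h2 => _ /(_ _ _ v).
have rt i : row_of (take a D2) i = if (i < a)%N then row_of D2 i else [::].
  case: ltnP => h; first by rewrite /row_of nth_take.
  by rewrite row_of_default // (leq_trans _ h) // size_take_min geq_minl.
have rd i : row_of (drop a D2) i = row_of D2 (a + i) by rewrite /row_of nth_drop.
have dt : dom_rows false (take a D2).
  move=> i; rewrite !rt; case: (ltnP i.+1 a) => h; last by rewrite dom0.
  by rewrite ltnW //; apply: domD2; lia.
have dd : dom_rows false (drop a D2) by move=> i; rewrite !rd addnS; apply: domD2; lia.
have tY' : tab Y'.
  by rewrite YE; apply: tabl_drop_empty dt => i; rewrite rt; case: ifP.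
have rY' i : row_of Y' i = if (i < a)%N then row_of D2 i else [::].
  by rewrite YE (row_of_drop_empty dt) rt.
have szQ : size (drop a D2) = size (right_cut b X).
  by rewrite size_drop szD size_stack addKn.
have t1Q i : take 1 (row_of (drop a D2) i) = take 1 (row_of (right_cut b X) i).
  by rewrite rd t1 ?leq_addr // row_of_stack ltnNge leq_addr /= addKn.
have nQ : [::] \notin drop a D2.
  apply/negP => /(nthP [::])[i]; rewrite szQ -/(row_of _ _) => hi e.
  have [nr _ _] := tablP _ _ tXr; have := row_of_neq0 nr hi.
  by have := t1Q i; rewrite e; case: (row_of (right_cut b X) i).
have tQ : tab (drop a D2) by apply/tablP; split=> // i; rewrite rd.
have memQ i x : x \in row_of (drop a D2) i ->
    exists2 y, y \in row_of (right_cut b X) i & y <= x.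
  move=> xi; have := t1Q i; have [_ sQ _] := tablP _ _ tQ; move: xi (sQ i).
  case: (row_of (drop a D2) i) => // z u; case: (row_of (right_cut b X) i) => //= y v.
  move=> xz p; rewrite !take0 => -[zy]; exists y; first by rewrite inE eqxx.
  rewrite -zy; move: xz; rewrite inE => /predU1P[->//|xu].
  by move: p; rewrite (path_sortedE (@lei_trans false)) => /andP[/allP h _]; exact: h.
have JE : X' = join (left_cut b X) (drop a D2).
  rewrite XE join_mul //; first exact: tabl_sorted.
  move=> i k ik x y xi /memQ[z zk zy]; apply: le_trans zy.
  exact: (jcond_cut tX ik xi zk).
have tX' : tab X' by rewrite XE; exact: tab_tmul.
have [|||cl cr] := @cut_join b (left_cut b X) (drop a D2) tX0 tQ.
- by rewrite -JE.
- by move=> i; exact: row_of_leq_left.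
- move=> i hi; apply: (cut_flush tX); apply: contra hi => /eqP e.
  by have := t1Q i; rewrite e; case: (row_of _ _).
rewrite -JE in cl cr.
have D2E : D2 = stack a Y' (right_cut b X').
  have szs : size D2 = size (stack a Y' (right_cut b X')).
    by rewrite size_stack cr szQ szD size_stack.
  apply: (eq_from_nth (x0 := [::])) => // i _; rewrite -!/(row_of _ _) row_of_stack rY'.
  by case: ltnP => // h; rewrite cr rd subnKC.
have sY' : (size Y' <= a)%N.
  rewrite YE (leq_trans (size_subseq (filter_subseq _ _))) // size_take_min geq_minl //.
split=> //.
- split=> //; exists (drop a D2) => //.
  case: hD => D1 x l; exists D1, D2; split=> //.
  by rewrite /drop_empty -[LHS]filter_predT; apply: eq_in_filter => u uD; apply/esym; apply: contra nQ => /eqP <-.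
- by split=> //; rewrite cr szQ.
move=> V f af.
pose Rs (p : bool) (D D' : diagram) := f (shape D') = if p then - f (shape D) else f (shape D).
have [||c k j D D' le X1|] := @fomin_diag_rel a Rs D0 D2 _ _ _ s0 h0 hD; rewrite /Rs //.
- by move=> [] [] D D' D'' /= -> // ->; rewrite ?opprK.
- rewrite (shape_exchange X1) -/(xshape _ _) af // ?size_map; last first.
    have /andP[_ kD] := violation_size (exch_viol X1).
    rewrite /shape (nth_map [::]) //; case/and3P: (exch_viol X1) => _ h _.
    exact: leq_ltn_trans h.
  exact: violation_size (exch_viol X1).
Qed.

Lemma fomin_image_inj X1 Y1 X2 Y2 X' Y' : bad X1 Y1 -> bad X2 Y2 ->
  fomin_image X1 Y1 X' Y' -> fomin_image X2 Y2 X' Y' -> X1 = X2 /\ Y1 = Y2.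
Proof.
move=> b1 b2 i1 i2.
have [D1 h1 [e1 l1 _ _ _]] := fomin_image_props b1 i1.
have [D2 h2 [e2 l2 _ _ _]] := fomin_image_props b2 i2.
have [tX1 tY1 s1 _ _] := b1; have [tX2 tY2 s2 _ _] := b2.
rewrite e1 -e2 in h1; rewrite e2 in h1 h2 *.
have E := fomin_diag_inj (stack_srows tX1 tY1) (bad_only_row b1)
  (stack_srows tX2 tY2) (bad_only_row b2) h1 h2.
have rE i : row_of (right_cut b X1) i = row_of (right_cut b X2) i.
  have := row_of_stack a Y1 (right_cut b X1) (a + i); rewrite E row_of_stack.
  by rewrite !ltnNge !leq_addr /= !addKn.
have rY i : row_of Y1 i = row_of Y2 i.
  case: (ltnP i a) => h; last by rewrite !row_of_default ?(leq_trans _ h).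
  by have := row_of_stack a Y1 (right_cut b X1) i; rewrite E row_of_stack h.
have [n1 _ _] := tablP _ _ tY1; have [n2 _ _] := tablP _ _ tY2; split; last exact: row_of_ext.
rewrite -(join_cut b tX1) -(join_cut b tX2) -l1 -l2; congr join.
by apply: row_of_ext => //; exact: nil_drop_empty.
Qed.

Lemma fomin_image_not_fits X Y X' Y' : bad X Y -> fomin_image X Y X' Y' ->
  entries_above T X' -> entries_above T Y' -> ~ fits_around a X' T Y'.
Proof.
move=> bXY im aX' aY'; have [D2 _ [e2 _ [_ tX' tY' _] [[[j v] _] _] _]] := fomin_image_props bXY im.
by move/(fits_stack tX' tY' aX' aY')/(_ j); rewrite -e2 v.
Qed.

Lemma fomin_image_around X Y X' Y' : bad X Y -> fomin_image X Y X' Y' ->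
  [/\ fomin_around a b X Y X' Y', tab X', tab Y' & (size Y' <= a)%N].
Proof. by move=> bXY im; have [D2 _ [_ _ h _ _]] := fomin_image_props bXY im. Qed.

Lemma shape_around X Y : tab X -> tab Y ->
  shape (around a X T Y) =
  [seq (b + n)%N | n <- shape (stack a Y (right_cut b X))] ++
    drop (size (right_cut b X)) (shape (left_cut b X)).
Proof.
move=> tX tY; rewrite /around /stack /shape !map_cat -/(shape X) (shape_cut b tX) catA.
congr ((_ ++ _) ++ _); rewrite -map_comp -map_comp -[RHS]map_comp.
apply/eq_in_map => k; rewrite mem_iota /= => ka.
by rewrite size_cat (rect_row shT) ka.
Qed.

(** Positivity of the entry at [k] makes its predecessor exact, so that it commutes with the shift
    by [b]. *)
Lemma xshape_shift k sh tl : (0 < k < size sh)%N -> (0 < nth 0%N sh k)%N ->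
  [seq (b + n)%N | n <- xshape k sh] ++ tl = xshape k ([seq (b + n)%N | n <- sh] ++ tl).
Proof.
move=> /andP[k0 ks] h; rewrite /xshape map_cat /= -catA; congr (_ ++ _).
  by rewrite map_take takel_cat // size_map; lia.
have k1 : (k.-1 < size sh)%N by lia.
rewrite !nth_cat size_map ks k1 !(nth_map 0%N) // map_drop drop_cat_le ?size_map //=.
by congr [:: _, _ & _]; lia.
Qed.

Lemma fomin_image_sign (V : zmodType) (f : seq nat -> V) X Y X' Y' :
  antisym f -> bad X Y -> fomin_image X Y X' Y' ->
  f (shape (around a X' T Y')) = - f (shape (around a X T Y)).
Proof.
move=> af bXY im; have [D2 _ [e2 lE [_ tX' tY' _] [_ sE] sign]] := fomin_image_props bXY im.
have [tX tY _ _ _] := bXY.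
rewrite !shape_around // -e2 lE sE.
set tl := drop _ _; pose f' sh := f ([seq (b + n)%N | n <- sh] ++ tl).
apply: (sign _ f') => k sh ks h; rewrite /f' xshape_shift // af //.
  by rewrite size_cat size_map; move: ks; clear; lia.
by rewrite nth_cat size_map; case/andP: ks => _ ks; rewrite ks (nth_map 0%N) //; lia.
Qed.

End Around.

(** * Paths and factor sequences *)

Lemma cat_align (A : Type) (a b c d : seq A) : a ++ b = c ++ d ->
  (exists2 e, c = a ++ e & b = e ++ d) \/ (exists2 e, a = c ++ e & d = e ++ b).
Proof.
elim: a c => [|x a IH] [|y c] /=; [by left; exists [::] | by move=> ->; left; exists (y :: c) |
  by move=> <-; right; exists (x :: a) | ].
by case=> -> /IH[[e -> ->]|[e -> ->]]; [left | right]; exists e.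
Qed.

Section Walks.
Variable n : nat.
Implicit Types (g : seq step) (v : nat * nat).

Definition okv v := (v.1 <= v.2 <= n)%N.

Definition walk v g := all okv (scanl move v g) && (foldl move v g == (n, n)).

Lemma walk_cat v g1 g2 :
  walk v (g1 ++ g2) = all okv (scanl move v g1) && walk (foldl move v g1) g2.
Proof. by rewrite /walk scanl_cat all_cat foldl_cat andbA. Qed.

Lemma is_pathP g : is_path n g <-> walk (0, 0)%N g.
Proof.
have H v : okv v -> (forall k, okv (foldl move v (take k g))) <-> all okv (scanl move v g).
  move=> ov; split=> [h|h [|k]]; last 2 first.
  - by rewrite take0.
  - case: (ltnP k (size g)) => hk.
      by move/all_nthP: h => /(_ v k); rewrite size_scanl nth_scanl //; exact.
    case: (posnP (size g)) => [/size0nil->//|g0]; rewrite take_oversize ?(leq_trans hk) //.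
    move/all_nthP: h => /(_ v (size g).-1); rewrite size_scanl nth_scanl ?prednK // take_size.
    exact.
  apply/(all_nthP v) => i; rewrite size_scanl => hi; rewrite nth_scanl //; exact: h.
have o0 : okv (0, 0)%N by [].
rewrite /is_path /endpoint /walk; split=> [[h ->]|/andP[h /eqP->]].
  by rewrite eqxx andbT; apply/H.
by split=> //; apply/H.
Qed.

Lemma walk_lowest : walk (0, 0)%N (lowest_path n).
Proof.
rewrite walk_cat.
have dn p j : (j + p <= n)%N -> all okv (scanl move (0%N, j) (nseq p Down)) /\
    foldl move (0%N, j) (nseq p Down) = (0%N, j + p)%N.
  elim: p j => [|p IH] j h /=; first by rewrite addn0.
  have jn : (j.+1 + p <= n)%N by rewrite addSnnS.
  have [-> ->] := IH j.+1 jn; rewrite addSnnS andbT; split=> //.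
  by rewrite /okv /= (leq_trans (leq_addr p _) jn).
have up p i : (i + p <= n)%N -> walk (i, n)%N (nseq p Up) = (i + p == n)%N.
  elim: p i => [|p IH] i h; first by rewrite /walk /= addn0 xpair_eqE eqxx andbT.
  rewrite (walk_cat _ [:: Up]) /= IH; last by lia.
  by rewrite addSn addnS /okv /= !andbT; have -> : (i < n <= n)%N by lia.
have [|-> ->] := dn n 0%N; first by rewrite add0n.
by rewrite add0n up ?add0n ?eqxx.
Qed.

Fixpoint ups g : nat := if g is s :: g' then (if s is Down then 0%N else 1%N) + ups g' else 0%N.
Fixpoint downs g : nat := if g is s :: g' then (if s is Up then 0%N else 1%N) + downs g' else 0%N.

(* Twice the area between the path and the lowest path. *)
Fixpoint height g : nat :=
  if g is s :: g' then
    match s with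
    | Down => height g'
    | Up => (downs g').*2 + height g'
    | Horiz => ((downs g').*2 + height g').+1
    end
  else 0%N.

Lemma ups_cat g1 g2 : ups (g1 ++ g2) = (ups g1 + ups g2)%N.
Proof. by elim: g1 => //= s g IH; rewrite IH addnA. Qed.

Lemma downs_cat g1 g2 : downs (g1 ++ g2) = (downs g1 + downs g2)%N.
Proof. by elim: g1 => //= s g IH; rewrite IH addnA. Qed.

Lemma height_cat g1 g2 :
  height (g1 ++ g2) = (height g1 + height g2 + (ups g1 * downs g2).*2)%N.
Proof.
elim: g1 => [|s g IH]; first by rewrite mul0n addn0.
by case: s; rewrite /= IH ?downs_cat; lia.
Qed.

Lemma height_lowest : height (lowest_path n) = 0%N.
Proof.
rewrite /lowest_path height_cat.
have -> : ups (nseq n Down) = 0%N by elim: (n) => //= p ->.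
have -> : height (nseq n Down) = 0%N by elim: (n) => //= p ->.
suff [-> _] : height (nseq n Up) = 0%N /\ downs (nseq n Up) = 0%N by [].
by elim: (n) => //= p [-> ->].
Qed.

Definition peak g := g = [:: Up; Down] \/ g = [:: Horiz].

Lemma height_peak g1 g g2 : peak g -> (0 < height (g1 ++ g ++ g2))%N.
Proof. by case=> ->; rewrite !height_cat /=; lia. Qed.

(** The patterns [Up; Down] and [Horiz] cannot overlap partially, which makes moves at different
    peaks independent. *)
Lemma peak_align (A : Type) (f : A -> step) (Y1 B Y2 Z1 C Z2 : seq A) :
  peak (map f B) -> peak (map f C) -> Y1 ++ B ++ Y2 = Z1 ++ C ++ Z2 ->
  [\/ [/\ Y1 = Z1, B = C & Y2 = Z2],
      exists2 e, Z1 = Y1 ++ B ++ e & Y2 = e ++ C ++ Z2 |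
      exists2 e, Y1 = Z1 ++ C ++ e & Z2 = e ++ B ++ Y2].
Proof.
have key Y Y' e (B' C' : seq A) : peak (map f B') -> peak (map f C') ->
    B' ++ Y = e ++ C' ++ Y' -> (e = [::] /\ B' = C' /\ Y = Y') \/
    exists2 e', e = B' ++ e' & Y = e' ++ C' ++ Y'.
  case: B' => [|x [|y [|z B']]] [] //= [fx].
    case: C' => [|u [|w [|w' C']]] [] //= [fu].
      by case: e => [|e0 e] /= [<- E]; [left; split; rewrite ?E | right; exists e; rewrite ?E].
    move=> fw; case: e => [|e0 e] /= [exu E]; last by right; exists e; rewrite ?E // exu.
    by move: fx; rewrite exu fu.
  move=> fy; case: C' => [|u [|w [|w' C']]] [] //= [fu].
    case: e => [|e0 [|e1 e]] /= [ex]; first by move: fx; rewrite ex fu.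
      by case=> ey; move: fy; rewrite ey fu.
    by case=> ey E; right; exists e; rewrite ?E // ex ey.
  move=> fw; case: e => [|e0 [|e1 e]] /= [ex].
  - by case=> ey E; left; rewrite ex ey E.
  - by case=> ey; move: fy; rewrite ey fu.
  - by case=> ey E; right; exists e; rewrite ?E // ex ey.
move=> pB pC /cat_align[[e -> E]|[e -> E]].
  case: (key _ _ _ _ _ pB pC E) => [[-> [-> ->]]|[e' -> ->]].
    by constructor 1; rewrite cats0.
  by constructor 2; exists e'.
case: (key _ _ _ _ _ pC pB E) => [[-> [-> ->]]|[e' -> ->]].
  by constructor 1; rewrite cats0.
by constructor 3; exists e'.
Qed.

Lemma peak_or_valley (A : Type) (f : A -> step) (Z : seq A) :
  (exists Z1 B Z2, peak (map f B) /\ Z = Z1 ++ B ++ Z2) \/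
  (exists p q, map f Z = nseq p Down ++ nseq q Up).
Proof.
elim: Z => [|x Z IH]; first by right; exists 0%N, 0%N.
case: IH => [[Z1 [B [Z2 [pB ->]]]]|[p [q E]]]; first by left; exists (x :: Z1), B, Z2.
case fx : (f x).
- by right; exists p.+1, q; rewrite /= fx E.
- case: p E => [|p] E; first by right; exists 0%N, q.+1; rewrite /= fx E.
  case: Z E => //= y Z [fy E]; left; exists [::], [:: x; y], Z; split=> //.
  by left; rewrite /= fx fy.
- by left; exists [::], [:: x], Z; split=> //; right; rewrite /= fx.
Qed.
End Walks.

(** * Factor sequences and their closure under the two moves *)

Section FactorSequences.
Variables (n : nat) (r : nat -> nat -> nat) (T : nat -> nat -> diagram).
Hypothesis hr : rank_conditions n r.
Hypothesis hT : tableau_diagram n r T.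

Let lpath := seq (step * diagram).
Implicit Types (Z L : lpath) (v : nat * nat).

Definition pos Z := endpoint (map fst Z).

(** Steps and tableaux are kept in one list, so that a rule is a local rewriting whose only context
    is the vertex [v] before it. *)
Inductive rule v : lpath -> lpath -> Prop :=
| rule_split P Q : (v.1 < v.2)%N -> is_tableau P -> is_tableau Q ->
    rule v [:: (Horiz, tmul P Q)] [:: (Up, P); (Down, Q)]
| rule_merge Q P :
    rule v [:: (Down, Q); (Up, P)] [:: (Horiz, tmul (tmul Q (T v.1 v.2.+1)) P)].

Inductive FS : lpath -> Prop :=
| FS_lowest : FS [seq (s, [::]) | s <- lowest_path n]
| FS_rule Z1 L B Z2 : rule (pos Z1) L B -> FS (Z1 ++ L ++ Z2) -> FS (Z1 ++ B ++ Z2).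

Lemma fst_lowest : map fst [seq (s, [::] : diagram) | s <- lowest_path n] = lowest_path n.
Proof. by elim: (lowest_path n) => //= s g' ->. Qed.

Lemma FS_factor Z : FS Z -> factor_seq n T (map fst Z) (map snd Z).
Proof.
elim=> [|Z1 L B Z2 [P Q v tP tQ|Q P] _].
- have e2 : map snd [seq (s, [::] : diagram) | s <- lowest_path n] =
      nseq (size (lowest_path n)) [::].
    by elim: (lowest_path n) => [|s g' IH] //; congr (_ :: _); exact: IH.
  by rewrite fst_lowest e2; exact: factor_lowest.
- rewrite !map_cat /= => h; apply: factor_split => //.
  by rewrite !size_map.
- rewrite !map_cat /= => h; apply: factor_merge => //.
  by rewrite !size_map.
Qed.

Lemma factor_FS g W : factor_seq n T g W -> size W = size g /\ FS (zip g W).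
Proof.
elim=> [|g1 g2 W1 W2 P Q h sW tP tQ _ [sz]|g1 g2 W1 W2 Q P i j sW _ [sz]].
- split; first by rewrite size_nseq.
  have -> : zip (lowest_path n) (nseq (size (lowest_path n)) [::]) =
      [seq (s, [::] : diagram) | s <- lowest_path n].
    by elim: (lowest_path n) => [|s g' IH] //; congr (_ :: _); exact: IH.
  exact: FS_lowest.
- rewrite !zip_cat //= => f; split; first by move: sz; rewrite !size_cat /=; lia.
  apply: (FS_rule (L := [:: (Horiz, tmul P Q)]) (B := [:: (Up, P); (Down, Q)])) f.
  by apply: rule_split => //; rewrite /pos -/(unzip1 _) unzip1_zip ?sW.
rewrite !zip_cat //= => f; split; first by move: sz; rewrite !size_cat /=; lia.
have e : pos (zip g1 W1) = endpoint g1 by rewrite /pos -/(unzip1 _) unzip1_zip ?sW.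
have := rule_merge (pos (zip g1 W1)) Q P; rewrite e => ru.
by apply: (@FS_rule _ [:: (Down, Q); (Up, P)] [:: (Horiz, _)] _ _ f); rewrite e.
Qed.

Lemma rule_move v L B : rule v L B ->
  foldl move v (map fst L) = foldl move v (map fst B).
Proof. by case. Qed.

Lemma rule_peak v L B : rule v L B -> peak (map fst B).
Proof. by case=> [P Q _ _ _|Q P]; [left | right]. Qed.

Lemma rule_height v L B Z1 Z2 : rule v L B ->
  (height (map fst (Z1 ++ L ++ Z2)) < height (map fst (Z1 ++ B ++ Z2)))%N.
Proof. by case=> [P Q _ _ _|Q P]; rewrite !map_cat !height_cat /=; lia. Qed.

Lemma pos_cat Z1 Z2 : pos (Z1 ++ Z2) = foldl move (pos Z1) (map fst Z2).
Proof. by rewrite /pos /endpoint map_cat foldl_cat. Qed.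

Lemma rule_pos Z1 L B Z2 : rule (pos Z1) L B -> pos (Z1 ++ L ++ Z2) = pos (Z1 ++ B ++ Z2).
Proof. by move=> ru; rewrite !pos_cat !map_cat !foldl_cat (rule_move ru). Qed.

(* Moves at distinct places commute, so any peak can be produced last. *)
Lemma FS_inv Z : FS Z -> forall Z1 B Z2, Z = Z1 ++ B ++ Z2 -> peak (map fst B) ->
  exists2 L, rule (pos Z1) L B & FS (Z1 ++ L ++ Z2).
Proof.
elim=> [Z1 B Z2 E pB|Y1 L B Y2 ru f IH Z1 C Z2 E pC].
  have := height_peak (map fst Z1) (map fst Z2) pB; rewrite -!map_cat -E.
  by rewrite fst_lowest height_lowest.
case: (peak_align (rule_peak ru) pC E) => [[<- <- <-]|[e E1 E2]|[e E1 E2]].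
- by exists L.
- have [L' ru' f'] := IH (Y1 ++ L ++ e) C Z2 (etrans (congr1 (fun X => Y1 ++ L ++ X) E2)
    (esym (etrans (esym (catA _ _ _)) (congr1 (cat Y1) (esym (catA _ _ _)))))) pC.
  exists L'; first by rewrite E1 -(rule_pos _ ru).
  rewrite E1 -!catA; apply: (FS_rule ru); by move: f'; rewrite -!catA.
have [L' ru' f'] := IH Z1 C (e ++ L ++ Y2) (etrans (congr1 (fun X => X ++ L ++ Y2) E1)
    (etrans (esym (catA _ _ _)) (congr1 (cat Z1) (esym (catA _ _ _))))) pC.
exists L' => //; rewrite E2 !catA -!catA (catA L') (catA Z1).
apply: (FS_rule (L := L)); last by rewrite -!catA.
by rewrite (rule_pos _ ru') -E1.
Qed.

(** The index intervals that can feed a label. At a corner both labels come from intervals strictly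
    containing that of the rectangle, so their entries exceed those of its tableau; this requires
    the strict bound on [k] for down-steps. *)
Definition okl v (s : step) (V : diagram) := tab V /\ forall x, x \in entries V ->
  exists k l, [/\ (k < l <= n)%N, if s is Down then (k < v.1)%N else (k <= v.1)%N,
    (v.2 < l)%N & x \in entries (T k l)].

Fixpoint content v Z : Prop :=
  if Z is x :: Z' then okl v x.1 x.2 /\ content (move v x.1) Z' else True.

Lemma content_cat v Z1 Z2 :
  content v (Z1 ++ Z2) <-> content v Z1 /\ content (foldl move v (map fst Z1)) Z2.
Proof.
elim: Z1 v => [|x Z1 IH] v /=; first by split=> [|[]].
by rewrite IH; split=> [[? []]|[[]]].
Qed.

Lemma FS_okl Z : FS Z -> walk n (0, 0)%N (map fst Z) /\ content (0, 0)%N Z.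
Proof.
elim=> [|Z1 L B Z2 ru _ [w c]].
  split; first by rewrite fst_lowest; exact: walk_lowest.
  by elim: (lowest_path n) (0, 0)%N => //= s g' IH v; split.
move: w c; rewrite !map_cat walk_cat => /andP[w1 w] /content_cat[c1 /content_cat[c c2]].
rewrite walk_cat w1 /=; move: w c c2; rewrite !walk_cat (rule_move ru) => /andP[wL ->] cL c2.
rewrite andbT; suff [wB cB] : all (okv n) (scanl move (pos Z1) (map fst B)) /\ content (pos Z1) B.
  by split=> //; apply/content_cat; split=> //; apply/content_cat.
case: ru wL cL {c2} => [P Q v tP tQ|Q P] /=; rewrite ?andbT.
  rewrite -/(endpoint _) -/(pos _) => h [[_ okV] _]; split.
    by rewrite /okv /= in h *; move: h v; clear; lia.
  split; last split=> //.
    split; first exact/is_tableauP.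
    by move=> x xP; apply: okV; rewrite (perm_mem (perm_tmul _ _)) mem_cat xP.
  split; first exact/is_tableauP.
  move=> x xQ; have [|k [l [kl hk hl xT]]] := okV x.
    by rewrite (perm_mem (perm_tmul _ _)) mem_cat xQ orbT.
  by exists k, l.
rewrite -/(endpoint _) -/(pos _) => /andP[h1 h2] [okQ [okP _]]; split=> //; split=> //.
have [tQ eQ] := okQ; have [tP eP] := okP.
have hv : ((pos Z1).1 < (pos Z1).2.+1 <= n)%N.
  by move: h1 h2; rewrite /okv /=; clear; lia.
have [/is_tableauP tT _] := (proj1 hT) _ _ hv.
split; first by do 2!apply: tab_tmul.
move=> x; rewrite (perm_mem (perm_tmul _ _)) mem_cat (perm_mem (perm_tmul _ _)) mem_cat.
case/orP=> [/orP[/eQ|xT]|/eP] => [[k [l [kl hk hl xT]]]||[k [l [kl hk hl xT]]]].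
- by exists k, l; split=> //=; apply: ltnW.
- by exists (pos Z1).1, (pos Z1).2.+1; split=> /=.
- by exists k, l; split=> //=; apply: ltnW.
Qed.

Lemma FS_label Z1 s V Z2 : FS (Z1 ++ (s, V) :: Z2) -> okl (pos Z1) s V.
Proof. by case/FS_okl => _ /content_cat[_ []]. Qed.

Lemma FS_nil_right Z1 s V Z2 : FS (Z1 ++ (s, V) :: Z2) -> (n <= (pos Z1).2)%N -> V = [::].
Proof.
move=> /FS_label[tV eV] h; case: V tV eV => // -[|x u] V tV eV; first by case/tablP: tV.
have [|k [l [kl _ hl _]]] := eV x; first by rewrite inE eqxx.
by move: kl hl h; clear; lia.
Qed.

Lemma FS_nil_left Z1 V Z2 : FS (Z1 ++ (Down, V) :: Z2) -> (pos Z1).1 = 0%N -> V = [::].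
Proof.
move=> /FS_label[tV eV] h; case: V tV eV => // -[|x u] V tV eV; first by case/tablP: tV.
by have [|k [l [_ /= hk _ _]]] := eV x; [rewrite inE eqxx | rewrite h in hk].
Qed.

Lemma FS_corner Z1 Q P Z2 : FS (Z1 ++ [:: (Down, Q); (Up, P)] ++ Z2) ->
  let i := (pos Z1).1 in let j := (pos Z1).2 in
  [/\ (i <= j < n)%N, tab Q, tab P, entries_above (T i j.+1) Q & entries_above (T i j.+1) P].
Proof.
move=> f i j; have [w _] := FS_okl f.
have hv : (i <= j < n)%N.
  move: w; rewrite !map_cat walk_cat walk_cat => /andP[w1 /andP[/= /andP[h1 /andP[h2 _]] _]].
  by move: h1 h2; rewrite /okv /= -/(endpoint _) -/(pos _) -/i -/j; clear; lia.
have [tQ eQ] := FS_label f.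
have [tP eP] : okl (pos (Z1 ++ [:: (Down, Q)])) Up P.
  by apply: (@FS_label _ _ _ Z2); rewrite -catA.
have [_ above] := hT.
split=> // x t.
  move=> /eQ[k [l [kl /= hk hl xT]]] tT; apply: (above k l i j.+1) xT tT.
  - by case/andP: kl.
  - by move: hk hv; rewrite -/i; clear; lia.
  - by move: hl; rewrite -/j.
  - by case=> e _; move: hk; rewrite -e ltnn.
move=> /eP[k [l [kl]]]; rewrite pos_cat /= -/i -/j => hk hl xT tT.
apply: (above k l i j.+1) xT tT.
- by case/andP: kl.
- by move: hk hv; clear; lia.
- exact: ltnW.
- by case=> _ e; move: hl; rewrite -e ltnn.
Qed.

Lemma FS_rect Z1 Q P Z2 : FS (Z1 ++ [:: (Down, Q); (Up, P)] ++ Z2) ->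
  let i := (pos Z1).1 in let j := (pos Z1).2 in
  tab (T i j.+1) /\ shape (T i j.+1) =
    [seq m <- nseq (rect_rows r i j.+1) (rect_cols r i j.+1) | m != 0%N].
Proof.
move=> f i j; have [h _ _ _ _] := FS_corner f.
have [|/is_tableauP tT sT] := (proj1 hT) i j.+1; first by move: h; rewrite -/i -/j; clear; lia.
by split.
Qed.

Lemma inv_split Z1 P Q Z2 : FS (Z1 ++ [:: (Up, P); (Down, Q)] ++ Z2) ->
  [/\ ((pos Z1).1 < (pos Z1).2)%N, tab P, tab Q & FS (Z1 ++ [:: (Horiz, tmul P Q)] ++ Z2)].
Proof.
move=> f; have [L ru f'] := FS_inv f erefl (or_introl erefl).
move: ru f'; move E : [:: (Up, P); (Down, Q)] => B ru.
case: ru E => [P' Q' v /is_tableauP tP /is_tableauP tQ [-> ->] //|Q' P' E].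
by case: E.
Qed.

Lemma inv_merge Z1 V Z2 : FS (Z1 ++ [:: (Horiz, V)] ++ Z2) ->
  exists Q P, V = tmul (tmul Q (T (pos Z1).1 (pos Z1).2.+1)) P /\
    FS (Z1 ++ [:: (Down, Q); (Up, P)] ++ Z2).
Proof.
move=> f; have [L ru f'] := FS_inv f erefl (or_intror erefl).
move: ru f'; move E : [:: (Horiz, V)] => B ru.
by case: ru E => [P' Q' _ _ _|Q P [->] f'] //; exists Q, P.
Qed.

Lemma do_split Z1 P Q Z2 : ((pos Z1).1 < (pos Z1).2)%N -> tab P -> tab Q ->
  FS (Z1 ++ [:: (Horiz, tmul P Q)] ++ Z2) -> FS (Z1 ++ [:: (Up, P); (Down, Q)] ++ Z2).
Proof.
by move=> h tP tQ; apply: FS_rule; apply: rule_split => //; exact/is_tableauP.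
Qed.

Lemma do_merge Z1 P Q Z2 : FS (Z1 ++ [:: (Down, Q); (Up, P)] ++ Z2) ->
  FS (Z1 ++ [:: (Horiz, tmul (tmul Q (T (pos Z1).1 (pos Z1).2.+1)) P)] ++ Z2).
Proof. by apply: FS_rule; exact: rule_merge. Qed.

Definition move_rows Z1 Z2 := forall Q P, FS (Z1 ++ [:: (Down, Q); (Up, P)] ++ Z2) ->
  let a := rect_rows r (pos Z1).1 (pos Z1).2.+1 in
  FS (Z1 ++ [:: (Down, tmul Q (drop a P)); (Up, take a P)] ++ Z2).

Definition move_cols Z1 Z2 := forall Q P, FS (Z1 ++ [:: (Down, Q); (Up, P)] ++ Z2) ->
  let b := rect_cols r (pos Z1).1 (pos Z1).2.+1 in
  FS (Z1 ++ [:: (Down, left_cut b Q); (Up, tmul (right_cut b Q) P)] ++ Z2).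

Lemma corner_canonical Z1 V Z2 : move_rows Z1 Z2 -> move_cols Z1 Z2 ->
  FS (Z1 ++ [:: (Horiz, V)] ++ Z2) ->
  let i := (pos Z1).1 in let j := (pos Z1).2.+1 in
  exists X Y, [/\ FS (Z1 ++ [:: (Down, X); (Up, Y)] ++ Z2),
    V = tmul (tmul X (T i j)) Y & col_canonical (rect_rows r i j) (rect_cols r i j) X Y].
Proof.
move=> m1 m2 /inv_merge[Q [P [-> f]]] i j.
have [tT sT] := FS_rect f.
have h Q' P' : FS (Z1 ++ [:: (Down, Q'); (Up, P')] ++ Z2) ->
    [/\ tab Q', tab P', entries_above (T i j) Q' & entries_above (T i j) P'].
  by case/FS_corner.
have [X [Y [f' E c]]] := @canonical_exists _ _ _ tT sT
  (fun Q P => FS (Z1 ++ [:: (Down, Q); (Up, P)] ++ Z2)) h m1 m2 Q P f.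
by exists X, Y.
Qed.

Lemma col_canonical_ex Z1 V Z2 : move_rows Z1 Z2 -> move_cols Z1 Z2 ->
  FS (Z1 ++ [:: (Horiz, V)] ++ Z2) ->
  let i := (pos Z1).1 in let j := (pos Z1).2.+1 in let b := rect_cols r i j in
  exists X Y, [/\ FS (Z1 ++ [:: (Down, X); (Up, Y)] ++ Z2),
    left_cut b V = tmul X (T i j) & right_cut b V = Y].
Proof.
move=> m1 m2 f i j b; have [X [Y [f' -> c]]] := corner_canonical m1 m2 f.
have [tT sT] := FS_rect f'; have [_ tX tY aX aY] := FS_corner f'.
by exists X, Y; have [-> ->] := col_canonicalP tT sT tX tY aX aY c.
Qed.

Lemma row_canonical_ex Z1 V Z2 : move_rows Z1 Z2 -> move_cols Z1 Z2 ->
  FS (Z1 ++ [:: (Horiz, V)] ++ Z2) ->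
  let i := (pos Z1).1 in let j := (pos Z1).2.+1 in let a := rect_rows r i j in
  exists X Y, [/\ FS (Z1 ++ [:: (Down, X); (Up, Y)] ++ Z2), (size Y <= a)%N,
    V = tmul (tmul X (T i j)) Y, take a V = tmul (T i j) Y & drop a V = X].
Proof.
move=> m1 m2 f i j a; have [X0 [Y0 [f0 -> c]]] := corner_canonical m1 m2 f.
have [tT sT] := FS_rect f0; have [_ tX0 tY0 aX0 aY0] := FS_corner f0.
have rc := col_row_canonical tT sT tX0 tY0 aX0 aY0 c.
have f' := m1 _ _ f0; have [_ tX tY aX aY] := FS_corner f'.
exists (tmul X0 (drop a Y0)), (take a Y0); case: rc => r1 r2.
have E := tmul_top tT sT tX0 tY0 aY0.
split=> //; first by rewrite size_take; case: ltnP => // /ltnW.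
  by rewrite E r1 tmul_above.
by rewrite E r2.
Qed.

Lemma rows_decrease i j : (i <= j)%N -> (j.+2 <= n)%N ->
  (rect_rows r i j.+2 <= rect_rows r i j.+1)%N.
Proof.
move=> ij jn; have [_ h] := hr; have := h i j.+2; rewrite /rect_rows.
by move=> /(_ _); rewrite !ltnS ij jn => /(_ isT) /=; clear; lia.
Qed.

Lemma cols_increase i j : (i < j)%N -> (j.+1 <= n)%N ->
  (rect_cols r i j.+1 <= rect_cols r i.+1 j.+1)%N.
Proof.
move=> ij jn; have [_ h] := hr; have := h i j.+1; rewrite /rect_cols.
by move=> /(_ _); rewrite !ltnS ij jn => /(_ isT) /=; clear; lia.
Qed.

Lemma left_cases Z1 p q : map fst Z1 = nseq p Down ++ nseq q Up ->
  (pos Z1).1 = 0%N \/ exists Z A, Z1 = Z ++ [:: (Up, A)].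
Proof.
case: q => [|q] E.
  left; rewrite /pos E cats0 /endpoint.
  suff H v : (foldl move v (nseq p Down)).1 = v.1 by rewrite H.
  by elim: p v {E} => //= p IH v; rewrite IH.
right; case/lastP: Z1 E => [|Z [s A]]; first by case: p.
have -> : nseq p Down ++ nseq q.+1 Up = rcons (nseq p Down ++ nseq q Up) Up.
  by rewrite -cats1 -catA -[[:: Up]]/(nseq 1 Up) -nseqD addn1.
by rewrite map_rcons => /rcons_inj[_ /= ->]; exists Z, A; rewrite cats1.
Qed.

Lemma right_cases Z Z2 p q : walk n (0, 0)%N (map fst (Z ++ Z2)) ->
  map fst Z2 = nseq p Down ++ nseq q Up ->
  (n <= (pos Z).2)%N \/ exists (V : diagram) Z', Z2 = (Down, V) :: Z'.
Proof.
case: p => [|p] w E; last by right; case: Z2 E {w} => // -[s B] Z' [-> _]; exists B, Z'.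
left; move: w; rewrite map_cat walk_cat E /= => /andP[_ /andP[_ /eqP e]].
rewrite -/(endpoint _) -/(pos Z) in e.
suff H v : (foldl move v (nseq q Up)).2 = v.2 by rewrite -(H (pos Z)) e.
by elim: q v {E e} => //= q IH v; rewrite IH.
Qed.

Lemma tmul_eq_nil X Y : tmul X Y = [::] -> tab X -> tab Y -> X = [::] /\ Y = [::].
Proof.
move=> E tX tY; have := area_tmul X Y; rewrite E => /esym/eqP; rewrite addn_eq0.
have nil V : tab V -> area V == 0%N -> V = [::] by case: V => // -[|x u] V //; case/tablP.
by case/andP=> /(nil _ tX) -> /(nil _ tY) ->.
Qed.

Lemma move_rows_left Z A B B' P X :
  move_rows (Z ++ [:: (Horiz, A)]) X -> move_cols (Z ++ [:: (Horiz, A)]) X ->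
  B = tmul P B' -> tab P -> tab B' ->
  FS ((Z ++ [:: (Horiz, A)]) ++ [:: (Horiz, B)] ++ X) ->
  let a := rect_rows r (pos Z).1.+1 (pos Z).2.+1 in
  ((pos Z).1.+1 <= (pos Z).2)%N -> ((pos Z).2.+2 <= n)%N ->
  FS (Z ++ [:: (Horiz, tmul A (drop a P))] ++ [:: (Horiz, tmul (take a P) B')] ++ X).
Proof.
move=> m1 m2 EB tP tB' f a h1 h2.
have [X2 [Y2 [f2 _ EB2 tB dB]]] := row_canonical_ex m1 m2 f.
move: tB dB EB2; rewrite pos_cat /=; set i := (pos Z).1; set j := (pos Z).2.
set S := T _ _; set a' := rect_rows _ _ _ => tB dB EB2.
have aa : (a' <= a)%N by apply: rows_decrease.
have [tS _] : tab S /\ True by have := FS_rect f2; rewrite pos_cat => -[].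
have [_ tX2 tY2 _ _] := FS_corner f2.
have [r1 r2] := tmul_rows tP tB' aa; rewrite -EB tB dB in r1 r2.
set B1 := tmul (take a P) B' in r1 r2 *.
have tdP := tab_drop a tP; have ttP := tab_take a tP.
have tB1 : tab B1 by exact: tab_tmul.
have tX1 := tab_drop a' tB1.
move: f2; rewrite -catA => /inv_merge[Q1 [P1 [EA f3]]].
have [_ tQ1 tP1 _ _] := FS_corner f3.
have [tR _] := FS_rect f3; rewrite -/i -/j in tR EA.
have : FS ((Z ++ [:: (Down, Q1)]) ++ [:: (Up, P1); (Down, X2)] ++ (Up, Y2) :: X).
  by move: f3; rewrite -!catA.
case/inv_split => lt _ _ f4.
have f5 : FS ((Z ++ [:: (Down, Q1)]) ++ [:: (Up, tmul P1 (drop a P)); (Down, drop a' B1)]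
    ++ (Up, Y2) :: X).
  apply: do_split => //; first exact: tab_tmul.
  by rewrite tmulA // -r2.
have : FS (Z ++ [:: (Down, Q1); (Up, tmul P1 (drop a P))] ++
    [:: (Down, drop a' B1); (Up, Y2)] ++ X) by move: f5; rewrite -!catA.
move/do_merge; rewrite -/i -/j => f6.
have EA' : tmul (tmul Q1 (T i j.+1)) (tmul P1 (drop a P)) = tmul A (drop a P).
  by rewrite EA -(tmulA _ tP1 tdP) //; exact: tab_tmul.
rewrite EA' in f6.
have : FS ((Z ++ [:: (Horiz, tmul A (drop a P))]) ++
    [:: (Down, drop a' B1); (Up, Y2)] ++ X) by rewrite -catA.
move/do_merge; rewrite pos_cat /= -/i -/j -/S -catA.
have -> // : tmul (tmul (drop a' B1) S) Y2 = B1.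
by rewrite (tmulA tX1 tS tY2) r1 tmul_take_drop.
Qed.

Lemma move_cols_left Z A A' B Q X :
  move_rows Z ((Horiz, B) :: X) -> move_cols Z ((Horiz, B) :: X) ->
  A = tmul A' Q -> tab A' -> tab Q -> tab B ->
  FS (Z ++ [:: (Horiz, A)] ++ [:: (Horiz, B)] ++ X) ->
  let b := rect_cols r (pos Z).1.+1 (pos Z).2.+1 in
  ((pos Z).1 < (pos Z).2)%N -> ((pos Z).2.+1 <= n)%N ->
  FS (Z ++ [:: (Horiz, tmul A' (left_cut b Q))] ++
    [:: (Horiz, tmul (right_cut b Q) B)] ++ X).
Proof.
move=> m1 m2 EA tA' tQ tB f b h1 h2.
have [X1 [Y1 [f2 lA rA]]] := col_canonical_ex m1 m2 f.
move: lA rA; set i := (pos Z).1; set j := (pos Z).2.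
set R := T _ _; set b' := rect_cols _ _ _ => lA rA.
have bb : (b' <= b)%N by apply: cols_increase.
have [tR _] := FS_rect f2; rewrite -/i -/j -/R in tR.
have [_ tX1 tY1 _ _] := FS_corner f2.
have [r1 r2] := tmul_columns tA' tQ bb; rewrite -EA lA rA in r1 r2.
set A1 := tmul A' (left_cut b Q) in r1 r2 *.
have tlQ := tab_left_cut b tQ; have trQ := tab_right_cut b tQ.
have tA1 : tab A1 by exact: tab_tmul.
have tW := tab_right_cut b' tA1.
have : FS ((Z ++ [:: (Down, X1); (Up, Y1)]) ++ [:: (Horiz, B)] ++ X) by rewrite -catA.
case/inv_merge => Q2 [P2 [EB f3]].
have [_ tQ2 tP2 _ _] := FS_corner f3.
have [tS _] := FS_rect f3; rewrite pos_cat /= -/i -/j in tS EB.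
have : FS ((Z ++ [:: (Down, X1)]) ++ [:: (Up, Y1); (Down, Q2)] ++ (Up, P2) :: X).
  by move: f3; rewrite -!catA.
case/inv_split => lt _ _ f4.
have f5 : FS ((Z ++ [:: (Down, X1)]) ++ [:: (Up, right_cut b' A1);
    (Down, tmul (right_cut b Q) Q2)] ++ (Up, P2) :: X).
  apply: do_split => //; first exact: tab_tmul.
  by rewrite -tmulA // -r2.
have : FS (Z ++ [:: (Down, X1); (Up, right_cut b' A1)] ++
    [:: (Down, tmul (right_cut b Q) Q2); (Up, P2)] ++ X) by move: f5; rewrite -!catA.
move/do_merge; rewrite -/i -/j -/R r1 tmul_cut // => f6.
have : FS ((Z ++ [:: (Horiz, A1)]) ++
    [:: (Down, tmul (right_cut b Q) Q2); (Up, P2)] ++ X) by rewrite -catA.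
move/do_merge; rewrite pos_cat /= -/i -/j -catA.
have -> // : tmul (tmul (tmul (right_cut b Q) Q2) (T i.+1 j.+2)) P2 = tmul (right_cut b Q) B.
rewrite EB (tmulA trQ tQ2 tS) (tmulA trQ _ tP2) //; exact: tab_tmul.
Qed.

Lemma moves_closed N Z1 Z2 Q P :
  (height (map fst (Z1 ++ [:: (Down, Q); (Up, P)] ++ Z2)) < N)%N ->
  move_rows Z1 Z2 /\ move_cols Z1 Z2.
Proof.
elim: N Z1 Z2 Q P => // N IH Z1 Z2 Q0 P0 hN.
have IH' Z B' L : rule (pos Z) L B' -> forall Z', 
    (height (map fst (Z ++ B' ++ Z')) <= N)%N -> (height (map fst (Z ++ L ++ Z')) < N)%N.
  by move=> ru Z' h; exact: leq_trans (rule_height Z Z' ru) h.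
have hc Q P : (height (map fst (Z1 ++ [:: (Down, Q); (Up, P)] ++ Z2)) <= N)%N.
  by move: hN; rewrite !map_cat.
(* A peak before the corner is undone, the move is made on the lower path by induction, and the peak
   is restored by the same rule. A peak after the corner is treated likewise next. *)
have [[Y1 [B [Y2 [pB EZ]]]]|[p [q E1]]] := peak_or_valley fst Z1.
  have key Q P : FS (Z1 ++ [:: (Down, Q); (Up, P)] ++ Z2) -> exists L,
      [/\ rule (pos Y1) L B, FS ((Y1 ++ L ++ Y2) ++ [:: (Down, Q); (Up, P)] ++ Z2) &
          move_rows (Y1 ++ L ++ Y2) Z2 /\ move_cols (Y1 ++ L ++ Y2) Z2].
    rewrite EZ -!catA => f; have [L ru f'] := FS_inv f erefl pB.
    exists L; split; rewrite -?catA //; apply: (IH _ _ Q P).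
    by rewrite -!catA; apply: (IH' _ _ _ ru); have := hc Q P; rewrite EZ -!catA.
  split=> Q P f; have [L [ru f' [m1 m2]]] := key Q P f.
    have := m1 _ _ f'; rewrite (rule_pos _ ru) -EZ => g a; rewrite /= in g; rewrite EZ -!catA.
    by apply: (FS_rule ru); rewrite -!catA in g.
  have := m2 _ _ f'; rewrite (rule_pos _ ru) -EZ => g a; rewrite /= in g; rewrite EZ -!catA.
  by apply: (FS_rule ru); rewrite -!catA in g.
have [[Y1 [B [Y2 [pB EZ]]]]|[s [t E2]]] := peak_or_valley fst Z2.
  have key Q P : FS (Z1 ++ [:: (Down, Q); (Up, P)] ++ Z2) -> exists L,
      [/\ rule (pos (Z1 ++ [:: (Down, Q); (Up, P)] ++ Y1)) L B,
          FS (Z1 ++ [:: (Down, Q); (Up, P)] ++ (Y1 ++ L ++ Y2)) &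
          move_rows Z1 (Y1 ++ L ++ Y2) /\ move_cols Z1 (Y1 ++ L ++ Y2)].
    have e X : Z1 ++ [:: (Down, Q); (Up, P)] ++ Y1 ++ X =
        (Z1 ++ [:: (Down, Q); (Up, P)] ++ Y1) ++ X by rewrite -!catA.
    rewrite EZ e => f; have [L ru f'] := FS_inv f erefl pB.
    exists L; split=> //; first by rewrite e.
    apply: (IH _ _ Q P); rewrite e; apply: (IH' _ _ _ ru); rewrite -e -EZ; exact: hc.
  have redo Q P Q' P' L : rule (pos (Z1 ++ [:: (Down, Q); (Up, P)] ++ Y1)) L B ->
      FS (Z1 ++ [:: (Down, Q'); (Up, P')] ++ (Y1 ++ L ++ Y2)) ->
      FS (Z1 ++ [:: (Down, Q'); (Up, P')] ++ Z2).
    have e X : Z1 ++ [:: (Down, Q'); (Up, P')] ++ Y1 ++ X =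
        (Z1 ++ [:: (Down, Q'); (Up, P')] ++ Y1) ++ X by rewrite -!catA.
    rewrite EZ !e => ru; apply: FS_rule; move: ru; by rewrite !pos_cat.
  by split=> Q P f; have [L [ru f' [m1 m2]]] := key Q P f; apply: (redo Q P _ _ L ru);
    [exact: m1 | exact: m2].
(* No peak is left on either side. [low] is the induction hypothesis at another corner; the height
   ignores the labels, so empty ones serve. *)
have low Z X Q P : (height (map fst Z ++ [:: Down; Up] ++ map fst X) <
    height (map fst (Z1 ++ [:: (Down, Q); (Up, P)] ++ Z2)))%N -> move_rows Z X /\ move_cols Z X.
  move=> lt; apply: (IH _ _ [::] [::]).
  by rewrite !map_cat /=; apply: leq_trans lt _; exact: hc.
split=> Q P f /=.
  have [h tQ tP _ _] := FS_corner f; have [w _] := FS_okl f.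
  set a := rect_rows _ _ _.
  have triv : drop a P = [::] ->
      FS (Z1 ++ [:: (Down, tmul Q (drop a P)), (Up, take a P) & Z2]).
    by move=> d; rewrite d tmul0 -[take a P]cats0 -d cat_take_drop.
  (* Without a down-step after the corner the path has reached level [n], and no [T k l] can
     contribute to [P]. *)
  rewrite catA in w; case: (right_cases w E2) => [nj|[B' [X EX]]].
    apply: triv; suff -> : P = [::] by [].
    apply: (@FS_nil_right (Z1 ++ [:: (Down, Q)]) Up P Z2); first by rewrite -catA.
    by move: nj; rewrite !pos_cat.
  have : FS ((Z1 ++ [:: (Down, Q)]) ++ [:: (Up, P); (Down, B')] ++ X).
    by move: f; rewrite EX -catA.
  case/inv_split => _ _ tB' f1.
  have jn : ((pos Z1).2.+2 <= n)%N.
    have [Q' [P' [_ /FS_corner[hx _ _ _ _]]]] := inv_merge f1.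
    by move: hx; rewrite pos_cat /= => /andP[].
  (* Without an up-step before the corner the first coordinate is 0, so the down label [X2] is
     empty: [P . B'] has at most [a'] rows, and [drop a P], a factor of its lower rows, is empty. *)
  case: (left_cases E1) => [i0|[Z [A' EZ]]].
    have [m1 m2] : move_rows (Z1 ++ [:: (Down, Q)]) X /\ move_cols (Z1 ++ [:: (Down, Q)]) X.
      by apply: (low _ _ Q P); rewrite EX ?map_cat ?height_cat ?ups_cat ?downs_cat /=; clear; lia.
    have [X2 [Y2 [f2 _ _ _ dB]]] := row_canonical_ex m1 m2 f1.
    apply: triv; have X20 : X2 = [::].
      by apply: (FS_nil_left f2); rewrite pos_cat.
    move: dB; rewrite pos_cat /= X20; set a' := rect_rows _ _ _ => dB.
    have aa : (a' <= a)%N by apply: rows_decrease => //; case/andP: h.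
    have [_ r2] := tmul_rows tP tB' aa; rewrite dB in r2.
    have [] // := tmul_eq_nil (esym r2); first exact: tab_drop.
    by apply: tab_drop; apply: tab_tmul; exact: tab_take.
  have pZ : pos Z1 = ((pos Z).1.+1, (pos Z).2) by rewrite EZ pos_cat.
  have : FS (Z ++ [:: (Up, A'); (Down, Q)] ++ [:: (Horiz, tmul P B')] ++ X).
    by move: f1; rewrite EZ -!catA.
  case/inv_split => lt tA' _ f2.
  have [m1 m2] : move_rows (Z ++ [:: (Horiz, tmul A' Q)]) X /\
      move_cols (Z ++ [:: (Horiz, tmul A' Q)]) X.
    by apply: (low _ _ Q P); rewrite EX EZ ?map_cat ?height_cat ?ups_cat ?downs_cat /=; clear; lia.
  rewrite catA in f2; have := move_rows_left m1 m2 erefl tP tB' f2.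
  rewrite pZ /= in jn a triv h *; rewrite -/a => /(_ lt jn).
  have tdP := tab_drop a tP; have ttP := tab_take a tP.
  rewrite (tmulA tA' tQ tdP) => /do_split g.
  have {g} := g lt tA' (tab_tmul _ tQ).
  rewrite catA => /do_split g; have {g} : FS ((Z ++ [:: (Up, A'); (Down, tmul Q (drop a P))]) ++
      [:: (Up, take a P); (Down, B')] ++ X).
    by apply: g => //; rewrite pos_cat /=; move: lt jn; clear; lia.
  by rewrite EX EZ -!catA.
have [h tQ tP _ _] := FS_corner f; have [w _] := FS_okl f.
set b := rect_cols _ _ _.
case: (left_cases E1) => [i0|[Z [A' EZ]]].
  have eQ := FS_nil_left f i0; rewrite eQ in f *.
  by rewrite tmul_nil.
have pZ : pos Z1 = ((pos Z).1.+1, (pos Z).2) by rewrite EZ pos_cat.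
rewrite pZ /= in b h *.
have : FS (Z ++ [:: (Up, A'); (Down, Q)] ++ (Up, P) :: Z2) by move: f; rewrite EZ -!catA.
case/inv_split => lt tA' _ f1.
have tlQ := tab_left_cut b tQ; have trQ := tab_right_cut b tQ.
have jn : ((pos Z).2.+1 <= n)%N by case/andP: h.
(* The analogue for columns: at level [n] both [P] and [Y1] are empty, so [A' . Q] has an empty
   right part, of which [right_cut b Q] is a factor. *)
rewrite catA in w; case: (right_cases w E2) => [nj|[B' [X EX]]].
  have [m1 m2] : move_rows Z ((Up, P) :: Z2) /\ move_cols Z ((Up, P) :: Z2).
    by apply: (low _ _ Q P); rewrite EZ ?map_cat ?height_cat ?ups_cat ?downs_cat /=; clear; lia.
  have [X1 [Y1 [f2 _ rA]]] := col_canonical_ex m1 m2 f1.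
  have nj' : (n <= (pos Z).2.+1)%N by move: nj; rewrite pos_cat pZ /=.
  have eP : P = [::].
    apply: (@FS_nil_right (Z1 ++ [:: (Down, Q)]) Up P Z2); first by rewrite -catA.
    by rewrite pos_cat pZ.
  have Y0 : Y1 = [::].
    apply: (@FS_nil_right (Z ++ [:: (Down, X1)]) Up Y1 ((Up, P) :: Z2)); first by rewrite -catA.
    by rewrite pos_cat.
  rewrite Y0 in rA; set b' := rect_cols _ _ _ in rA.
  have bb : (b' <= b)%N by apply: cols_increase.
  have [_ r2] := tmul_columns tA' tQ bb; rewrite rA in r2.
  have [_ r0] : right_cut b' (tmul A' (left_cut b Q)) = [::] /\ right_cut b Q = [::].
    by apply: (tmul_eq_nil (esym r2)) => //; apply: tab_right_cut; exact: tab_tmul.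
  have lQ : left_cut b Q = Q by rewrite -[RHS](tmul_cut b tQ) r0.
  by rewrite r0 lQ tmul_nil.
have : FS ((Z ++ [:: (Horiz, tmul A' Q)]) ++ [:: (Up, P); (Down, B')] ++ X).
  by move: f1; rewrite EX -catA.
case/inv_split => lt2 _ tB'; rewrite -catA => f2.
have [m1 m2] : move_rows Z ((Horiz, tmul P B') :: X) /\ move_cols Z ((Horiz, tmul P B') :: X).
  by apply: (low _ _ Q P); rewrite EX EZ ?map_cat ?height_cat ?ups_cat ?downs_cat /=; clear; lia.
have := move_cols_left m1 m2 erefl tA' tQ (tab_tmul _ tP) f2 lt jn; rewrite -/b.
move=> /do_split g; have {g} := g lt tA' tlQ.
rewrite -(tmulA trQ tP tB') catA => /do_split g.
have {g} : FS ((Z ++ [:: (Up, A'); (Down, left_cut b Q)]) ++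
    [:: (Up, tmul (right_cut b Q) P); (Down, B')] ++ X).
  apply: g => //; last exact: tab_tmul.
  by move: lt2; rewrite !pos_cat.
by rewrite EX EZ -!catA.
Qed.

Lemma FS_canonical Z1 V Z2 : FS (Z1 ++ [:: (Horiz, V)] ++ Z2) ->
  let i := (pos Z1).1 in let j := (pos Z1).2.+1 in let a := rect_rows r i j in
  exists X Y, [/\ FS (Z1 ++ [:: (Down, X); (Up, Y)] ++ Z2), (size Y <= a)%N,
    V = tmul (tmul X (T i j)) Y & fits_around a X (T i j) Y].
Proof.
move=> f i j a; have [m1 m2] : move_rows Z1 Z2 /\ move_cols Z1 Z2.
  exact: (@moves_closed _ Z1 Z2 [::] [::] (leqnn _)).
have [X [Y [f' sY EV tV dV]]] := row_canonical_ex m1 m2 f.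
exists X, Y; split=> //; have [tT sT] := FS_rect f'.
have [_ tX tY aX aY] := FS_corner f'.
apply/(row_canonicalP tT sT tX tY sY aX aY); rewrite /row_canonical -EV.
by rewrite -tmul_above.
Qed.

End FactorSequences.

(** * Schur functions as counts of factorizations *)

Local Open Scope classical_set_scope.
Local Open Scope card_scope.
Local Open Scope ring_scope.
Section Enumset.
Variable T : choiceType.
Implicit Types A : set T.

Definition enumset A : seq T := fset_set A.

Lemma enumset_uniq A : uniq (enumset A). Proof. exact: fset_uniq. Qed.

Lemma mem_enumset A x : finite_set A -> (x \in enumset A) <-> A x.
Proof. by move=> fA; rewrite /enumset in_fset_set // inE. Qed.

Lemma finite_sub_seq A (s : seq T) : (forall x, A x -> x \in s) -> finite_set A.
Proof. by move=> h; apply: (sub_finite_set _ (finite_seq s)) => x /h. Qed.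
End Enumset.

Lemma sum_enumset_bij (T1 T2 : choiceType) (V : nmodType) (A : set T1) (C : set T2)
    (f : T1 -> T2) (G : T2 -> V) :
  finite_set A -> finite_set C ->
  (forall x, A x -> C (f x)) -> (forall x y, A x -> A y -> f x = f y -> x = y) ->
  (forall z, C z -> exists2 x, A x & f x = z) ->
  \sum_(x <- enumset A) G (f x) = \sum_(z <- enumset C) G z.
Proof.
move=> fA fC AC inj surj; rewrite -(big_map f predT G); apply: perm_big.
apply: uniq_perm; rewrite ?enumset_uniq //.
  rewrite map_inj_in_uniq ?enumset_uniq // => x y /(mem_enumset _ fA) Ax /(mem_enumset _ fA).
  exact: inj.
move=> z; apply/mapP/idP => [[x /(mem_enumset _ fA) Ax ->]|/(mem_enumset _ fC)/surj[x Ax <-]].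
  by apply/mem_enumset => //; exact: AC.
by exists x => //; apply/mem_enumset.
Qed.

Lemma sum_enumset_pair (T1 T2 T3 : choiceType) (V : nmodType) (A : set T1)
    (B : T1 -> set T2) (C : set T3) (f : T1 -> T2 -> T3) (G : T3 -> V) :
  finite_set A -> (forall x, A x -> finite_set (B x)) -> finite_set C ->
  (forall x y, A x -> B x y -> C (f x y)) ->
  (forall x y x' y', A x -> B x y -> A x' -> B x' y' -> f x y = f x' y' -> x = x' /\ y = y') ->
  (forall z, C z -> exists x y, [/\ A x, B x y & f x y = z]) ->
  \sum_(x <- enumset A) \sum_(y <- enumset (B x)) G (f x y) = \sum_(z <- enumset C) G z.
Proof.
move=> fA fB fC AC inj surj.
have mA x : x \in enumset A -> A x by move/(mem_enumset _ fA).
have mB x y : A x -> y \in enumset (B x) -> B x y by move=> Ax /(mem_enumset _ (fB _ Ax)).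
transitivity (\sum_(z <- [seq f x y | x <- enumset A, y <- enumset (B x)]) G z).
  by rewrite big_allpairs_dep.
apply: perm_big; apply: uniq_perm.
- apply: allpairs_uniq_dep => [|x _|]; rewrite ?enumset_uniq // => -[x y] [x' y'].
  case/allpairsPdep => x1 [y1 [/mA a1 /(mB _ _ a1) b1 [-> ->]]].
  case/allpairsPdep => x2 [y2 [/mA a2 /(mB _ _ a2) b2 [-> ->]]] /= e.
  by have [-> ->] := inj _ _ _ _ a1 b1 a2 b2 e.
- exact: enumset_uniq.
move=> z; apply/allpairsPdep/idP => [[x [y [/mA a /(mB _ _ a) b ->]]]|].
  by apply/mem_enumset => //; exact: AC.
move=> /(mem_enumset _ fC)/surj[x [y [a b <-]]]; exists x, y; split=> //.
  by apply/mem_enumset.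
by apply/mem_enumset => //; exact: fB.
Qed.

(** An injective map of a finite set to itself is a permutation, so the sum equals its own negative;
    the map need not be an involution. *)
Lemma sum_sign_reversing (T : eqType) (V : zmodType) (L : seq T) (R : T -> T -> Prop)
    (F : T -> V) : (forall v : V, v = - v -> v = 0) -> uniq L ->
  (forall x, x \in L -> exists y, [/\ y \in L, R x y & F y = - F x]) ->
  (forall x x' y, x \in L -> x' \in L -> R x y -> R x' y -> x = x') ->
  \sum_(x <- L) F x = 0.
Proof.
move=> tf uL ex inj; apply: tf.
pose f x := if pselect (exists y, [/\ y \in L, R x y & F y = - F x]) is left h
  then projT1 (cid h) else x.
have fP x : x \in L -> [/\ f x \in L, R x (f x) & F (f x) = - F x].
  by move=> /ex h; rewrite /f; case: pselect => // h'; case: cid.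
have p : perm_eq (map f L) L.
  have u : uniq (map f L).
    rewrite map_inj_in_uniq // => x x' xL xL' e; have [_ h1 _] := fP _ xL.
    by have [_ h2 _] := fP _ xL'; apply: inj xL xL' h1 _; rewrite e.
  apply: uniq_perm => //.
  have sb : {subset map f L <= L} by move=> x /mapP[y yL ->]; have [] := fP _ yL.
  have [|_ h] := uniq_min_size u sb; first by rewrite size_map.
  by move=> x; rewrite h.
rewrite -{1}(perm_big _ p) /= big_map -sumrN; apply: eq_big_seq => x xL.
by have [_ _ ->] := fP _ xL.
Qed.

Lemma pairs_finite p (w : seq int) : exists s : seq (diagram * diagram),
  forall B D, [::] \notin B -> size D = p -> perm_eq (entries B ++ entries D) w -> (B, D) \in s.
Proof.
have /choice[U hU] n := diagrams_finite n w.
exists [seq (take j E, drop j E) | j <- iota 0 (size w).+1, E <- U (j + p)%N].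
move=> B D nB sD pw.
have sB : (size B <= size w)%N.
  rewrite -(perm_size pw) size_cat; apply: leq_trans (leq_addr _ _).
  elim: B nB {pw} => //= u B IH; rewrite inE negb_or eq_sym => /andP[nu /IH h].
  by rewrite size_cat; case: u nu => //= x u _; rewrite addSn ltnS (leq_trans h) // leq_addl.
apply/allpairsPdep; exists (size B), (B ++ D); rewrite take_size_cat // drop_size_cat //.
split=> //; first by rewrite mem_iota add0n ltnS.
by apply: hU; [rewrite size_cat sD | rewrite /entries flatten_cat].
Qed.

Definition upd (l : nat) (W : 'I_l -> diagram) (k : 'I_l) (B : diagram) : 'I_l -> diagram :=
  fun k' => if k' == k then B else W k'.

Lemma updE l (W : 'I_l -> diagram) k B : upd W k B k = B.
Proof. by rewrite /upd eqxx. Qed.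

Lemma upd_id l (W : 'I_l -> diagram) k : upd W k (W k) = W.
Proof. by apply: funext => k'; rewrite /upd; case: eqP => // ->. Qed.

Lemma upd_upd l (W : 'I_l -> diagram) k B C : upd (upd W k B) k C = upd W k C.
Proof. by apply: funext => k'; rewrite /upd; case: eqP. Qed.

Lemma upd_comm l (W : 'I_l -> diagram) k k' B C : k != k' ->
  upd (upd W k B) k' C = upd (upd W k' C) k B.
Proof.
move=> kk; apply: funext => k2; rewrite /upd; case: eqP => // ->.
by rewrite eq_sym (negPf kk).
Qed.

Definition row_factors (n : int) (V : diagram) : set (diagram * seq int) :=
  [set x | [/\ tab x.1, sorted lew x.2, (size x.2)%:Z = n & insw false x.1 x.2 = V]].

Lemma perm_row_factors n V x : row_factors n V x -> perm_eq (entries x.1 ++ x.2) (entries V).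
Proof. by case=> _ _ _ <-; rewrite perm_sym /entries; exact: perm_insw. Qed.

Lemma row_factors_finite n V : finite_set (row_factors n V).
Proof.
have [s hs] := pairs_finite 1 (entries V).
apply: (@finite_sub_seq _ _ [seq (x.1, head [::] x.2) | x <- s]) => -[B u] h.
have := perm_row_factors h; case: h => /= tB _ _ _ p.
apply/mapP; exists (B, [:: u]) => //; apply: hs => //; first by case/tablP: tB.
by rewrite /entries /= cats0.
Qed.

Lemma row_factors_neg m V : row_factors (Negz m) V = set0.
Proof. by apply/seteqP; split=> // x []. Qed.

Lemma enumset0 (T : choiceType) : enumset (@set0 T) = [::].
Proof.
by apply/eqP; rewrite -size_eq0 -leqn0 leqNgt; apply/negP; case E : (enumset _) => [|x s] // _;
  have /(mem_enumset _ (@finite_set0 _)) : x \in enumset (@set0 T) by rewrite E inE eqxx.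
Qed.

Lemma enumset1 (T : choiceType) (x : T) : enumset [set x] = [:: x].
Proof.
apply: perm_small_eq => //; apply: uniq_perm; rewrite ?enumset_uniq // => y.
apply/idP/idP => [/(mem_enumset _ (finite_set1 _))->|]; first by rewrite inE eqxx.
by rewrite inE => /eqP->; apply/mem_enumset => //; exact: finite_set1.
Qed.

Lemma row_factors0 V : tab V -> row_factors 0 V = [set (V, [::])].
Proof.
move=> tV; apply/seteqP; split=> [[B u] [/= tB su]|_ ->] /=; last by split.
by case: u su => //= _ _ <-.
Qed.

(** * The functional dual to the Schur tensors *)

Section Functional.
Variable l : nat.
Implicit Types (W : 'I_l -> diagram) (s : seq ('I_l * nat)).

Definition tabs W := forall k, tab (W k).

Lemma tabs_upd W k B : tabs W -> tab B -> tabs (upd W k B).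
Proof. by move=> tW tB k'; rewrite /upd; case: eqP. Qed.

(** The functional on a monomial: the number of ways to strip rows of the given lengths off the
    tableaux, in turn, until all are empty. The generator of index [(k, m)] is h_(m+1), hence
    [x.2.+1]. *)
Fixpoint act s W : int :=
  if s is x :: s' then
    \sum_(Bu <- enumset (row_factors x.2.+1 (W x.1))) act s' (upd W x.1 Bu.1)
  else [forall k, W k == [::]]%:R.

Definition row2_factors (n m : int) (V : diagram) : set (diagram * (seq int * seq int)) :=
  [set x | [/\ tab x.1, sorted lew x.2.1 /\ sorted lew x.2.2, (size x.2.1)%:Z = n,
    (size x.2.2)%:Z = m & insw false x.1 (x.2.1 ++ x.2.2) = V]].

Lemma row2_factors_finite n m V : finite_set (row2_factors n m V).
Proof.
have [s hs] := pairs_finite 2 (entries V).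
apply: (@finite_sub_seq _ _ [seq (x.1, (nth [::] x.2 0, nth [::] x.2 1)) | x <- s]).
move=> [B [v u]] [/= tB _ _ _ E].
apply/mapP; exists (B, [:: v; u]) => //; apply: hs => //; first by case/tablP: tB.
rewrite -E perm_sym /entries /= cats0; exact: perm_insw.
Qed.

Lemma row2_sum (V : nmodType) (G : diagram -> V) n m U :
  \sum_(Bu <- enumset (row_factors m U)) \sum_(Cv <- enumset (row_factors n Bu.1)) G Cv.1 =
  \sum_(x <- enumset (row2_factors n m U)) G x.1.
Proof.
rewrite -(@sum_enumset_pair _ _ _ V (row_factors m U) (fun Bu => row_factors n Bu.1)
  (row2_factors n m U) (fun Bu Cv => (Cv.1, (Cv.2, Bu.2))) (fun x => G x.1)) //.
- exact: row_factors_finite.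
- by move=> *; exact: row_factors_finite.
- exact: row2_factors_finite.
- by move=> [B u] [C v] [/= tB su zu E1] [/= tC sv zv E2]; split=> //=; rewrite insw_cat E2.
- by move=> [B u] [C v] [B' u'] [C' v'] [/= _ _ _ _] [/= _ _ _ E] [/= _ _ _ _] [/= _ _ _ E'] [] e1 e2 e3;
    rewrite -E -E' e1 e2 e3.
- move=> [C [v u]] [/= tC [sv su] zv zu E]; exists (insw false C v, u), (C, v).
  split=> //=; first by split=> //=; [exact: tabl_insw | rewrite -insw_cat].
Qed.

(** Exchanging the lengths of two rows while keeping their product is bijective, by [two_rows_swap]
    and [two_rows_uniq]. This makes [act] independent of the order of the generators in one tensor
    factor. *)
Lemma row2_sum_swap (V : nmodType) (G : diagram -> V) n m U :
  \sum_(x <- enumset (row2_factors n m U)) G x.1 =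
  \sum_(x <- enumset (row2_factors m n U)) G x.1.
Proof.
have /choice[f fP] (x : diagram * (seq int * seq int)) : exists y : diagram * (seq int * seq int),
    sorted lew x.2.1 -> sorted lew x.2.2 ->
    [/\ y.1 = x.1, sorted lew y.2.1 /\ sorted lew y.2.2, size y.2.1 = size x.2.2,
        size y.2.2 = size x.2.1 & Pw (y.2.1 ++ y.2.2) = Pw (x.2.1 ++ x.2.2)].
  case: x => C [v u] /=; have [sv|nv] := boolP (sorted lew v); last by exists (C, (v, u)).
  have [su|nu] := boolP (sorted lew u); last by exists (C, (v, u)).
  have [v' [u' [h1 h2 h3 h4 h5]]] := two_rows_swap sv su.
  by exists (C, (v', u')).
have eG x : row2_factors n m U x -> G x.1 = G (f x).1.
  by case=> _ [h1 h2] _ _ _; have [-> _ _ _ _] := fP x h1 h2.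
have finm := row2_factors_finite n m U; have fimn := row2_factors_finite m n U.
rewrite (eq_big_seq (fun x => G (f x).1)); last by move=> x /(mem_enumset _ finm)/eG.
apply: (sum_enumset_bij (fun x => G x.1)) => //.
- move=> x [tx [h1 h2] zv zu E]; have [e1 [h3 h4] e2 e3 e4] := fP x h1 h2.
  split; rewrite ?e1 ?e2 ?e3 // -E.
  apply: insw_plact; [exact: tabl_sorted | exact: plact_of_P].
- move=> x x' [tx [h1 h2] zv zu E] [tx' [h1' h2'] zv' zu' E'].
  have [e1 [h3 h4] e2 e3 e4] := fP x h1 h2; have [e1' [h3' h4'] e2' e3' e4'] := fP x' h1' h2'.
  move=> e; move: e1' e4'; rewrite -e e1 e4 => e1' /(two_rows_uniq h1 h2 h1' h2').
  have -> : size x.2.1 = size x'.2.1 by apply/eqP; rewrite -eqz_nat zv zv'.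
  case=> // ea eb; case: x x' e1' ea eb {h1 h2 h3 h4 h1' h2' h3' h4' tx tx' zv zv' zu zu' E E' e1 e2 e3 e4 e2' e3' e}.
  by move=> C [v u] [C' [v' u']] /= -> -> ->.
move=> [C [v u]] [/= tC [sv su] zv zu E].
have [v' [u' [h1 h2 h3 h4 h5]]] := two_rows_swap sv su.
exists (C, (v', u')).
  split=> //=; rewrite ?h3 ?h4 // -E; apply: insw_plact; [exact: tabl_sorted | exact: plact_of_P].
have [/= e1 [g3 g4] e2 e3 e4] := fP (C, (v', u')) h1 h2.
case: (f _) e1 g3 g4 e2 e3 e4 => C1 [v1 u1] /= -> g3 g4 e2 e3 e4.
have [|-> ->] // := two_rows_uniq g3 g4 sv su _ (etrans e4 h5).
by rewrite e2 h4.
Qed.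

Lemma act_swap x y s W : act [:: x, y & s] W = act [:: y, x & s] W.
Proof.
case: x y => [k m] [k' m'] /=; have [<-|kk] := eqVneq k k'.
  under eq_bigr do rewrite updE; under [RHS]eq_bigr do rewrite updE.
  under eq_bigr do under eq_bigr do rewrite upd_upd.
  under [RHS]eq_bigr do under eq_bigr do rewrite upd_upd.
  rewrite !(row2_sum (fun C => act s (upd W k C))).
  exact: (row2_sum_swap (fun C => act s (upd W k C))).
have uE B j j' : j != j' -> upd W j B j' = W j'.
  by move=> jj; rewrite /upd eq_sym (negPf jj).
under eq_bigr do rewrite (uE _ k k') //.
under [RHS]eq_bigr do rewrite (uE _ k' k) 1?eq_sym //.
rewrite exchange_big; apply: eq_bigr => Bu _; apply: eq_bigr => Cv _.
by rewrite upd_comm.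
Qed.

Lemma act_perm s s' W : perm_eq s s' -> act s W = act s' W.
Proof.
have mid x p1 p2 U : act (p1 ++ x :: p2) U = act (x :: p1 ++ p2) U.
  elim: p1 U => // y p1 IH U; rewrite [RHS]act_swap /=.
  by apply: eq_bigr => Bu _; exact: IH.
elim: s s' W => [|x s IH] s' W; first by rewrite perm_sym => /perm_nilP->.
move=> p; have : x \in s' by rewrite -(perm_mem p) inE eqxx.
move=> xs; case/splitPr: xs p => p1 p2 p; rewrite mid /=; apply: eq_bigr => Bu _; apply: IH.
by move: p; rewrite perm_sym (perm_catCA p1 [:: x]) /= perm_cons perm_sym.
Qed.

End Functional.

Lemma perm_count (T : eqType) (s t : seq T) :
  (forall x, count_mem x s = count_mem x t) -> perm_eq s t.
Proof. by move=> h; apply/allP => x _ /=; rewrite h. Qed.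

Section Words.
Variable I : choiceType.

Definition wordof (m : {cmonom I}) : seq I := flatten [seq nseq (m i) i | i <- finsupp m].

Lemma count_wordof m x : count_mem x (wordof m) = m x.
Proof.
rewrite /wordof count_flatten -map_comp.
have E (s : seq I) : uniq s ->
    sumn [seq (count_mem x \o (fun i => nseq (m i) i)) i | i <- s] = (if x \in s then m x else 0)%N.
  elim: s => //= i s IH /andP[ni us]; rewrite IH // count_nseq inE eq_sym /=.
  rewrite inE; case: (eqVneq x i) => [->|_] /=; last by rewrite mul0n add0n.
  by rewrite mul1n (negPf ni) addn0.
rewrite E ?fset_uniq //; case: finsuppP => //.
Qed.

Lemma wordof1 : wordof (onecm I) = [::].
Proof.
apply/perm_nilP; apply: perm_count => x; rewrite count_wordof; exact: onecmE.
Qed.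

Lemma wordofM m1 m2 : perm_eq (wordof (mulcm m1 m2)) (wordof m1 ++ wordof m2).
Proof. by apply: perm_count => x; rewrite count_cat !count_wordof; exact: mulcmE. Qed.

Lemma wordof_ucm x : wordof (ucm x) = [:: x].
Proof.
apply: perm_small_eq => //; apply: perm_count => y; rewrite count_wordof ucmE /= addn0 eq_sym.
by [].
Qed.
End Words.

Section Phi.
Variable l : nat.
Implicit Types (W : 'I_l -> diagram) (f g : Sym l).

Definition Phi f W : int := mmap idfun (fun m => act (wordof m) W) f.

Lemma PhiN f W : Phi (- f) W = - Phi f W. Proof. exact: raddfN. Qed.
Lemma Phi0 W : Phi 0 W = 0. Proof. exact: raddf0. Qed.

Lemma Phi_sum (T : Type) (r : seq T) (F : T -> Sym l) W :
  Phi (\sum_(i <- r) F i) W = \sum_(i <- r) Phi (F i) W.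
Proof. exact: raddf_sum. Qed.

Lemma scale_intE (c : int) f : c *: f = f *~ c.
Proof. by rewrite -[c in LHS]intz scaler_int. Qed.

Lemma PhiZ (c : int) f W : Phi (c *: f) W = c * Phi f W.
Proof. by rewrite scale_intE /Phi raddfMz -mulrzl intz. Qed.

Lemma PhiU (c : int) (m : {cmonom ('I_l * nat)%type}) W :
  Phi << c *g m >> W = c * act (wordof m) W.
Proof. exact: mmapU. Qed.

Lemma Phi1 W : Phi 1 W = [forall k, W k == [::]]%:R.
Proof. by rewrite -[1]/(<< 1 *g onecm _ >>) PhiU mul1r wordof1. Qed.

Lemma mulU m1 m2 (c : int) :
  << m1 >> * << c *g m2 >> = << c *g mulcm m1 m2 >> :> Sym l.
Proof. by rewrite -[LHS]/(fgmul _ _) fgmulUU mul1r. Qed.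

Lemma Phi_ucm x f W : Phi (<< ucm x >> * f) W =
  \sum_(Bu <- enumset (row_factors x.2.+1 (W x.1))) Phi f (upd W x.1 Bu.1).
Proof.
rewrite {1}(monalgE f) mulr_sumr Phi_sum.
under [RHS]eq_bigr do rewrite {1}(monalgE f) Phi_sum.
rewrite exchange_big /=; apply: eq_bigr => m _.
rewrite (mulU (ucm x) m f@_m).
apply: etrans (PhiU f@_m (mulcm (ucm x) m) W) _.
transitivity (f@_m * act (x :: wordof m) W).
  congr (_ * _); apply: act_perm.
  by apply: perm_trans (wordofM _ _) _; rewrite wordof_ucm.
rewrite [act _ _]/= mulr_sumr.
apply: eq_bigr => i _.
by apply: esym; exact: (PhiU f@_m m (upd W x.1 i.1)).
Qed.
Lemma Phi_hsym k n f W : tabs W -> Phi (hsym k n * f) W =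
  \sum_(Bu <- enumset (row_factors n (W k))) Phi f (upd W k Bu.1).
Proof.
move=> tW; case: n => [[|n]|n] /=.
- by rewrite mul1r row_factors0 // enumset1 big_seq1 upd_id.
- by rewrite Phi_ucm.
- by rewrite mul0r Phi0 row_factors_neg enumset0 big_nil.
Qed.

Definition rows_factors (al : seq int) (V : diagram) : set (diagram * diagram) :=
  [set x | [/\ tab x.1, all (sorted lew) x.2, [seq (size u)%:Z | u <- x.2] = al
    & insw false x.1 (reading_word x.2) = V]].

Lemma rows_factors_finite al V : finite_set (rows_factors al V).
Proof.
have [s hs] := pairs_finite (size al) (entries V).
apply: (@finite_sub_seq _ _ s) => -[B D] [/= tB sD zD E].
apply: hs; [by case/tablP: tB | by rewrite -zD size_map | ].
rewrite -E perm_sym (permPl (perm_insw _ _ _)) perm_cat2l; exact: perm_reading.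
Qed.

Lemma reading_cons u D : reading_word (u :: D) = reading_word D ++ u.
Proof. by rewrite /reading_word rev_cons flatten_rcons. Qed.

Lemma Phi_hsyms k al f W : tabs W -> Phi ((\prod_(n <- al) hsym k n) * f) W =
  \sum_(x <- enumset (rows_factors al (W k))) Phi f (upd W k x.1).
Proof.
elim: al W => [|n al IH] W tW.
  have -> : rows_factors [::] (W k) = [set (W k, [::])].
    apply/seteqP; split=> [[B D] [/= _ _ zD E]|_ ->]; last by split=> //; exact: tW.
    by case: D zD E => //= _ <-.
  by rewrite enumset1 big_seq1 big_nil mul1r upd_id.
rewrite big_cons -mulrA Phi_hsym //.
rewrite -(@sum_enumset_pair _ _ _ _ (row_factors n (W k)) (fun Bu => rows_factors al Bu.1)
  (rows_factors (n :: al) (W k)) (fun Bu CD => (CD.1, Bu.2 :: CD.2)) (fun x => Phi f (upd W k x.1))).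
- apply: eq_big_seq => Bu /(mem_enumset _ (row_factors_finite _ _))[tB _ _ _].
  rewrite IH; last exact: tabs_upd.
  by rewrite updE; apply: eq_bigr => CD _; rewrite upd_upd.
- exact: row_factors_finite.
- by move=> *; exact: rows_factors_finite.
- exact: rows_factors_finite.
- move=> [B u] [C D] [/= tB su zu E1] [/= tC sD zD E2]; split=> //=; rewrite ?su ?zu ?zD //.
  by rewrite reading_cons insw_cat E2.
- move=> [B u] [C D] [B' u'] [C' D'] [/= _ _ _ _] [/= _ _ _ E] [/= _ _ _ _] [/= _ _ _ E'] [] e1 e2 e3.
  by rewrite -E -E' e1 e2 e3.
move=> [C [|u D]] [//= tC /andP[su sD] [zu zD] E].
exists (insw false C (reading_word D), u), (C, D); split=> //=.
by split=> //=; [exact: tabl_insw | rewrite -insw_cat -reading_cons].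
Qed.

End Phi.

(** The transpose is expanded so that [y] becomes the row index of a diagram; exchanging two rows
    then corresponds to composing [s] with a transposition. *)
Lemma schur_expand l (k : 'I_l) (I : seq int) :
  schur k I = \sum_(s : 'S_(size I)) (-1) ^+ s *
    \prod_(n <- [seq I`_(s y) + y%:Z - (s y)%:Z | y : 'I_(size I)]) hsym k n.
Proof.
rewrite /schur -det_tr /determinant; apply: eq_bigr => s _; congr (_ * _).
rewrite big_map big_enum /=; apply: eq_bigr => y _; rewrite !mxE.
by [].
Qed.

Lemma perm_increasing n (s : 'S_n) :
  (forall y : nat, forall h : (y.+1 < n)%N, (s (Ordinal (ltnW h)) < s (Ordinal h))%N) -> s = 1%g.
Proof.
move=> h; apply/permP => y; rewrite perm1.
have E : [seq val (s z) | z <- enum 'I_n] = [seq val z | z <- enum 'I_n].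
  apply: (irr_sorted_eq ltn_trans ltnn).
  - apply/(sortedP 0%N) => i; rewrite size_map size_enum_ord => hi.
    have o : 'I_n by exact: Ordinal hi.
    have en j (hj : (j < n)%N) : nth 0%N [seq val (s z) | z <- enum 'I_n] j = s (Ordinal hj).
      rewrite (nth_map o) ?size_enum_ord //; congr (val (s _)); apply: val_inj.
      exact: nth_enum_ord.
    by rewrite (en _ (ltnW hi)) (en _ hi); exact: h.
  - by rewrite val_enum_ord iota_ltn_sorted.
  move=> m; apply/mapP/mapP => [[z _ ->]|[z _ ->]].
    by exists (s z); rewrite ?mem_enum.
  by exists (s^-1%g z); rewrite ?mem_enum // permKV.
have := eq_in_map (fun z => val (s z)) val (enum 'I_n).
by case=> _ /(_ E) H; apply: val_inj; apply: H; rewrite mem_enum.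
Qed.

Lemma exchange_all_min D i j : srows D -> violation D i j ->
  exists i0 j0 D', [/\ exchanged i0 j0 D D',
    forall i' j', violation D i' j' -> violation_le i0 j0 i' j' &
    forall i' j', violation D' i' j' -> violation_le i0 j0 i' j'].
Proof.
move=> sD v; have [i0 [j0 [v0 _ m0]]] := @min_violation (fun _ => True) D i j v I.
have [D' X] := exchange_exists sD v0 (@min_first (fun _ => True) _ _ _ I m0).
exists i0, j0, D'.
have [Y h] := exchange_min sD v0 I m0 (exch_rel X).
by split=> // i' j'; [move=> /m0; exact | move=> /h; exact].
Qed.

Definition tab_factors (I : seq nat) (V : diagram) : set (diagram * diagram) :=
  [set x | [/\ tab x.1, tab x.2, shape x.2 = I & tmul x.1 x.2 = V]].

Lemma tab_factors_finite I V : finite_set (tab_factors I V).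
Proof.
apply: sub_finite_set (rows_factors_finite (map Posz I) V) => -[B D] [/= tB tD sD E].
by split=> //=; [exact: tabl_sorted | rewrite -sD -map_comp | rewrite -tmulE].
Qed.

Section JacobiTrudi.
Variables (l : nat) (k : 'I_l) (I : seq nat).
Hypothesis pI : is_partition I.
Let p := size (map Posz I).

Let al (s : 'S_p) : seq int := [seq (map Posz I)`_(s y) + y%:Z - (s y)%:Z | y : 'I_p].

Let size_al s : size (al s) = p. Proof. by rewrite size_map -cardE card_ord. Qed.

Let nth_al s (y : 'I_p) : (al s)`_y = (map Posz I)`_(s y) + y%:Z - (s y)%:Z.
Proof. by rewrite /al (nth_map y) ?size_enum_ord ?ltn_ord // nth_ord_enum. Qed.

Let T : choiceType := ('S_p * (diagram * diagram))%type.
Variables (W : 'I_l -> diagram) (G : diagram -> int).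

Let L : seq T := [seq (s, x) | s <- enum 'S_p, x <- enumset (rows_factors (al s) (W k))].

Let uL : uniq L.
Proof.
apply: allpairs_uniq_dep.
- exact: enum_uniq.
- by move=> s _; exact: enumset_uniq.
- by move=> [s x] [s' x'] _ _ /= [-> ->].
Qed.

Let memL (t : T) : t \in L <-> rows_factors (al t.1) (W k) t.2.
Proof.
case: t => s x; split=> [/allpairsPdep[s' [x' [_ /(mem_enumset _ (rows_factors_finite _ _)) h [-> ->]]]]|h] //.
by apply/allpairsPdep; exists s, x; split; rewrite ?mem_enum //; apply/mem_enumset => //; exact: rows_factors_finite.
Qed.

Let F (t : T) : int := (-1) ^+ t.1 * G t.2.1.

Let good (t : T) : bool := `[< no_violation t.2.2 >].

Let sum_bad : \sum_(t <- L | ~~ good t) F t = 0.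
Proof.
(* The exchange in row [i] alters two row lengths just as the transposition of their indices does.
   The violation used stays minimal, so it can be read off from the image, and [R] is injective. *)
pose R (t t' : T) := exists i j (h : (i < p)%N) (h1 : (i.-1 < p)%N),
  [/\ exchanged i j t.2.2 t'.2.2, t'.2.1 = t.2.1,
   forall i' j', violation t'.2.2 i' j' -> violation_le i j i' j' &
   t'.1 = (tperm (Ordinal h1) (Ordinal h) * t.1)%g].
rewrite -big_filter; apply: (@sum_sign_reversing _ _ _ R).
- by move=> v; lia.
- by rewrite filter_uniq.
- move=> [s [B D]]; rewrite mem_filter => /andP[/asboolPn nv /memL[/= tB sD zD E]].
  have srD : srows D.
    move=> i; case: (ltnP i (size D)) => h; last by rewrite row_of_default.
    exact: (allP sD _ (mem_nth _ h)).
  have [i [j v]] : exists i j, violation D i j.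
    by apply: contrapT => nv'; apply: nv => i j; apply/negP => v; apply: nv'; exists i, j.
  have [i0 [j0 [D' [X m m']]]] := exchange_all_min srD v.
  have szD : size D = p by rewrite -(size_map (fun u => (size u)%:Z)) zD size_al.
  have /andP[i00 h] := violation_size (exch_viol X); rewrite szD in h.
  have h1 : (i0.-1 < p)%N by lia.
  exists ((tperm (Ordinal h1) (Ordinal h) * s)%g, (B, D')).
  have io : (i0.-1 < i0)%N by lia.
  split; last 2 first.
  - by exists i0, j0, h, h1; split.
  - rewrite /F /= odd_permM odd_tperm; have -> : Ordinal h1 != Ordinal h.
      by apply/eqP => /(congr1 val) /=; lia.
    by rewrite signr_addb expr1 mulN1r mulNr.
  rewrite mem_filter; apply/andP; split.
    by apply/asboolPn => nv'; have := nv' i0 j0; rewrite (exchange_violation X).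
  apply/memL; split=> //=.
  - apply/allP => u /(nthP [::])[i' _ <-]; exact: exch_srows X i'.
  - apply: (@eq_from_nth _ 0); first by rewrite size_map size_al (exch_size X).
    move=> y; rewrite size_map (exch_size X) szD => hy.
    have zy (y' : 'I_p) : (size (row_of D y'))%:Z = (al s)`_y'.
      by rewrite -zD (nth_map [::]) // szD.
    rewrite (nth_map [::]) ?(exch_size X) ?szD // -/(row_of _ _).
    rewrite -[y in RHS]/(val (Ordinal hy)) nth_al permM.
    have [yi|yi] := eqVneq y i0.
      have -> : Ordinal hy = Ordinal h by apply: val_inj.
      rewrite tpermR yi (exch_size_down X) -addn1 PoszD (zy (Ordinal h1)) nth_al /=; lia.
    have [yi1|yi1] := eqVneq y i0.-1.
      have -> : Ordinal hy = Ordinal h1 by apply: val_inj.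
      have gt0 : (0 < size (row_of D i0))%N.
        by case/and3P: (exch_viol X) => _ hj _; exact: leq_ltn_trans hj.
      by rewrite tpermL yi1 (exch_size_up X) -subn1 -subzn // (zy (Ordinal h)) nth_al /=; lia.
    rewrite tpermD ?(exch_row X) //; first by rewrite (zy (Ordinal hy)) nth_al.
      by apply: contra yi1 => /eqP/(congr1 val) /= ->.
    by apply: contra yi => /eqP/(congr1 val) /= ->.
  - rewrite -E; apply: insw_plact; first exact: tabl_sorted.
    by apply: plact_of_P; exact: rowprod_exchange X.
move=> [s [B D]] [s' [B' D']] [s2 [B2 D2]] _ _ [i [j [h [h1 [/= X -> m ->]]]]] [i' [j' [h' [h1' [/= X' -> m' es]]]]].
have [ii jj] := violation_le_anti (m _ _ (exchange_violation X')) (m' _ _ (exchange_violation X)).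
move: h' h1' X' es {m'}; rewrite -ii => h' h1' X' es.
have -> : D = D' := exchange_uniq (exchange_sym X) (exchange_sym X').
congr (_, _); move: es; rewrite (bool_irrelevance h' h) (bool_irrelevance h1' h1).
exact: mulgI.
Qed.

Let sum_good : \sum_(t <- L | good t) F t =
  \sum_(x <- enumset (tab_factors I (W k))) G x.1.
Proof.
have nthI (y : nat) : (map Posz I)`_y = (nth 0%N I y)%:Z.
  case: (ltnP y (size I)) => h; first exact: nth_map.
  by rewrite !nth_default ?size_map.
have al1 : al 1%g = map Posz I.
  apply: (@eq_from_nth _ 0); first by rewrite size_al.
  by move=> y; rewrite size_al => hy; rewrite -[y]/(val (Ordinal hy)) nth_al perm1 addrK.
have [sI nI] : (forall x y, (x <= y)%N -> (nth 0%N I y <= nth 0%N I x)%N) /\ 0%N \notin I.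
  case/andP: pI => so ni; split=> // x y xy.
  case: (ltnP y (size I)) => hy; last by rewrite (nth_default _ hy).
  have gt : transitive geq by move=> a b c /= h1 h2; exact: leq_trans h2 h1.
  apply: (sorted_leq_nth gt leqnn 0%N so) => //; rewrite inE //; exact: leq_ltn_trans hy.
have goodP (t : T) : t \in L -> good t -> t.1 = 1%g.
  case: t => s [B D] /memL[/= tB sD zD E] /asboolP/= /no_violation_dom dD.
  have szD : size D = p by rewrite -(size_map (fun u => (size u)%:Z)) zD size_al.
  have zy (y' : 'I_p) : (size (row_of D y'))%:Z = (al s)`_y'.
    by rewrite -zD (nth_map [::]) // szD.
  apply: perm_increasing => y h.
  (* If [s] did not increase at [y], row [y.+1] would be longer than row [y], because [I] is weakly
     decreasing. So [s] is increasing, hence the identity. *)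
  have := dom_size (dD y); rewrite -lez_nat (zy (Ordinal h)) (zy (Ordinal (ltnW h))) !nth_al /=.
  rewrite !nthI => h2; rewrite ltnNge; apply/negP => h3.
  by have := sI _ _ h3; lia.
rewrite big_mkcond /L big_allpairs_dep /= (bigD1_seq 1%g) ?enum_uniq ?mem_enum //=.
rewrite [X in _ + X]big1_seq ?addr0; last first.
  move=> s /andP[s1 _]; apply: big1_seq => x /andP[_ hx].
  case: ifP => // g; case/eqP: s1; apply: (goodP (s, x)) => //.
  by apply/memL; exact/(mem_enumset _ (rows_factors_finite _ _)).
rewrite -big_mkcond /= al1.
have fr := rows_factors_finite (map Posz I) (W k); have ft := tab_factors_finite I (W k).
rewrite -big_filter; under eq_bigr do rewrite /F /= odd_perm1 expr0 mul1r.
apply: perm_big; apply: uniq_perm; rewrite ?filter_uniq ?enumset_uniq // => -[B D].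
rewrite mem_filter; apply/andP/idP.
  case=> /asboolP/= nv /(mem_enumset _ fr)[/= tB sD zD E].
  have shD : shape D = I.
    by apply: (inj_map (f := Posz)) => [x y []//|]; rewrite -zD -map_comp.
  apply/mem_enumset => //; split=> //=; last by rewrite tmulE.
  apply/is_tableauP; split=> //; apply: contra nI => n0; rewrite -shD.
  by apply/mapP; exists [::].
move=> /(mem_enumset _ ft)[/= tB tD shD E]; split.
  by apply/asboolP; apply/no_violation_dom; case/tablP: tD.
apply/mem_enumset => //; split=> //=; first exact: tabl_sorted.
  by rewrite -shD -map_comp.
by rewrite -tmulE.
Qed.

Lemma JT_sum : \sum_(s : 'S_p) (-1) ^+ s *
    \sum_(x <- enumset (rows_factors (al s) (W k))) G x.1 =
  \sum_(x <- enumset (tab_factors I (W k))) G x.1.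
Proof.
have := @bigID int 0 +%R _ L good predT F; rewrite /= sum_bad addr0 sum_good => <-.
rewrite /L big_allpairs_dep /= -(@big_enum _ _ _ _ ('S_p)) /=; apply: eq_bigr => s _.
by rewrite mulr_sumr.
Qed.

End JacobiTrudi.

Lemma Phi_schur l (k : 'I_l) (I : seq nat) f W : is_partition I -> tabs W ->
  Phi (schur k (map Posz I) * f) W =
  \sum_(x <- enumset (tab_factors I (W k))) Phi f (upd W k x.1).
Proof.
move=> pI tW; rewrite -(@JT_sum _ k _ pI W (fun B => Phi f (upd W k B))).
rewrite schur_expand mulr_suml Phi_sum; apply: eq_bigr => s _.
rewrite -(Phi_hsyms k _ f tW) -mulrA.
by case: (odd_perm s); rewrite /= ?expr1 ?expr0 ?mulN1r ?mul1r ?PhiN.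
Qed.

Lemma partition_geq p : is_partition p -> forall x y, (x <= y)%N -> (nth 0%N p y <= nth 0%N p x)%N.
Proof.
case/andP=> so _ x y xy; case: (ltnP y (size p)) => hy; last by rewrite (nth_default _ hy).
have gt : transitive geq by move=> a b c /= h1 h2; exact: leq_trans h2 h1.
apply: (sorted_leq_nth gt leqnn 0%N so) => //; rewrite inE //; exact: leq_ltn_trans hy.
Qed.

Lemma partition_shape T : tab T -> is_partition (shape T).
Proof.
case/tablP=> nT sT dT; apply/andP; split.
  apply/(sortedP 0%N) => i; rewrite size_map => hi.
  rewrite /shape !(nth_map [::]) //; last exact: ltnW.
  by have := dom_size (dT i).
by apply: contra nT => /mapP[u uT /esym/size0nil <-].
Qed.

Lemma tableau_of_shape p : is_partition p -> exists2 T, tab T & shape T = p.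
Proof.
move=> pp; have mono := partition_geq pp; case/andP: pp => _ np.
pose T : diagram := mkseq (fun i => nseq (nth 0%N p i) i%:Z) (size p).
have rT i : row_of T i = nseq (nth 0%N p i) i%:Z.
  case: (ltnP i (size p)) => h; first by rewrite /row_of nth_mkseq.
  by rewrite /row_of [nth 0%N p i]nth_default // nth_default // size_mkseq.
exists T.
  apply/is_tableauP; split.
  - apply: contra np => /mapP[i]; rewrite mem_iota /= => hi e.
    have {e} <- : nth 0%N p i = 0%N by move: e; case: (nth 0%N p i).
    exact: mem_nth.
  - apply/allP => u /mapP[i _ ->]; elim: (nth 0%N p i) => // n IH; case: n IH => //= n ->.
    by rewrite lexx.
  move=> i j; rewrite /violation !rT !size_nseq !nth_nseq.
  case: i => //= i; case: ltnP => //= h; rewrite (leq_trans h (mono _ _ (leqnSn i))) /=.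
  by rewrite ltz_nat ltnSn.
apply: (@eq_from_nth _ 0%N); first by rewrite size_map size_mkseq.
move=> i; rewrite size_map size_mkseq => hi.
by rewrite (nth_map [::]) ?size_mkseq // -/(row_of T i) rT size_nseq.
Qed.

Lemma nth_partition l mu : all is_partition mu -> is_partition (nth [::] mu l).
Proof.
move=> am; case: (ltnP l (size mu)) => h; last by rewrite nth_default.
exact: (allP am) (mem_nth _ h).
Qed.

Section Tensor.
Variable l : nat.
Implicit Types (W : 'I_l -> diagram) (mu : seq (seq nat)).

(** Splitting a tableau of shape mu_k off each [W k] must leave nothing, and the only factorization
    with empty left factor is the trivial one. So [Phi] at [W] extracts the coefficient of the
    tensor labelled by the shapes of [W]. *)
Lemma Phi_tensor mu W : all is_partition mu -> tabs W ->
  Phi (schur_tensor l mu) W = [forall k : 'I_l, shape (W k) == nth [::] mu k]%:R.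
Proof.
move=> am tW; rewrite /schur_tensor -(@big_enum _ _ _ _ ('I_l)) /=.
have H (s : seq 'I_l) V : uniq s -> tabs V ->
    Phi (\prod_(k <- s) schur k (map Posz (nth [::] mu k))) V =
    [forall k, if k \in s then shape (V k) == nth [::] mu k else V k == [::]]%:R.
  elim: s V => [|k s IH] V us tV.
    by rewrite big_nil Phi1; congr (_%:R); apply: eq_forallb.
  case/andP: us => ks us; rewrite big_cons Phi_schur ?nth_partition //.
  set p := nth [::] mu k; have ft := tab_factors_finite p (V k).
  have S x : x \in enumset (tab_factors p (V k)) ->
      Phi (\prod_(k <- s) schur k (map Posz (nth [::] mu k))) (upd V k x.1) =
      ((x == ([::], V k)) && [forall k', if k' \in k :: s then
        shape (V k') == nth [::] mu k' else V k' == [::]])%:R.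
    move=> /(mem_enumset _ ft)[t1 t2 sh E]; rewrite IH //; last exact: tabs_upd.
    congr (nat_of_bool _)%:R; case: x t1 t2 sh E => B D /= tB tD sh E.
    apply/forallP/andP => [h|[/eqP[B0 DE] /forallP h] k'].
      have B0 : B = [::] by have := h k; rewrite (negPf ks) updE => /eqP.
      have DE : D = V k by rewrite -E B0 tmul_nil.
      split; first by rewrite B0 DE.
      apply/forallP => k'; case: (eqVneq k' k) => [->|nk]; first by rewrite inE eqxx /= -DE sh.
      by have := h k'; rewrite inE /upd (negPf nk).
    case: (eqVneq k' k) => [->|nk]; first by rewrite (negPf ks) updE B0.
    by have := h k'; rewrite inE /upd (negPf nk).
  rewrite (eq_big_seq _ S); case: forallP => [h|nh]; last first.
    by rewrite big1 // => x _; rewrite andbF.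
  under eq_bigr do rewrite andbT.
  have m : ([::], V k) \in enumset (tab_factors p (V k)).
    apply/(mem_enumset _ ft); split=> //=; first by have := h k; rewrite inE eqxx => /eqP.
    by rewrite tmul_nil.
  rewrite (bigD1_seq _ m) ?enumset_uniq //= eqxx big1 // => x /negPf-> //.
rewrite H ?enum_uniq //; congr (nat_of_bool _)%:R; apply: eq_forallb => k.
by rewrite mem_enum.
Qed.

Lemma expansion_coef (f : Sym l) d mu W : is_schur_expansion f d -> size mu = l ->
  all is_partition mu -> tabs W -> (forall k, shape (W k) = nth [::] mu k) -> d@_mu = Phi f W.
Proof.
case=> hd -> sm am tW sW; rewrite Phi_sum.
rewrite (eq_big_seq (fun nu => d@_nu * (nu == mu)%:R)); last first.
  move=> nu /hd[sn an]; rewrite PhiZ Phi_tensor //; congr (_ * (nat_of_bool _)%:R).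
  apply/forallP/eqP => [h|-> k]; last by rewrite sW.
  apply: (@eq_from_nth _ [::]); rewrite sn ?sm // => i hi.
  by have /eqP := h (Ordinal hi); rewrite sW.
case: (boolP (mu \in msupp d)) => [mi|ni].
  rewrite (bigD1_seq mu) ?fset_uniq //= eqxx mulr1 big1 ?addr0 // => nu /negPf->.
  by rewrite mulr0.
rewrite mcoeff_outdom // big1_seq // => nu /andP[_ hn].
by case: eqP => [e|_]; [rewrite -e hn in ni | rewrite mulr0].
Qed.

Lemma schur_expansion_uniq (f : Sym l) c c' :
  is_schur_expansion f c -> is_schur_expansion f c' -> c = c'.
Proof.
have out d (hd : is_schur_expansion f d) mu : ~ (size mu = l /\ all is_partition mu) -> d@_mu = 0.
  by move=> h; apply: mcoeff_outdom; apply/negP => /(proj1 hd).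
move=> hc hc'; apply/malgP => mu.
case: (pselect (size mu = l /\ all is_partition mu)) => [[sm am]|h]; last by rewrite !out.
have /choice[W hW] (k : 'I_l) : exists T, tab T /\ shape T = nth [::] mu k.
  by have [T tT sT] := tableau_of_shape (nth_partition k am); exists T.
have tW : tabs W by move=> k; case: (hW k).
have sW k : shape (W k) = nth [::] mu k by case: (hW k).
by rewrite (expansion_coef hc sm am tW sW) (expansion_coef hc' sm am tW sW).
Qed.

Lemma schur_expansionE (f : Sym l) c : is_schur_expansion f c -> schur_expansion f = c.
Proof.
move=> h; rewrite /schur_expansion; case: xgetP => [c' _ h'|/(_ c)//].
exact: schur_expansion_uniq h' h.
Qed.

Definition lin (m : nat) (phi : seq (seq nat) -> Sym m) (c : {malg int[seq (seq nat)]}) : Sym m :=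
  \sum_(mu <- msupp c) c@_mu *: phi mu.

Lemma linE m phi c : @lin m phi c = mmap intr phi c.
Proof. by apply: eq_bigr => mu _; rewrite scale_intE mulrzl. Qed.

Lemma lin_sum m phi (T : Type) (s : seq T) (F : T -> {malg int[seq (seq nat)]}) :
  @lin m phi (\sum_(x <- s) F x) = \sum_(x <- s) lin phi (F x).
Proof. by rewrite linE raddf_sum; apply: eq_bigr => x _; rewrite linE. Qed.

Lemma linU m phi (z : int) mu : @lin m phi << z *g mu >> = z *: phi mu.
Proof. by rewrite linE mmapU scale_intE mulrzl. Qed.

Definition labels (L : seq (seq (seq nat))) := forall mu, mu \in L -> size mu = l /\ all is_partition mu.

Definition formal (L : seq (seq (seq nat))) : {malg int[seq (seq nat)]} := \sum_(mu <- L) << mu >>.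

Lemma is_expansion_formal L : labels L ->
  is_schur_expansion (\sum_(mu <- L) schur_tensor l mu) (formal L).
Proof.
move=> hL; split.
  move=> mu; rewrite -mcoeff_neq0 raddf_sum /= => /negP h; apply: hL; apply/negPn/negP => nm.
  apply: h; rewrite big1_seq // => nu /andP[_ hn]; rewrite mcoeffU; case: eqP => // e.
  by rewrite -e hn in nm.
rewrite -/(lin (schur_tensor l) (formal L)) lin_sum; apply: eq_bigr => mu _.
by rewrite linU scale1r.
Qed.

Lemma schur_coef_formal L mu : labels L ->
  schur_coef (\sum_(mu <- L) schur_tensor l mu) mu = (count_mem mu L)%:Z.
Proof.
move=> hL; rewrite /schur_coef (schur_expansionE (is_expansion_formal hL)) raddf_sum /=.
rewrite (eq_bigr (fun nu => (nu == mu)%:Z)); last by move=> nu _; rewrite mcoeffU; case: eqP.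
by elim: L {hL} => [|nu L IH]; rewrite ?big_nil // big_cons IH.
Qed.

Lemma linear_ext_formal m (phi : seq (seq nat) -> Sym m) L : labels L ->
  linear_ext phi (\sum_(mu <- L) schur_tensor l mu) = \sum_(mu <- L) phi mu.
Proof.
move=> hL; rewrite /linear_ext /schur_coef (schur_expansionE (is_expansion_formal hL)).
rewrite -/(lin phi (formal L)) lin_sum; apply: eq_bigr => mu _.
by rewrite linU scale1r.
Qed.

End Tensor.

(** * Schur functions span the symmetric functions *)

Section Spanned.
Variable l : nat.

Definition spanned (f : Sym l) := exists c, is_schur_expansion f c.

Lemma spannedB f g : spanned f -> spanned g -> spanned (f - g).
Proof.
move=> [c [hc ->]] [d [hd ->]]; exists (c - d); split.
  move=> mu; rewrite -mcoeff_neq0 raddfB /=.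
  case: (boolP (mu \in msupp c)) => [/hc//|nc]; case: (boolP (mu \in msupp d)) => [/hd//|nd].
  by rewrite !mcoeff_outdom // subrr eqxx.
rewrite -!/(lin (schur_tensor l) _) !linE; exact/esym/raddfB.
Qed.

Lemma spanned0 : spanned 0.
Proof. by exists 0; split; rewrite ?msupp0 // big_nil. Qed.

Lemma spannedN f : spanned f -> spanned (- f).
Proof. by move=> h; rewrite -[- f]add0r; exact: spannedB spanned0 h. Qed.

Lemma spannedD f g : spanned f -> spanned g -> spanned (f + g).
Proof. by move=> hf /spannedN hg; rewrite -[g]opprK; exact: spannedB. Qed.

Lemma spanned_sum (T : Type) (s : seq T) (Q : pred T) (F : T -> Sym l) :
  (forall x, Q x -> spanned (F x)) -> spanned (\sum_(x <- s | Q x) F x).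
Proof. by move=> h; apply: (big_ind _ spanned0 spannedD h). Qed.

Lemma spannedZ (z : int) f : spanned f -> spanned (z *: f).
Proof.
move=> h; rewrite scale_intE; case: z => n; rewrite ?NegzE ?mulrNz.
  by rewrite -pmulrn; elim: n => [|n IH]; [exact: spanned0 | rewrite mulrS; exact: spannedD].
by apply: spannedN; rewrite -pmulrn; elim: n => [//|n IH]; rewrite mulrS; exact: spannedD.
Qed.

Lemma spanned_tensor mu : size mu = l -> all is_partition mu -> spanned (schur_tensor l mu).
Proof.
move=> sm am; exists (formal [:: mu]).
have -> : schur_tensor l mu = \sum_(nu <- [:: mu]) schur_tensor l nu by rewrite big_seq1.
by apply: is_expansion_formal => nu; rewrite inE => /eqP ->.
Qed.
End Spanned.

(** Bounds the measure of [spanned_hsyms]: with a fixed sum, the sum of squares cannot grow for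
    ever. *)
Lemma sumn_sq_le (s : seq nat) : (sumn [seq x ^ 2 | x <- s] <= sumn s ^ 2)%N.
Proof.
elim: s => //= x s IH; rewrite sqrnD -addnA leq_add2l.
exact: leq_trans IH (leq_addr _ _).
Qed.

Section Straighten.
Variables (n : nat) (b : nat -> int) (s : 'S_n).
Hypothesis mono : forall x y, (x <= y)%N -> b y <= b x.

(** The partial sums of a weakly decreasing sequence form a concave function, which lies below its
    tangents. *)
Lemma concave_sum x z :
  \sum_(t < z) b t - \sum_(t < x) b t <= b x * (z%:Z - x%:Z).
Proof.
have up d y : \sum_(t < y + d) b t - \sum_(t < y) b t <= b y * d%:Z.
  elim: d => [|d IH]; first by rewrite addn0 subrr mulr0.
  rewrite addnS big_ord_recr /= -addn1 PoszD mulrDr mulr1 addrAC lerD //.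
  by apply: mono; exact: leq_addr.
have dn d y : b (y + d)%N * d%:Z <= \sum_(t < y + d) b t - \sum_(t < y) b t.
  elim: d => [|d IH]; first by rewrite addn0 subrr mulr0.
  rewrite addnS big_ord_recr /=.
  have h : b (y + d).+1 * d.+1%:Z <= b (y + d)%N * d.+1%:Z by rewrite ler_wpM2r // mono.
  by apply: le_trans h _; rewrite -addn1 PoszD mulrDr mulr1 addrAC lerD.
case: (leqP x z) => h; first by have := up (z - x)%N x; rewrite subnKC // -subzn.
have := dn (x - z)%N z; rewrite subnKC ?(ltnW h) // -subzn ?(ltnW h) // => le.
by rewrite -lerN2 opprB -mulrN opprB.
Qed.

Lemma straighten_sum : \sum_(y < n) (b (s y) + y%:Z - (s y)%:Z) = \sum_(y < n) b y.
Proof.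
have e1 : \sum_(y < n) b (s y) = \sum_(y < n) b y by rewrite [RHS](reindex_perm s).
have e2 : \sum_(y < n) (s y)%:Z = \sum_(y < n) y%:Z by rewrite [RHS](reindex_perm s).
by rewrite sumrB big_split /= e1 e2 addrK.
Qed.

(** In the expanded squares, each cross term is at least a difference of partial sums by
    [concave_sum], and these differences cancel over a permutation. The remaining squares of
    [y - s y] are not all zero. *)
Lemma straighten_sq : s != 1%g ->
  \sum_(y < n) b y ^+ 2 < \sum_(y < n) (b (s y) + y%:Z - (s y)%:Z) ^+ 2.
Proof.
move=> s1; have -> : \sum_(y < n) (b (s y) + y%:Z - (s y)%:Z) ^+ 2 =
    \sum_(y < n) b (s y) ^+ 2 + (\sum_(y < n) b (s y) * (y%:Z - (s y)%:Z)) *+ 2 +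
    \sum_(y < n) (y%:Z - (s y)%:Z) ^+ 2.
  rewrite -sumrMnl -!big_split /=; apply: eq_bigr => y _.
  by rewrite -(addrA (b (s y))) (sqrrD (b (s y))).
have -> : \sum_(y < n) b y ^+ 2 = \sum_(y < n) b (s y) ^+ 2 by rewrite [LHS](reindex_perm s).
rewrite -addrA ltrDl.
apply: ltr_wpDl.
  rewrite mulrn_wge0 //.
  have : \sum_(y < n) (\sum_(t < y) b t - \sum_(t < s y) b t) = 0.
    by rewrite sumrB [X in X - _](reindex_perm s) subrr.
  move=> e; rewrite -[X in X <= _]e; apply: ler_sum => y _; exact: concave_sum.
have [y hy] : exists y, s y != y.
  apply/existsP; apply: contraNT s1; rewrite negb_exists => /forallP h.
  by apply/eqP/permP => y; rewrite perm1; have := h y; rewrite negbK => /eqP.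
rewrite (bigD1 y) //=; apply: ltr_pwDl; last by apply: sumr_ge0 => z _; exact: sqr_ge0.
rewrite lt_def sqr_ge0 andbT sqrf_eq0 subr_eq0 eqz_nat.
by apply: contra hy => /eqP h; apply/eqP; exact: val_inj.
Qed.
End Straighten.

Lemma nonneg_nat (s : seq int) : all (fun x => 0 <= x) s -> exists t, s = map Posz t.
Proof.
elim: s => [|x s IH] /=; first by exists [::].
by case: x => // n /IH[t ->]; exists (n :: t).
Qed.

Lemma sumZ (s : seq nat) (F : nat -> nat) :
  (\sum_(x <- s) F x)%N%:Z = \sum_(x <- s) (F x)%:Z.
Proof. exact: (big_morph Posz PoszD). Qed.

(** For a partition, the product of the h's is the diagonal term of the Jacobi-Trudi determinant.
    The other terms either vanish, having a negative index, or have the same index sum and a larger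
    sum of squares, so induction applies. *)
Lemma spanned_hsyms (k : 'I_1) (al : seq nat) : spanned (\prod_(n <- al) hsym k n%:Z).
Proof.
have [N] : exists N, (sumn al ^ 2 < N + sumn [seq x ^ 2 | x <- al])%N.
  by exists (sumn al ^ 2).+1; rewrite addSn ltnS leq_addr.
elim: N al => [|N IH] al hN; first by have := sumn_sq_le al; rewrite leqNgt hN.
(* Zero indices contribute factors 1 and the order is irrelevant, so the indices may be taken to
   form a partition. *)
pose be := sort geq [seq x <- al | x != 0%N].
have be0 (T : Type) (idx : T) (op : Monoid.com_law idx) (F : nat -> T) : F 0%N = idx ->
    \big[op/idx]_(x <- al) F x = \big[op/idx]_(x <- be) F x.
  move=> F0; rewrite [RHS](perm_big [seq x <- al | x != 0%N]) /=; last by rewrite perm_sort.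
  rewrite big_filter [LHS](bigID (fun x => x != 0%N)) /= [X in op _ X]big1 ?Monoid.mulm1 //.
  by move=> x; rewrite negbK => /eqP ->.
have pbe : is_partition be.
  by rewrite /is_partition sort_sorted ?mem_sort ?mem_filter ?eqxx.
have {hN} : (sumn be ^ 2 < N.+1 + sumn [seq (x ^ 2)%N | x <- be])%N.
  move: hN; rewrite !sumnE !big_map (be0 _ _ _ (fun x => x)) //.
  by rewrite (be0 _ _ _ (fun x => (x ^ 2)%N)).
rewrite (be0 _ _ _ (fun n : nat => hsym k n%:Z)) // => hN.
move: be pbe hN {be0}; clear al => al pal hN.
have mono := partition_geq pal.
pose I := map Posz al; pose b x := (nth 0%N al x)%:Z.
have sI : size I = size al by rewrite size_map.
have bI x : I`_x = b x.
  case: (ltnP x (size al)) => h; first by rewrite (nth_map 0%N).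
  by rewrite /b !nth_default ?size_map.
have mb x y : (x <= y)%N -> b y <= b x by rewrite lez_nat; exact: mono.
have bal (F : nat -> int) : \sum_(y < size I) F (nth 0%N al y) = \sum_(x <- al) F x.
  by rewrite sI (big_nth 0%N) big_mkord.
have e := schur_expand k I; rewrite (bigD1 1%g) //= in e.
have e1 : \prod_(n <- [seq I`_((1%g : 'S_(size I)) y) + y%:Z - ((1%g : 'S_(size I)) y)%:Z | y : 'I_(size I)]) hsym k n
    = \prod_(n <- al) hsym k n%:Z.
  rewrite big_map -(big_map Posz predT (fun n => hsym k n)) -/I (big_nth 0) big_mkord big_enum /=.
  by apply: eq_bigr => y _; rewrite perm1 addrK.
rewrite e1 odd_perm1 expr0 mul1r in e.
have -> : \prod_(n <- al) hsym k n%:Z = schur k I - (schur k I - \prod_(n <- al) hsym k n%:Z).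
  by rewrite opprB addrC subrK.
apply: spannedB.
  have -> : schur k I = schur_tensor 1 [:: al].
    by rewrite /schur_tensor big_ord1 /= (ord1 k).
  by apply: spanned_tensor; rewrite //= pal.
rewrite {1}e [X in X - _]addrC addrK; apply: spanned_sum => s s1.
set ga := [seq _ | y : _].
suff H : spanned (\prod_(n <- ga) hsym k n).
  by case: (odd_perm s); rewrite ?expr1 ?expr0 ?mul1r // mulN1r; exact: spannedN.
have [/nonneg_nat[t Et]|/allPn[x xg]] := boolP (all (fun x => 0 <= x) ga); last first.
  case: x xg => // x xg _; rewrite (big_rem _ xg) /= mul0r; exact: spanned0.
rewrite Et big_map; apply: IH; move: hN; rewrite !sumnE !big_map.
have S1 : \sum_(x <- al) x%:Z = \sum_(x <- ga) x.
  rewrite -(bal Posz) /ga big_map big_enum /= -(straighten_sum b s).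
  by apply: eq_bigr => y _; rewrite bI.
have S2 : \sum_(x <- al) x%:Z ^+ 2 < \sum_(x <- ga) x ^+ 2.
  rewrite -(bal (fun x => x%:Z ^+ 2)) /ga big_map big_enum /=.
  apply: lt_le_trans (straighten_sq mb s1) _.
  by rewrite le_eqVlt; apply/orP; left; apply/eqP/eq_bigr => y _; rewrite bI.
move: S1 S2; rewrite Et !big_map -!sumZ => -[->].
have sq u : (\sum_(x <- u) x * x = \sum_(x <- u) x ^ 2)%N by apply: eq_bigr => x _; rewrite mulnn.
by rewrite ltz_nat !sq; clear; lia.
Qed.

Lemma scaleU (K : choiceType) (z : int) (m : K) : << z *g m >> = z *: << m >> :> {malg int[K]}.
Proof. by apply/malgP => m'; rewrite mcoeffZ !mcoeffU mulrnAr mulr1. Qed.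

(** Used for the product of two Schur functions in [lr_coef], for which no explicit expansion is at
    hand; the expansion of a path polynomial is always exhibited. *)
Lemma spanned_Sym1 (f : Sym 1) : spanned f.
Proof.
rewrite (monalgE f); apply: spanned_sum => m _.
rewrite scaleU.
apply: spannedZ.
suff -> : << m >> = \prod_(n <- [seq x.2.+1 | x <- wordof m]) hsym ord0 n%:Z :> Sym 1.
  exact: spanned_hsyms.
rewrite big_map.
have E (s : seq ('I_1 * nat)) :
    \prod_(x <- s) hsym ord0 x.2.+1%:Z = << foldr (fun x => mulcm (ucm x)) (onecm _) s >> :> Sym 1.
  elim: s => [|[k n] s IH]; first by rewrite big_nil.
  rewrite (ord1 k) big_cons IH; exact: mulU.
rewrite E; congr << _ >>; apply/eqP/cmP => x; rewrite -count_wordof.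
elim: (wordof m) => [|y s IH] /=; first by rewrite onecmE.
by rewrite mulcmE ucmE IH.
Qed.

Lemma Sym_torsion_free l (f : Sym l) : f = - f -> f = 0.
Proof.
move=> e; apply/malgP => m; have := congr1 (fun g : Sym l => g@_m) e.
by rewrite raddfN raddf0 /=; lia.
Qed.

(** * Rules for Jacobi-Trudi determinants and for labels *)

Definition schurn l (k : 'I_l) n (I : seq int) : Sym l :=
  \det (\matrix_(x < n, y < n) hsym k (I`_x + y%:Z - x%:Z)).

(** Row [x] of the matrix depends only on the [x]-th index minus [x], so [xshape] exchanges two
    adjacent rows. *)
Lemma schurn_swap l (k : 'I_l) (sh : seq nat) i : (0 < i < size sh)%N -> (0 < nth 0%N sh i)%N ->
  schur k (map Posz (xshape i sh)) = - schur k (map Posz sh).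
Proof.
move=> /andP[i0 ih] gt0; set n := size sh in ih.
have i1h : (i.-1 < n)%N by apply: leq_ltn_trans ih; exact: leq_pred.
have szx : size (xshape i sh) = n.
  by rewrite /xshape size_cat size_take /= size_drop i1h -/n; lia.
have nx j : nth 0%N (xshape i sh) j = if j == i.-1 then (nth 0%N sh i).-1
    else if j == i then (nth 0%N sh i.-1).+1 else nth 0%N sh j.
  rewrite /xshape nth_cat size_take -/n i1h.
  case: (ltnP j i.-1) => h.
    by rewrite nth_take // !ifF //; apply/eqP; lia.
  case: eqVneq => [->|ne1]; first by rewrite subnn.
  case: eqVneq => [->|ne2]; first by have -> : (i - i.-1 = 1)%N by lia.
  have -> : (j - i.-1 = (j - i.+1).+2)%N by lia.
  by rewrite /= nth_drop; congr nth; lia.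
rewrite -![schur _ _]/(schurn k (size _) _) !size_map szx -/n.
pose o := Ordinal ih; pose o1 := Ordinal i1h.
have ne : o1 != o by apply/eqP => /(congr1 val) /=; lia.
pose A : 'M[Sym l]_n := \matrix_(x < n, y < n) hsym k ((map Posz sh)`_x + y%:Z - x%:Z).
rewrite -[schurn k n (map Posz sh)]/(\det A).
suff -> : schurn k n (map Posz (xshape i sh)) = \det (xrow o1 o A).
  by rewrite xrowE det_mulmx det_perm odd_tperm ne expr1 mulN1r.
congr (\det _); apply/matrixP => x y; rewrite !mxE.
have nZ (s : seq nat) j : (map Posz s)`_j = (nth 0%N s j)%:Z.
  by case: (ltnP j (size s)) => h; [rewrite (nth_map 0%N) | rewrite !nth_default ?size_map].
rewrite !nZ nx; congr hsym.
case: eqVneq => [e|n1].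
  have -> : x = o1 by apply: val_inj.
  by rewrite tpermL /=; lia.
case: eqVneq => [e|n2].
  have -> : x = o by apply: val_inj.
  by rewrite tpermR /=; lia.
by rewrite tpermD //; [apply: contra n1 => /eqP<- | apply: contra n2 => /eqP<-].
Qed.

(** The last row of the matrix is zero except for a final 1. *)
Lemma schurn_last l (k : 'I_l) n (I : seq int) : I`_n = 0 -> schurn k n.+1 I = schurn k n I.
Proof.
move=> In; rewrite /schurn (expand_det_row _ ord_max) (bigD1 ord_max) //= big1 ?addr0; last first.
  move=> j jn; rewrite !mxE /= In add0r.
  have jn' : (j < n)%N.
    by have := ltn_ord j; rewrite ltnS leq_eqVlt => /orP[/eqP e|//]; case/eqP: jn; apply: val_inj.
  by rewrite -opprB subzn ?(ltnW jn') //; case: (n - j)%N (subn_gt0 j n) => [|m] //; rewrite ?jn' // ?mul0r.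
rewrite !mxE /= In add0r subrr /= mul1r /cofactor -signr_odd /= oddD addbb expr0 mul1r.
congr (\det _); apply/matrixP => x y; rewrite !mxE.
by congr hsym; rewrite !lift_max.
Qed.

Lemma schur_trailing l (k : 'I_l) (sh : seq nat) z :
  schur k (map Posz (sh ++ nseq z 0%N)) = schur k (map Posz sh).
Proof.
rewrite -![schur _ _]/(schurn k (size _) _) !size_map size_cat size_nseq.
have -> : schurn k (size sh) (map Posz sh) = schurn k (size sh) (map Posz (sh ++ nseq z 0%N)).
  congr (\det _); apply/matrixP => x y; rewrite !mxE; congr (hsym _ (_ + _ - _)).
  by rewrite !(nth_map 0%N) ?size_cat ?ltn_addr // nth_cat ltn_ord.
suff H w : schurn k (size sh + w) (map Posz (sh ++ nseq z 0%N)) =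
    schurn k (size sh) (map Posz (sh ++ nseq z 0%N)) by [].
elim: w => [|w IH]; first by rewrite addn0.
rewrite addnS schurn_last ?IH // map_cat nth_cat size_map ltnNge leq_addr /=.
by rewrite map_nseq nth_nseq; case: ltnP.
Qed.

Section Embed.
Variables (l : nat) (k : 'I_l).

(** Sends h_m to the h_m of the [k]-th tensor factor. Vanishing of s_I, which [schur_nonzero] reads
    in a single factor, is thereby carried over to a label in the tensor power. *)
Definition embed_monom (m : {cmonom ('I_1 * nat)%type}) : Sym l :=
  \prod_(x <- wordof m) << ucm (k, x.2) >>.

Lemma embed_monomM : mmorphism embed_monom.
Proof.
split=> [m1 m2|]; last by rewrite /embed_monom [wordof _]wordof1 big_nil.
by rewrite /embed_monom (perm_big _ (wordofM m1 m2)) big_cat.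
Qed.

HB.instance Definition _ := isMultiplicative.Build _ _ embed_monom embed_monomM.

Definition embed : Sym 1 -> Sym l := mmap (intmul 1 : int -> Sym l) embed_monom.

Lemma embed_hsym k0 n : embed (hsym k0 n) = hsym k n.
Proof.
case: n => [[|n]|n]; [exact: mmap1 | | exact: mmap0].
by rewrite /embed /= mmapU /embed_monom wordof_ucm big_seq1 mul1r.
Qed.

Lemma embed_schur k0 I : embed (schur k0 I) = schur k I.
Proof.
rewrite /schur -[LHS]det_map_mx; congr (\det _); apply/matrixP => x y; rewrite !mxE.
exact: embed_hsym.
Qed.
End Embed.

Section Label.
Variables (m : nat) (mu1 mu2 : seq (seq nat)).
Hypothesis m1 : (size mu1 < m)%N.
Let label (sh : seq nat) : Sym m := schur_tensor m (mu1 ++ sh :: mu2).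

Lemma label_factor : exists (k : 'I_m) (c : Sym m),
  forall sh, label sh = schur k (map Posz sh) * c.
Proof.
pose k := Ordinal m1.
exists k, (\prod_(k' < m | k' != k) schur k' (map Posz (nth [::] (mu1 ++ [::] :: mu2) k'))).
move=> sh; have n1 : nth [::] (mu1 ++ sh :: mu2) k = sh by rewrite nth_cat ltnn subnn.
have n2 (k' : 'I_m) : k' != k ->
    nth [::] (mu1 ++ sh :: mu2) k' = nth [::] (mu1 ++ [::] :: mu2) k'.
  move=> kk; rewrite !nth_cat; case: ltnP => // h.
  case e : (k' - size mu1)%N => //; case/eqP: kk; apply: val_inj; move: e h => /=; lia.
rewrite /label /schur_tensor (bigD1 k isT) n1; apply: (congr2 *%R); first by [].
by apply: eq_bigr => k' kk; rewrite n2.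
Qed.

Lemma label_antisym : antisym label.
Proof.
have [k [c E]] := label_factor; move=> i sh hi h0.
by rewrite !E schurn_swap // mulNr.
Qed.

Lemma label_trailing sh z : label (sh ++ nseq z 0%N) = label sh.
Proof. by have [k [c E]] := label_factor; rewrite !E schur_trailing. Qed.

Lemma label_zero sh : schur_tensor 1 [:: sh] = 0 -> label sh = 0.
Proof.
have [k [c E]] := label_factor; rewrite /schur_tensor big_ord1 /= => h.
by rewrite E -(embed_schur k ord0) h /embed mmap0 mul0r.
Qed.
End Label.

(** * Littlewood-Richardson coefficients as counts of factorizations *)

Definition pairs (V : diagram) : set (diagram * diagram) :=
  [set x | [/\ tab x.1, tab x.2 & tmul x.1 x.2 = V]].

Lemma pairs_finite_set V : finite_set (pairs V).
Proof.
have /choice[U hU] p := pairs_finite p (entries V).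
apply: (@finite_sub_seq _ _ [seq x | p <- iota 0 (size (entries V)).+1, x <- U p]).
move=> [P Q] [tP tQ E]; rewrite /fst /snd in tP tQ E.
have pe : perm_eq (entries P ++ entries Q) (entries V) by rewrite -E perm_sym perm_tmul.
apply/allpairsPdep; exists (size Q), (P, Q); split=> //; last first.
  by apply: hU => //; case/tablP: tP.
rewrite mem_iota add0n ltnS /= -(perm_size pe) size_cat (leq_trans _ (leq_addl _ _)) //.
case/tablP: tQ => nQ _ _; elim: Q nQ {pe E hU} => //= u Q IH.
rewrite inE negb_or eq_sym => /andP[nu /IH h]; rewrite size_cat.
by case: u nu => //= x u _; rewrite addSn ltnS (leq_trans h) // leq_addl.
Qed.

(** The functional at the single tableau [V] extracts the coefficient of its shape; s_tau splits off
    the right factor, and s_sigma tests the shape of what is left. *)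
Lemma lr_coefE V sigma tau : tab V -> is_partition sigma -> is_partition tau ->
  lr_coef (shape V) sigma tau =
  \sum_(x <- enumset (pairs V)) ((shape x.1 == sigma) && (shape x.2 == tau))%:R.
Proof.
move=> tV ps pt; rewrite /lr_coef.
set f := _ * _; have [c hc] := spanned_Sym1 f.
rewrite /schur_coef (schur_expansionE hc).
have tW : tabs (fun _ : 'I_1 => V) by [].
rewrite (@expansion_coef _ _ _ [:: shape V] _ hc _ _ tW) //=; last 2 first.
- by rewrite partition_shape.
- by move=> k; rewrite (ord1 k).
rewrite /f mulrC /schur_tensor big_ord1 Phi_schur //= -/(schur_tensor 1 [:: sigma]).
have fp := pairs_finite_set V; have ft := tab_factors_finite tau V.
transitivity (\sum_(x <- enumset (tab_factors tau V)) (shape x.1 == sigma)%:R : int).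
  apply: eq_big_seq => x /(mem_enumset _ ft)[tx _ _ _].
  rewrite Phi_tensor /= ?ps //; last exact: tabs_upd.
  congr (nat_of_bool _)%:R; apply/forallP/idP => [/(_ ord0)|h k].
    by rewrite updE.
  by rewrite (ord1 k) updE.
rewrite [RHS](eq_bigr (fun x => if shape x.2 == tau then (shape x.1 == sigma)%:R else 0 : int)); last first.
  by move=> x _; case: (shape x.2 == tau); rewrite ?andbT ?andbF.
rewrite -big_mkcond -big_filter; apply: perm_big; apply: uniq_perm.
- exact: enumset_uniq.
- by rewrite filter_uniq // enumset_uniq.
move=> x; rewrite mem_filter; apply/idP/andP.
  by move=> /(mem_enumset _ ft)[t1 t2 /eqP sh E]; split=> //; apply/(mem_enumset _ fp).
by case=> /eqP sh /(mem_enumset _ fp)[t1 t2 E]; apply/(mem_enumset _ ft).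
Qed.

(** Only shapes of factors of [V] have nonzero coefficients, so both sums reduce to the finite lists
    [r1] and [r2]. After exchanging the sums, each factorization leaves one term. *)
Lemma split_valueE m k mu V : tab V -> nth [::] mu k = shape V ->
  split_value m k mu = \sum_(x <- enumset (pairs V))
    schur_tensor m (take k mu ++ shape x.1 :: shape x.2 :: drop k.+1 mu).
Proof.
move=> tV muk; rewrite /split_value muk; set E := enumset (pairs V).
have inE' x : x \in E -> pairs V x by move/(mem_enumset _ (pairs_finite_set V)).
pose F s t := schur_tensor m (take k mu ++ s :: t :: drop k.+1 mu).
pose r1 := undup [seq shape x.1 | x <- E]; pose r2 := undup [seq shape x.2 | x <- E].
have p1 s : s \in r1 -> is_partition s.
  by rewrite mem_undup => /mapP[x /inE'[t1 _ _] ->]; exact: partition_shape.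
have p2 s : s \in r2 -> is_partition s.
  by rewrite mem_undup => /mapP[x /inE'[_ t2 _] ->]; exact: partition_shape.
have m1 x : x \in E -> shape x.1 \in r1 by move=> xE; rewrite mem_undup; apply/mapP; exists x.
have m2 x : x \in E -> shape x.2 \in r2 by move=> xE; rewrite mem_undup; apply/mapP; exists x.
have z1 s t : is_partition s -> is_partition t -> s \notin r1 -> lr_coef (shape V) s t = 0.
  move=> ps pt ns; rewrite lr_coefE // big1_seq // => x /andP[_ xE].
  by case: eqP => //= e; rewrite -e m1 in ns.
have z2 s t : is_partition s -> is_partition t -> t \notin r2 -> lr_coef (shape V) s t = 0.
  move=> ps pt ns; rewrite lr_coefE // big1_seq // => x /andP[_ xE].
  by rewrite andbC; case: eqP => //= e; rewrite -e m2 in ns.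
rewrite (@fsbigE _ _ _ _ _ r1) ?undup_uniq //; last first.
- by move=> s ps ns; rewrite fsbig1 // => t pt; rewrite z1 // scale0r.
transitivity (\sum_(s <- r1) \sum_(t <- r2) \sum_(x <- E)
    if (shape x.1 == s) && (shape x.2 == t) then F s t else 0).
  rewrite big_seq_cond [RHS]big_seq_cond; apply: eq_big => [s|s].
    by case: (boolP (s \in r1)) => //= /p1 ps; rewrite mem_set.
  move=> /andP[sr _]; have ps := p1 s sr.
  rewrite (@fsbigE _ _ _ _ _ r2) ?undup_uniq //; last first.
  - by move=> t pt nt; rewrite z2 // scale0r.
  rewrite big_seq_cond [RHS]big_seq_cond; apply: eq_big => [t|t].
    by case: (boolP (t \in r2)) => //= /p2 pt; rewrite mem_set.
  move=> /andP[tr _]; have pt := p2 t tr.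
  rewrite lr_coefE // scaler_suml; apply: eq_bigr => x _.
  by case: andb; rewrite ?scale1r ?scale0r.
under eq_bigr do rewrite exchange_big.
rewrite exchange_big; apply: eq_big_seq => x xE /=.
rewrite (bigD1_seq (shape x.1)) ?undup_uniq ?m1 //=.
rewrite [X in _ + X]big1 ?addr0; last first.
  by move=> s ne; rewrite big1 // => t _; rewrite eq_sym (negPf ne).
rewrite (bigD1_seq (shape x.2)) ?undup_uniq ?m2 //= !eqxx /=.
rewrite big1 ?addr0 // => t ne; by rewrite eq_sym (negPf ne).
Qed.

(** * The sum over factor sequences *)

Lemma nth_eq_pad (p sh : seq nat) : (forall i, nth 0%N p i = nth 0%N sh i) -> 0%N \notin p ->
  exists z, sh = p ++ nseq z 0%N.
Proof.
move=> h np; exists (size sh - size p)%N.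
have le : (size p <= size sh)%N.
  rewrite leqNgt; apply: contra np => lt; rewrite -[0%N](nth_default 0%N (leqnn (size sh))).
  by rewrite -h; exact: mem_nth.
apply: (@eq_from_nth _ 0%N); first by rewrite size_cat size_nseq subnKC.
move=> i _; rewrite nth_cat -h nth_nseq if_same; case: ltnP => // hi; exact: nth_default.
Qed.

Lemma size_split (A B : Type) (W : seq A) (g1 : seq B) m : size W = (size g1 + m.+1)%N ->
  exists W1 x W2, [/\ W = W1 ++ x :: W2, size W1 = size g1 & size W2 = m].
Proof.
move=> sW; case e : (drop (size g1) W) => [|x W2].
  by have := congr1 size e; rewrite size_drop sW /=; lia.
exists (take (size g1) W), x, W2; rewrite -e cat_take_drop size_takel ?sW ?leq_addr //.
by split=> //; have := congr1 size e; rewrite size_drop sW /=; lia.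
Qed.

Lemma drop_cat1 (A : Type) (s t : seq A) x : drop (size s).+1 (s ++ x :: t) = t.
Proof. by elim: s => [|y s IH] //=; rewrite drop0. Qed.

Lemma drop_cat2 (A : Type) (s t : seq A) x y : drop (size s).+2 (s ++ x :: y :: t) = t.
Proof. by elim: s => [|z s IH] //=; rewrite drop0. Qed.

Section Facs.
Variables (n : nat) (r : nat -> nat -> nat) (T : nat -> nat -> diagram).
Hypothesis hr : rank_conditions n r.
Hypothesis hT : tableau_diagram n r T.

Definition facs (g : seq step) : set (seq diagram) := [set W | factor_seq n T g W].

Lemma facs_size g W : facs g W -> size W = size g.
Proof. by case/factor_FS. Qed.

Lemma facs_tab g W : facs g W -> forall V, V \in W -> tab V.
Proof.
case/factor_FS => sz /(FS_okl hT)[_]; elim: W g sz (0, 0)%N => // V W IH [|s g] //= [sz] v.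
by case=> [[tV _] /(IH _ sz) h] U; rewrite inE => /orP[/eqP->|/h].
Qed.

Lemma facs_FS g1 g2 h W1 W2 H : size W1 = size g1 -> size h = size H ->
  factor_seq n T (g1 ++ h ++ g2) (W1 ++ H ++ W2) -> FS n T (zip g1 W1 ++ zip h H ++ zip g2 W2).
Proof. by move=> s1 s2 /factor_FS[_]; rewrite !zip_cat. Qed.

Lemma FS_facs g1 g2 h W1 W2 H : size W1 = size g1 -> size h = size H -> size W2 = size g2 ->
  FS n T (zip g1 W1 ++ zip h H ++ zip g2 W2) -> factor_seq n T (g1 ++ h ++ g2) (W1 ++ H ++ W2).
Proof.
move=> s1 sh s2 /FS_factor; rewrite -!zip_cat // -/(unzip1 _) -/(unzip2 _).
by rewrite unzip1_zip ?unzip2_zip // !size_cat s1 sh s2.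
Qed.

Lemma pos_zip g1 (W1 : seq diagram) : size W1 = size g1 -> pos (zip g1 W1) = endpoint g1.
Proof. by move=> s1; rewrite /pos -/(unzip1 _) unzip1_zip ?s1. Qed.

Lemma facs_lowest : facs (lowest_path n) = [set nseq (size (lowest_path n)) [::]].
Proof.
apply/seteqP; split=> [W /factor_FS[sz]|_ ->]; last exact: factor_lowest.
move E : (zip (lowest_path n) W) => Z f; case: f E => [E|Z1 L B Z2 ru _ E].
  have := congr1 unzip2 E; rewrite unzip2_zip ?sz // => ->.
  by elim: (lowest_path n) => [|s g IH] //=; congr (_ :: _); exact: IH.
have := height_peak (map fst Z1) (map fst Z2) (rule_peak ru); rewrite -!map_cat -E.
by rewrite -/(unzip1 _) unzip1_zip ?sz // height_lowest.
Qed.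

Lemma facs_corner g1 g2 W1 X Y W2 : size W1 = size g1 ->
  facs (g1 ++ Down :: Up :: g2) (W1 ++ X :: Y :: W2) ->
  let i := (endpoint g1).1 in let j := (endpoint g1).2.+1 in
  [/\ tab X, tab Y, entries_above (T i j) X & entries_above (T i j) Y].
Proof.
move=> s1 f i j; have := facs_FS (h := [:: Down; Up]) (H := [:: X; Y]) s1 erefl f.
by case/(FS_corner hT); rewrite pos_zip.
Qed.

Lemma facs_rect g1 g2 W1 X Y W2 : size W1 = size g1 ->
  facs (g1 ++ Down :: Up :: g2) (W1 ++ X :: Y :: W2) ->
  let i := (endpoint g1).1 in let j := (endpoint g1).2.+1 in
  tab (T i j) /\ shape (T i j) =
    [seq m <- nseq (rect_rows r i j) (rect_cols r i j) | m != 0%N].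
Proof.
move=> s1 f i j; have := facs_FS (h := [:: Down; Up]) (H := [:: X; Y]) s1 erefl f.
by case/(FS_rect hT); rewrite pos_zip.
Qed.

Lemma facs_split_inv g1 g2 W : facs (g1 ++ Up :: Down :: g2) W ->
  exists W1 P Q W2, [/\ W = W1 ++ P :: Q :: W2, size W1 = size g1, tab P, tab Q &
    facs (g1 ++ Horiz :: g2) (W1 ++ tmul P Q :: W2)].
Proof.
move=> f; have sz := facs_size f; rewrite size_cat in sz.
have [W1 [P [W' [EW s1 s']]]] := size_split sz.
case: W' s' EW => // Q W2 [s2] EW; exists W1, P, Q, W2; rewrite EW in f *.
have [] := inv_split (facs_FS (h := [:: Up; Down]) (H := [:: P; Q]) s1 erefl f).
move=> _ tP tQ f'; split=> //.
exact: (FS_facs (h := [:: Horiz]) (H := [:: tmul P Q]) s1 erefl s2 f').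
Qed.

Lemma facs_merge_inv g1 g2 W : facs (g1 ++ Horiz :: g2) W ->
  let i := (endpoint g1).1 in let j := (endpoint g1).2.+1 in
  exists W1 X Y W2, [/\ W = W1 ++ tmul (tmul X (T i j)) Y :: W2, size W1 = size g1,
    (size Y <= rect_rows r i j)%N, fits_around (rect_rows r i j) X (T i j) Y &
    facs (g1 ++ Down :: Up :: g2) (W1 ++ X :: Y :: W2)].
Proof.
move=> f i j; have sz := facs_size f; rewrite size_cat in sz.
have [W1 [V [W2 [EW s1 s2]]]] := size_split sz; rewrite EW in f *.
have [X [Y []]] := FS_canonical hr hT (facs_FS (h := [:: Horiz]) (H := [:: V]) s1 erefl f).
rewrite pos_zip // -/i -/j => f' sY -> fit; exists W1, X, Y, W2; split=> //.
exact: (FS_facs (h := [:: Down; Up]) (H := [:: X; Y]) s1 erefl s2 f').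
Qed.

Lemma facs_two g1 g2 s t W : facs (g1 ++ s :: t :: g2) W ->
  exists W1 P Q W2, [/\ W = W1 ++ P :: Q :: W2, size W1 = size g1 & size W2 = size g2].
Proof.
move=> f; have sz := facs_size f; rewrite size_cat in sz.
have [W1 [P [W' [EW s1 s']]]] := size_split sz.
by case: W' s' EW => // Q W2 [s2] EW; exists W1, P, Q, W2.
Qed.

Lemma facs_one g1 g2 s W : facs (g1 ++ s :: g2) W ->
  exists W1 P W2, [/\ W = W1 ++ P :: W2, size W1 = size g1 & size W2 = size g2].
Proof.
move=> f; have sz := facs_size f; rewrite size_cat in sz.
by have [W1 [P [W' [EW s1 s']]]] := size_split sz; exists W1, P, W'.
Qed.

(** The induction statement along paths. Finiteness is part of it because [enumset] enumerates only
    finite sets faithfully. *)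
Definition expansion g (P : Sym (size g)) := finite_set (facs g) /\
  P = \sum_(W <- enumset (facs g)) schur_tensor (size g) (map shape W).

Lemma facs_labels g : finite_set (facs g) ->
  labels (size g) (map (map shape) (enumset (facs g))).
Proof.
move=> fin mu /mapP[W /(mem_enumset _ fin) f ->]; rewrite size_map (facs_size f); split=> //.
by apply/allP => p /mapP[V VW ->]; apply: partition_shape; exact: facs_tab f _ VW.
Qed.

Lemma linear_ext_facs g m (phi : seq (seq nat) -> Sym m) P : @expansion g P ->
  linear_ext phi P = \sum_(W <- enumset (facs g)) phi (map shape W).
Proof.
move=> [fin ->]; rewrite -(big_map (map shape) predT (schur_tensor (size g))).
by rewrite linear_ext_formal ?big_map //; exact: facs_labels.
Qed.

Lemma expansion_lowest : @expansion (lowest_path n) 1.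
Proof.
rewrite /expansion facs_lowest enumset1 big_seq1; split; first exact: finite_set1.
rewrite /schur_tensor big1 // => k _.
have -> : nth [::] (map shape (nseq (size (lowest_path n)) ([::] : diagram))) k = [::].
  by rewrite map_nseq nth_nseq if_same.
by rewrite /schur det_mx00.
Qed.

(** The pair of a lower factor sequence and a factorization of its tableau on the horizontal step is
    determined by the resulting sequence, since the product gives the tableau back. So the double
    sum runs over the new factor sequences once each. *)
Lemma expansion_split g1 g2 P : ((endpoint g1).1 < (endpoint g1).2)%N ->
  @expansion (g1 ++ Horiz :: g2) P ->
  @expansion (g1 ++ Up :: Down :: g2) (linear_ext (split_value _ (size g1)) P).
Proof.
move=> lt ex; have [fin _] := ex; rewrite /expansion (linear_ext_facs _ ex).
set k := size g1; set g := g1 ++ Up :: Down :: g2; set g' := g1 ++ Horiz :: g2 in ex fin *.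
pose h (V : seq diagram) (x : diagram * diagram) := take k V ++ x.1 :: x.2 :: drop k.+1 V.
pose Bf (V : seq diagram) := pairs (nth [::] V k).
have hE W1 A W2 x : size W1 = k -> h (W1 ++ A :: W2) x = W1 ++ x.1 :: x.2 :: W2.
  by move=> s1; rewrite /h -s1 take_size_cat // drop_cat1.
have nE W1 A W2 : size W1 = k -> nth [::] (W1 ++ A :: W2) k = A :> diagram.
  by move=> <-; rewrite nth_cat ltnn subnn.
have hin V x : facs g' V -> Bf V x -> facs g (h V x).
  move=> f; have [W1 [A [W2 [EV s1 s2]]]] := facs_one f; rewrite /Bf EV nE // hE // => -[t1 t2 EA].
  apply: factor_split => //; [exact/is_tableauP | exact/is_tableauP | ].
  by rewrite EA -EV.
have surj W : facs g W -> exists V x, [/\ facs g' V, Bf V x & h V x = W].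
  case/facs_split_inv => W1 [A [Q [W2 [-> s1 tA tQ f]]]].
  by exists (W1 ++ tmul A Q :: W2), (A, Q); rewrite hE // /Bf nE.
have fB V : finite_set (Bf V) by exact: pairs_finite_set.
have fin' : finite_set (facs g).
  apply: (@finite_sub_seq _ _ [seq h V x | V <- enumset (facs g'), x <- enumset (Bf V)]).
  move=> W /surj[V [x [f b <-]]]; apply/allpairsPdep; exists V, x.
  by split=> //; apply/mem_enumset.
split=> //.
transitivity (\sum_(V <- enumset (facs g')) \sum_(x <- enumset (Bf V))
    schur_tensor (size g) (map shape (h V x))).
  apply: eq_big_seq => V /(mem_enumset _ fin) f.
  have [W1 [A [W2 [EV s1 s2]]]] := facs_one f.
  have tA : tab A by apply: (facs_tab f); rewrite EV mem_cat inE eqxx orbT.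
  have kE : k = size (map shape W1) by rewrite size_map.
  have muE : map shape V = map shape W1 ++ shape A :: map shape W2 by rewrite EV map_cat.
  rewrite (@split_valueE _ _ _ A) //; last by rewrite muE kE nth_cat ltnn subnn.
  rewrite /Bf EV nE //; apply: eq_bigr => x _; congr (schur_tensor _ _).
  by rewrite hE // !map_cat /= kE take_size_cat // drop_cat1.
apply: (@sum_enumset_pair _ _ _ _ (facs g') Bf (facs g) h
  (fun W => schur_tensor (size g) (map shape W))) => //.
move=> V x V' x' /facs_one[W1 [A [W2 [EV s1 s2]]]] + /facs_one[W1' [A' [W2' [EV' s1' s2']]]].
rewrite /Bf EV EV' !nE // !hE // => -[_ _ <-] [_ _ <-] /eqP.
rewrite eqseq_cat ?s1 ?s1' // => /andP[/eqP -> /eqP[]].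
by case: x => [x1 x2]; case: x' => [x1' x2'] /= -> -> ->.
Qed.
Lemma nth_shape (D : diagram) i : nth 0%N (shape D) i = size (row_of D i).
Proof.
case: (ltnP i (size D)) => h; first by rewrite (nth_map [::]).
by rewrite /row_of !nth_default ?size_map.
Qed.

Lemma merge_label (a b : nat) (R X Y : diagram) :
  shape R = [seq m <- nseq a b | m != 0%N] ->
  mkseq (fun x => b + nth 0 (shape Y) x)%N a ++ shape X = shape (around a X R Y).
Proof.
move=> sR; rewrite /around /shape map_cat; congr (_ ++ _).
rewrite /mkseq -map_comp; apply/eq_in_map => x; rewrite mem_iota /= add0n => hx.
by rewrite size_cat (rect_row sR) hx -/(shape Y) nth_shape.
Qed.

Lemma row_of_merged (a b : nat) (R X Y : diagram) : tab R ->
  shape R = [seq m <- nseq a b | m != 0%N] -> tab X -> tab Y -> (size Y <= a)%N ->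
  entries_above R X -> entries_above R Y -> fits_around a X R Y ->
  let V := tmul (tmul X R) Y in
  [/\ forall i, row_of V i = row_of (around a X R Y) i, drop a V = X & take a V = join R Y].
Proof.
move=> tR sR tX tY sY aX aY /(row_canonicalP tR sR tX tY sY aX aY)[tk dr] V.
split=> // i; rewrite row_of_around; case: ltnP => h.
  by rewrite -row_of_join -tk /row_of nth_take.
by rewrite -[X in RHS]dr /row_of nth_drop subnKC.
Qed.

(** [h] is a bijection from the sequences with a fitting pair at the corner to the factor sequences
    of the higher path: onto by [facs_merge_inv], injective because the product displays the pair.
    The other terms cancel under Fomin's map. *)
Lemma expansion_merge g1 g2 P : let i := (endpoint g1).1 in let j := (endpoint g1).2.+1 in
  let a := rect_rows r i j in let b := rect_cols r i j in
  (forall W1 W2 X Y, size W1 = size g1 -> facs (g1 ++ Down :: Up :: g2) (W1 ++ X :: Y :: W2) ->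
    (size Y <= a)%N -> entries_above (T i j) X -> entries_above (T i j) Y ->
    ~ fits_around a X (T i j) Y -> schur_nonzero (around a X (T i j) Y) ->
    forall X' Y', fomin_around a b X Y X' Y' ->
      facs (g1 ++ Down :: Up :: g2) (W1 ++ X' :: Y' :: W2)) ->
  @expansion (g1 ++ Down :: Up :: g2) P ->
  @expansion (g1 ++ Horiz :: g2) (linear_ext (merge_value _ a b (size g1)) P).
Proof.
move=> i j a b hf ex; have [fin _] := ex; rewrite /expansion (linear_ext_facs _ ex).
set k := size g1; set g := g1 ++ Horiz :: g2; set g' := g1 ++ Down :: Up :: g2 in hf ex fin *.
pose R := T i j; pose X V : diagram := nth [::] V k; pose Y V : diagram := nth [::] V k.+1.
pose h (V : seq diagram) := take k V ++ tmul (tmul (X V) R) (Y V) :: drop k.+2 V.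
pose lab mu1 mu2 sh : Sym (size g) := schur_tensor (size g) (mu1 ++ sh :: mu2).
pose F V := lab (map shape (take k V)) (map shape (drop k.+2 V)) (shape (around a (X V) R (Y V))).
have XE W1 A C W2 : size W1 = k -> X (W1 ++ A :: C :: W2) = A.
  by move=> e; rewrite /X -e nth_cat ltnn subnn.
have YE W1 A C W2 : size W1 = k -> Y (W1 ++ A :: C :: W2) = C.
  by move=> e; rewrite /Y -e nth_cat ltnNge leqnSn subSnn.
have hE W1 A C W2 : size W1 = k -> h (W1 ++ A :: C :: W2) = W1 ++ tmul (tmul A R) C :: W2.
  by move=> s1; rewrite /h XE // YE // -s1 take_size_cat // drop_cat2.
have FE W1 A C W2 : size W1 = k ->
    F (W1 ++ A :: C :: W2) = lab (map shape W1) (map shape W2) (shape (around a A R C)).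
  by move=> s1; rewrite /F XE // YE // -s1 take_size_cat // drop_cat2.
have kg W1 : size W1 = k -> (size (map shape W1) < size g)%N.
  by move=> s1; rewrite size_map s1 /g size_cat /= -addSnnS leq_addr.
have mergeE V : facs g' V ->
    merge_value (size g) a b k (map shape V) = if (size (Y V) <= a)%N then F V else 0.
  move=> f; have [W1 [A [C [W2 [EV s1 s2]]]]] := facs_two f; rewrite EV in f *.
  have [tR sR] := facs_rect s1 f; rewrite -/i -/j -/a -/b -/R in tR sR.
  have kE : k = size (map shape W1) by rewrite size_map.
  rewrite YE // FE // /merge_value map_cat /= kE.
  rewrite !nth_cat ltnn subnn ltnNge leqnSn subSnn /= take_size_cat // drop_cat2.
  by rewrite size_map (merge_label _ _ sR).
pose fit V := `[< fits_around a (X V) R (Y V) >].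
pose A := [set V | [/\ facs g' V, (size (Y V) <= a)%N & fit V]].
have finA : finite_set A by apply: sub_finite_set fin => V [].
have hin V : A V -> facs g (h V).
  move=> [f _ _]; have [W1 [C [D [W2 [EV s1 s2]]]]] := facs_two f; rewrite EV hE // in f *.
  exact: factor_merge.
have surj W : facs g W -> exists2 V, A V & h V = W.
  case/facs_merge_inv => W1 [C [D [W2 [-> s1 sD ft f]]]].
  exists (W1 ++ C :: D :: W2); last by rewrite hE.
  by split; rewrite ?/fit ?XE ?YE //; apply/asboolP.
have fin' : finite_set (facs g).
  apply: (@finite_sub_seq _ _ (map h (enumset A))) => W /surj[V AV <-].
  by apply/mapP; exists V => //; apply/mem_enumset.
have prep V : A V -> exists W1 C D W2, [/\ V = W1 ++ C :: D :: W2, size W1 = k,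
    tab R & shape R = [seq m <- nseq a b | m != 0%N]] /\
    [/\ tab C, tab D, (size D <= a)%N, entries_above R C /\ entries_above R D
      & fits_around a C R D].
  move=> [f sz ft]; have [W1 [C [D [W2 [EV s1 s2]]]]] := facs_two f; rewrite EV in f sz ft.
  rewrite YE // in sz; move/asboolP: ft; rewrite XE // YE // => ft.
  have [tR sR] := facs_rect s1 f; have [tC tD aC aD] := facs_corner s1 f.
  by exists W1, C, D, W2.
split=> //.
transitivity (\sum_(V <- enumset (facs g')) if (size (Y V) <= a)%N then F V else 0).
  by apply: eq_big_seq => V /(mem_enumset _ fin); exact: mergeE.
rewrite -big_mkcond (bigID fit) /= [X in _ + X](_ : _ = 0) ?addr0; last first.
  (* Vanishing terms are set aside first: closure under Fomin's map is assumed only for nonzero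
     [S(X, T, Y)]. *)
  rewrite -big_filter (bigID (fun V => F V != 0)) /= [X in _ + X]big1 ?addr0; last first.
    by move=> V; rewrite negbK => /eqP.
  rewrite -big_filter; set L := filter _ _.
  have memL V : V \in L <-> [/\ facs g' V, (size (Y V) <= a)%N, ~~ fit V & F V != 0].
    rewrite !mem_filter; split=> [/andP[nz /andP[/andP[sz nf] /(mem_enumset _ fin) f]] //|[f sz nf nz]].
    by rewrite nz sz nf; apply/mem_enumset.
  pose Q V V' := exists W1 C D C' D' W2, [/\ size W1 = k, V = W1 ++ C :: D :: W2,
    V' = W1 ++ C' :: D' :: W2, bad a R C D & fomin_image a b C D C' D'].
  have badP V : V \in L -> exists W1 C D W2, [/\ V = W1 ++ C :: D :: W2, size W1 = k,
      tab R, shape R = [seq m <- nseq a b | m != 0%N] & bad a R C D].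
    move=> /memL[f sz nf _]; have [W1 [C [D [W2 [EV s1 s2]]]]] := facs_two f; rewrite EV in f sz nf.
    rewrite YE // in sz; move/asboolP: nf; rewrite XE // YE // => nf.
    have [tR sR] := facs_rect s1 f; have [tC tD aC aD] := facs_corner s1 f.
    by exists W1, C, D, W2; split.
  apply: (@sum_sign_reversing _ _ _ Q).
  - exact: Sym_torsion_free.
  - by rewrite !filter_uniq // enumset_uniq.
  - move=> V VL; have [W1 [C [D [W2 [EV s1 tR sR bCD]]]]] := badP V VL.
    have [C' [D' im]] := fomin_image_exists tR sR bCD.
    have [fa tC' tD' sD'] := fomin_image_around tR sR bCD im.
    have /memL[f _ _ nz] := VL; rewrite EV FE // in nz; rewrite EV in f.
    have [tC tD sD [aC aD] nft] := bCD.
    have f' : facs g' (W1 ++ C' :: D' :: W2).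
      apply: (hf _ _ C D) => //.
      by apply: contra nz => /eqP z; rewrite /lab label_zero ?kg.
    have [_ _ aC' aD'] := facs_corner s1 f'.
    have sg : F (W1 ++ C' :: D' :: W2) = - F (W1 ++ C :: D :: W2).
      by rewrite !FE //; apply: (fomin_image_sign tR sR _ bCD im); apply: label_antisym; exact: kg.
    exists (W1 ++ C' :: D' :: W2); split.
    + apply/memL; split=> //; first by rewrite YE.
        apply/asboolPn; rewrite XE // YE //; exact: (fomin_image_not_fits tR sR bCD im aC' aD').
      by rewrite sg oppr_eq0 FE.
    + by exists W1, C, D, C', D', W2.
    by rewrite EV.
  move=> V V' U VL _ [W1 [C [D [C1 [D1 [W2 [s1 EV EU bd im]]]]]]].
  move=> [W1' [C' [D' [C1' [D1' [W2' [s1' EV' EU' bd' im']]]]]]].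
  have [W0 [_ [_ [_ [_ _ tR sR _]]]]] := badP V VL.
  move: EU; rewrite EU' => /eqP; rewrite eqseq_cat ?s1 ?s1' // => /andP[/eqP e1 /eqP[e2 e3 e4]].
  rewrite e2 e3 in im'; have [eC eD] := fomin_image_inj tR sR bd bd' im im'.
  by rewrite EV EV' e1 e4 eC eD.
transitivity (\sum_(V <- enumset A) schur_tensor (size g) (map shape (h V))).
  rewrite -big_filter (perm_big (enumset A)) /=; last first.
    apply: uniq_perm; rewrite ?filter_uniq ?enumset_uniq // => V; rewrite mem_filter.
    apply/idP/idP => [/andP[/andP[sz ft] /(mem_enumset _ fin) f]|/(mem_enumset _ finA)[f sz ft]].
      by apply/mem_enumset.
    by rewrite sz ft; apply/mem_enumset.
  apply: eq_big_seq => V /(mem_enumset _ finA)/prep[W1 [C [D [W2 [[-> s1 tR sR]]]]]].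
  move=> [tC tD sD [aC aD] ft]; rewrite FE // hE //.
  have [rE _ _] := row_of_merged tR sR tC tD sD aC aD ft; set V' := tmul _ _ in rE *.
  have tV : tab V' by do 2!apply: tab_tmul.
  (* The diagram always lists its first [a] rows, even empty ones, so its shape may end in zeros;
     these do not change s_I. *)
  have [z ->] : exists z, shape (around a C R D) = shape V' ++ nseq z 0%N.
    apply: nth_eq_pad => [y|]; first by rewrite !nth_shape rE.
    by case/andP: (partition_shape tV).
  by rewrite /lab label_trailing ?kg // map_cat.
apply: (sum_enumset_bij (fun W => schur_tensor (size g) (map shape W))) => //.
move=> V V' /prep[W1 [C [D [W2 [[-> s1 tR sR] [tC tD sD [aC aD] ft]]]]]].
move=> /prep[W1' [C' [D' [W2' [[-> s1' _ _] [tC' tD' sD' [aC' aD'] ft']]]]]].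
rewrite !hE // => /eqP; rewrite eqseq_cat ?s1 ?s1' // => /andP[/eqP -> /eqP[EV ->]].
have [_ dr tk] := row_of_merged tR sR tC tD sD aC aD ft.
have [_ dr' tk'] := row_of_merged tR sR tC' tD' sD' aC' aD' ft'.
have -> : C = C' by rewrite -dr EV dr'.
have -> // : D = D'.
have [nD _ _] := tablP _ _ tD; have [nD' _ _] := tablP _ _ tD'.
apply: row_of_ext => // y; have : join R D = join R D' by rewrite -tk EV tk'.
move=> /(congr1 (fun J => row_of J y)); rewrite !row_of_join => /eqP.
by rewrite eqseq_cat // => /andP[_ /eqP].
Qed.
End Facs.

(** * Existence of path polynomials and the final count *)

Lemma walk_cons n v s g : walk n v (s :: g) = okv n (move v s) && walk n (move v s) g.
Proof. by rewrite /walk /= andbA. Qed.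

Lemma walk_peak n g1 g2 : walk n (0, 0)%N (g1 ++ Up :: Down :: g2) =
  ((endpoint g1).1 < (endpoint g1).2)%N && walk n (0, 0)%N (g1 ++ Horiz :: g2).
Proof.
rewrite !walk_cat -/(endpoint g1) andbCA; congr (_ && _); rewrite !walk_cons /=.
rewrite andbA; case: (walk _ _ g2); rewrite ?andbT ?andbF // /okv /=; lia.
Qed.

Lemma walk_valley n g1 g2 : walk n (0, 0)%N (g1 ++ Down :: Up :: g2) =
  walk n (0, 0)%N (g1 ++ Horiz :: g2).
Proof.
rewrite !walk_cat -/(endpoint g1); congr (_ && _); rewrite !walk_cons /=.
rewrite andbA; case: (walk _ _ g2); rewrite ?andbT ?andbF // /okv /=; lia.
Qed.

Lemma path_poly_walk n r g P : @path_poly n r g P -> walk n (0, 0)%N g.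
Proof.
elim=> [|g1 g2 {}P lt _ w|g1 g2 {}P i j _ w]; first exact: walk_lowest.
  by rewrite walk_peak lt.
by rewrite -walk_valley.
Qed.

Lemma walk_valley_lowest n p q : walk n (0, 0)%N (nseq p Down ++ nseq q Up) ->
  nseq p Down ++ nseq q Up = lowest_path n.
Proof.
rewrite /walk => /andP[_]; rewrite foldl_cat.
have -> : foldl move (0, 0)%N (nseq p Down) = (0, p)%N.
  suff H i j : foldl move (i, j) (nseq p Down) = (i, j + p)%N by rewrite H add0n.
  by elim: p j => [|p IH] j /=; rewrite ?addn0 // IH addSnnS.
suff H i j : foldl move (i, j) (nseq q Up) = (i + q, j)%N.
  by rewrite H add0n => /eqP[-> ->].
by elim: q i => [|q IH] i /=; rewrite ?addn0 // IH addSnnS.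
Qed.

(** Excludes the default value 0 of [xget] in [P_of]. Removing a peak lowers the height, and a path
    without peaks is the lowest one. *)
Lemma path_poly_exists n r g : walk n (0, 0)%N g -> exists P, @path_poly n r g P.
Proof.
have [N] := ubnP (height g); elim: N g => // N IH g hN w.
case: (peak_or_valley id g) => [[g1 [h [g2 [+ Eg]]]]|[p [q Eg]]]; last first.
  rewrite map_id in Eg; rewrite Eg in w *; rewrite (walk_valley_lowest w).
  by exists 1; exact: path_poly_lowest.
rewrite map_id => -[] eh; rewrite {}Eg {}eh /= in hN w *.
  rewrite walk_peak in w; case/andP: w => lt w.
  have [|P hP] := IH _ _ w; last by eexists; exact: path_poly_split lt hP.
  by move: hN; rewrite !height_cat /=; clear; lia.
rewrite -walk_valley in w; have [|P hP] := IH _ _ w; last by eexists; exact: path_poly_merge hP.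
by move: hN; rewrite !height_cat /=; clear; lia.
Qed.

Lemma card_uniq_seq (A : choiceType) (s : seq A) (Q : set A) : uniq s ->
  (forall x, Q x <-> x \in s) -> Q #= `I_(size s).
Proof.
move=> us h; have -> : Q = [set` [fset x in s]%fset].
  by apply/seteqP; split=> x /=; rewrite inE /= => /h.
by apply/card_eq_fsetP; rewrite card_fseq undup_id.
Qed.

Theorem theorem12 (n : nat) (r : nat -> nat -> nat)
  (hn : (1 <= n)%N) (hr : rank_conditions n r)
  (hfomin :
    forall T : nat -> nat -> diagram, tableau_diagram n r T ->
    forall g1 g2 : seq step, is_path n (g1 ++ Down :: Up :: g2) ->
    let i := (endpoint g1).1 in
    let j := (endpoint g1).2.+1 in
    let a := rect_rows r i j in
    let b := rect_cols r i j in
    forall (W1 W2 : seq diagram) (X Y : diagram),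
      size W1 = size g1 ->
      factor_seq n T (g1 ++ Down :: Up :: g2) (W1 ++ X :: Y :: W2) ->
      (size Y <= a)%N ->
      entries_above (T i j) X -> entries_above (T i j) Y ->
      ~ fits_around a X (T i j) Y ->
      schur_nonzero (around a X (T i j) Y) ->
      forall X' Y' : diagram, fomin_around a b X Y X' Y' ->
      factor_seq n T (g1 ++ Down :: Up :: g2) (W1 ++ X' :: Y' :: W2)) :
  forall T : nat -> nat -> diagram, tableau_diagram n r T ->
  forall g : seq step, is_path n g ->
  forall mu : seq (seq nat), size mu = size g -> all is_partition mu ->
  exists N : nat,
    [set W : seq diagram | factor_seq n T g W /\ map shape W = mu] #= `I_N
    /\ c_of n r g mu = N%:Z.
Proof.
move=> T hT g /is_pathP w mu _ _.
(* Every polynomial that the rules produce is the sum over factor sequences, whichever lower paths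
   were chosen; so the choice made by [xget] is immaterial. *)
have ex g' P : @path_poly n r g' P -> expansion n T P.
  elim=> [|g1 g2 {}P lt _ IH|g1 g2 {}P i j hP IH].
  - exact: expansion_lowest.
  - exact: (expansion_split hT lt IH).
  apply: (expansion_merge hr hT) => // W1 W2 X Y s1 f sY aX aY nf nz X' Y' fa.
  by apply: (hfomin T hT g1 g2 _ W1 W2 X Y) => //; apply/is_pathP; exact: path_poly_walk hP.
have [P hP] := path_poly_exists r w.
have [fin EP] : expansion n T (P_of n r g).
  by rewrite /P_of; case: xgetP => [P' _|/(_ P)//]; exact: ex.
exists (count (fun W => map shape W == mu) (enumset (facs n T g))); split.
  rewrite -size_filter; apply: card_uniq_seq; first by rewrite filter_uniq // enumset_uniq.
  move=> W; rewrite mem_filter; split=> [[f <-]|/andP[/eqP <- /(mem_enumset _ fin)] f] //.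
  by rewrite eqxx; apply/mem_enumset.
rewrite /c_of EP -(big_map (map shape) predT (schur_tensor (size g))).
by rewrite (schur_coef_formal mu (facs_labels hT fin)) count_map.
Qed.
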